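(* Let $A$ be an integral domain, $F\in A\setminus\{0\}$, and $c>0$ an integer, and let $B=A[Z]/(Z^c-F)$, where $A[Z]$ is the polynomial ring in one variable over $A$. Assume there exists a $\mathbb{Z}$-grading of $A$ such that $F$ is homogeneous and $\gcd(c,\deg F)=1$. Then $B$ is an integral domain and $\mathrm{frac}(B)\cong\mathrm{frac}(A)$ (as abstract fields). Moreover, if $F$ is a prime element of $A$, then: (a) $A$ is a Krull domain if and only if $B$ is a Krull domain; (b) if $A$ and $B$ are Krull domains, then $\mathrm{Cl}(B)$ is a direct summand of $\mathrm{Cl}(A)\oplus\mathrm{Cl}(A)$ and $\mathrm{Cl}(A)$ is a direct summand of $\mathrm{Cl}(B)\oplus\mathrm{Cl}(B)$; moreover, if one of $\mathrm{Cl}(A),\mathrm{Cl}(B)$ is finitely generated then $\mathrm{Cl}(A)\cong\mathrm{Cl}(B)$; (c) $A$ is a UFD if and only if $B$ is a UFD.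
   Context: $\mathrm{Cl}(R)$ denotes the divisor class group of a Krull domain $R$. $\mathrm{frac}(R)$ is the field of fractions of the domain $R$. *)

(* Defs.v *)
From Stdlib Require List.
From HB Require Import structures.
From mathcomp Require Import all_boot all_order all_algebra.
Set Implicit Arguments. Unset Strict Implicit. Unset Printing Implicit Defensive.
Import Order.TTheory GRing.Theory Num.Theory.
Local Open Scope ring_scope.

Section RingNotions.
Variable R : comPzRingType.

Definition is_domain : Prop :=
  (1 != 0 :> R) /\ forall x y : R, x * y = 0 -> x = 0 \/ y = 0.

Definition is_unit (x : R) : Prop := exists y, x * y = 1.
Definition divides (x y : R) : Prop := exists q, y = q * x.

Definition prime_elt (p : R) : Prop :=
  p != 0 /\ ~ is_unit p /\
  forall x y, divides p (x * y) -> divides p x \/ divides p y.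

Definition irreducible_elt (p : R) : Prop :=
  p != 0 /\ ~ is_unit p /\ forall a b, p = a * b -> is_unit a \/ is_unit b.

Definition is_UFD : Prop :=
  is_domain /\
  (forall x : R, x != 0 -> ~ is_unit x ->
     exists s : seq R, List.Forall irreducible_elt s /\ x = \prod_(y <- s) y) /\
  (forall s t : seq R, List.Forall irreducible_elt s -> List.Forall irreducible_elt t ->
     \prod_(y <- s) y = \prod_(y <- t) y ->
     size s = size t /\
     exists u : seq R, List.Forall is_unit u /\ size u = size s /\
       perm_eq [seq p.1 * p.2 | p <- zip u s] t).

Definition is_frac_field (K : fieldType) (f : {rmorphism R -> K}) : Prop :=
  injective f /\ forall k : K, exists a b : R, f b != 0 /\ k = f a / f b.

(* Krull domain: R = intersection of a family of DVRs of frac(R) (given by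
   normalized discrete valuations K^x -> Z), with finite character. *)
Definition is_dval (K : fieldType) (w : K -> int) : Prop :=
  (forall x y : K, x != 0 -> y != 0 -> w (x * y) = w x + w y) /\
  (forall x y : K, x != 0 -> y != 0 -> x + y != 0 ->
     Num.min (w x) (w y) <= w (x + y)) /\
  (exists x : K, x != 0 /\ w x = 1).

Definition is_Krull : Prop :=
  exists (K : fieldType) (f : {rmorphism R -> K}), is_frac_field f /\
  exists (I : Type) (v : I -> K -> int),
    (forall i, is_dval (v i)) /\
    (forall x : K, x != 0 -> exists s : seq I, forall i, v i x != 0 -> List.In i s) /\
    (forall x : K, x != 0 -> ((exists r : R, x = f r) <-> forall i, 0 <= v i x)).

Definition ideal (P : R -> Prop) : Prop :=
  P 0 /\ (forall x y, P x -> P y -> P (x + y)) /\ (forall r x, P x -> P (r * x)).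

Definition prime_ideal (P : R -> Prop) : Prop :=
  ideal P /\ ~ P 1 /\ forall x y, P (x * y) -> P x \/ P y.

Definition height_one (P : R -> Prop) : Prop :=
  prime_ideal P /\ (exists x, x != 0 /\ P x) /\
  forall Q : R -> Prop, prime_ideal Q -> (exists x, x != 0 /\ Q x) ->
    (forall x, Q x -> P x) -> forall x, P x -> Q x.

Fixpoint pow_ideal (P : R -> Prop) (n : nat) : R -> Prop :=
  match n with
  | 0 => fun _ => True
  | n'.+1 => fun x => exists s : seq (R * R),
      List.Forall (fun p => P p.1 /\ pow_ideal P n' p.2) s /\
      x = \sum_(p <- s) p.1 * p.2
  end.

(* x lies in the n-th symbolic power P^(n) = P^n R_P ∩ R *)
Definition symb_pow (P : R -> Prop) (n : nat) (x : R) : Prop :=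
  exists s : R, ~ P s /\ pow_ideal P n (s * x).

(* v_P(x) = n, v_P the valuation of R_P *)
Definition ord_is (P : R -> Prop) (x : R) (n : nat) : Prop :=
  symb_pow P n x /\ ~ symb_pow P n.+1 x.

Definition is_divisor (D : (R -> Prop) -> int) : Prop :=
  (forall P, ~ height_one P -> D P = 0) /\
  exists s : seq (R -> Prop), forall P, D P != 0 -> List.In P s.

(* principal divisors div(a/b) = div(a) - div(b), a, b nonzero in R *)
Definition is_principal (D : (R -> Prop) -> int) : Prop :=
  exists a b : R, a != 0 /\ b != 0 /\
  forall P, height_one P ->
    exists n m : nat, ord_is P a n /\ ord_is P b m /\ D P = n%:Z - m%:Z.

(* G is (isomorphic to) the divisor class group Cl(R) = Div(R)/Prin(R):
   phi is a surjective group morphism Div(R) -> G with kernel Prin(R). *)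
Definition class_group_iso (G : zmodType) : Prop :=
  exists phi : ((R -> Prop) -> int) -> G,
    (forall D1 D2, is_divisor D1 -> is_divisor D2 ->
        phi (fun P => D1 P + D2 P) = phi D1 + phi D2) /\
    (forall g : G, exists D, is_divisor D /\ phi D = g) /\
    (forall D, is_divisor D -> (phi D = 0 <-> is_principal D)).

End RingNotions.

Definition grp_iso (G H : zmodType) : Prop :=
  exists f : G -> H, (forall x y, f (x + y) = f x + f y) /\ bijective f.

Definition fin_gen (G : zmodType) : Prop :=
  exists s : seq G, forall g : G, exists k : seq int,
    g = \sum_(i < size s) s`_i *~ k`_i.

Definition peval (A : idomainType) (B : comPzRingType)
  (iota : {rmorphism A -> B}) (z : B) (p : {poly A}) : B :=
  \sum_(i < size p) iota p`_i * z ^+ i.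

(* the A-algebra map A[Z] -> B, Z |-> z, is surjective with kernel (Z^c - F) *)
Definition presents (A : idomainType) (B : comPzRingType)
  (iota : {rmorphism A -> B}) (z : B) (c : nat) (F : A) : Prop :=
  (forall b : B, exists p : {poly A}, b = peval iota z p) /\
  (forall p : {poly A}, peval iota z p = 0 <-> exists q, p = q * ('X^c - F%:P)).

Definition Zgrading (A : idomainType) (Ad : int -> A -> Prop) : Prop :=
  (forall d, Ad d 0 /\ forall x y, Ad d x -> Ad d y -> Ad d (x - y)) /\
  (forall d e x y, Ad d x -> Ad e y -> Ad (d + e) (x * y)) /\
  (forall x : A, exists (s : seq int) (comp : int -> A),
      (forall d, Ad d (comp d)) /\ x = \sum_(d <- s) comp d) /\
  (forall s : seq int, uniq s -> forall comp : int -> A,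
      (forall d, Ad d (comp d)) -> \sum_(d <- s) comp d = 0 ->
      forall d, d \in s -> comp d = 0).

(* Main.v *)
(* B is graded by giving z the degree d = deg F and an element of A of degree n
   the degree c n; since gcd(c, d) = 1, every homogeneous element of B is a z^j
   with a homogeneous in A. Multiplying degrees by c through an element u of
   degree c - 1 embeds B in frac A, and a suitable u of the form F^p w^q makes
   the image generate frac A. If F is prime, the homogeneous valuations of A
   extend to B with v(z) = v(F) / c, and the valuations of A that are trivial on
   homogeneous elements are pulled back along the embedding B -> frac A; together
   they define B, so B is Krull if A is. For class groups, every divisor class of
   a graded Krull domain contains a homogeneous divisor, and relations between
   homogeneous divisors are given by homogeneous elements. Multiplication by z^j
   changes no class, so extension of divisorial ideals from A to B induces an
   isomorphism Cl(A) = Cl(B), which is stronger than (b). Finally a domain is a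
   UFD if and only if it is Krull with trivial class group. *)
From Stdlib Require List.
Require Import Defs.
From HB Require Import structures.
From mathcomp Require Import all_boot all_order all_algebra.
From mathcomp Require Import boolp classical_sets functions zify ring.
Set Implicit Arguments. Unset Strict Implicit. Unset Printing Implicit Defensive.
Import Order.TTheory GRing.Theory Num.Theory.
Local Open Scope ring_scope.

(** The obstacle to the embedding is that the degrees occurring in A may all lie in some mZ, so that
    no fraction of degree c - 1 exists. Degrees are therefore first divided by the least positive
    difference m of degrees of nonzero homogeneous elements; m divides deg F, so coprimality with c
    survives. If only one degree occurs it is 0, and then gcd(c, 0) = 1 forces c = 1.

    The degree c - 1 is chosen because a of degree n is sent to a u^n, which then has degree c n.
    Since gcd(c, d) = 1, the degrees c n + d j with j < c are pairwise distinct, and this gives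
    injectivity on B.

    Primality of F enters twice. It bounds v_P(F) by 1, so that j v_P(F) / c stays below 1 for j < c
    and divisibility among the a z^j reduces to comparisons of integers; and it makes z prime in B,
    so that powers of z affect divisors only at (z).

    Divisorial ideals are handled through arbitrary generating sets and the test [vle], so that
    extension from A to B is just the image of a set. *)

Lemma In_sum_lt (I : Type) (s : seq I) (f g : I -> nat) (i : I) :
  (forall j, (f j <= g j)%N) -> List.In i s -> (f i < g i)%N ->
  (\sum_(j <- s) f j < \sum_(j <- s) g j)%N.
Proof.
move=> fg; elim: s => //= j s IH [->|hi] lt; rewrite !big_cons.
  by rewrite -addSn leq_add // leq_sum.
by rewrite -addnS leq_add // IH.
Qed.

Lemma In_map (I J : Type) (f : I -> J) (s : seq I) (i : I) :
  List.In i s -> List.In (f i) (map f s).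
Proof. by elim: s => //= j s IH [->|/IH]; [left | right]. Qed.

Lemma In_cat (I : Type) (s t : seq I) (i : I) :
  List.In i s \/ List.In i t -> List.In i (s ++ t).
Proof.
elim: s => [|j s IH] /=; first by case.
by case=> [[->|h]|h]; [left | right; apply: IH; left | right; apply: IH; right].
Qed.

Lemma min_nat (P : nat -> Prop) :
  (exists n, P n) -> exists n, P n /\ forall m, P m -> (n <= m)%N.
Proof.
move=> [n Pn]; have ex : exists n, `[< P n >] by exists n; apply/asboolP.
case: (ex_minnP ex) => m /asboolP Pm mP.
by exists m; split=> // k Pk; apply: mP; apply/asboolP.
Qed.

(* junk value 0 if S is empty *)
Definition mins (S : nat -> Prop) : nat := xget 0%N [set n | S n /\ forall m, S m -> (n <= m)%N].

Lemma minsP (S : nat -> Prop) : (exists n, S n) ->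
  S (mins S) /\ forall m, S m -> (mins S <= m)%N.
Proof. by move=> /min_nat [n hn]; rewrite /mins; case: xgetP => [//|/(_ n)]. Qed.

(** * Valuations and height-one primes of a Krull domain *)

Section Domain.
Variable R : idomainType.
Implicit Types (P Q : R -> Prop) (x y a b s t p : R).

Lemma divides_refl x : divides x x.
Proof. by exists 1; rewrite mul1r. Qed.

Lemma divides_mull x y a : divides x y -> divides x (a * y).
Proof. by case=> q ->; exists (a * q); rewrite mulrA. Qed.

Lemma divides_mulr x y a : divides x y -> divides x (y * a).
Proof. by rewrite mulrC; apply: divides_mull. Qed.

Lemma divides_trans x y a : divides x y -> divides y a -> divides x a.
Proof. by move=> xy [q ->]; apply: divides_mull. Qed.

Lemma divides_add x y a : divides x y -> divides x a -> divides x (y + a).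
Proof. by case=> q -> [r ->]; exists (q + r); rewrite mulrDl. Qed.

Lemma divides0 x : divides x 0.
Proof. by exists 0; rewrite mul0r. Qed.

Lemma divides_sum x (I : Type) (r : seq I) (h : I -> R) :
  (forall i, divides x (h i)) -> divides x (\sum_(i <- r) h i).
Proof.
move=> hx; apply: big_ind => //; [exact: divides0 | exact: divides_add].
Qed.

Lemma divides_pmul2l x y a : a != 0 -> divides (a * x) (a * y) -> divides x y.
Proof.
move=> a0 [q e]; exists q; apply: (mulfI a0); rewrite e; ring.
Qed.

Lemma divides_mul2l x y a : divides x y -> divides (a * x) (a * y).
Proof. by case=> q ->; exists q; ring. Qed.

(** No normalization is demanded, so the zero function counts as a valuation; it fills in for
    indices that carry no prime. *)
Definition is_val (v : R -> nat) : Prop :=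
  (forall x y, x != 0 -> y != 0 -> v (x * y) = (v x + v y)%N) /\
  (forall x y, x != 0 -> y != 0 -> x + y != 0 -> (minn (v x) (v y) <= v (x + y)%R)%N).

(* Values at [0] are junk; [vge v n x] reads v(x) >= n with v(0) infinite. *)
Definition vge (v : R -> nat) (n : nat) x : Prop := x != 0 -> (n <= v x)%N.

Section Val.
Variables (v : R -> nat) (hv : is_val v).

Lemma valM x y : x != 0 -> y != 0 -> v (x * y) = (v x + v y)%N.
Proof. by case: hv => h _; apply: h. Qed.

Lemma val1 : v 1 = 0%N.
Proof. by apply: (@addnI (v 1)); rewrite -valM ?oner_neq0 // mulr1 addn0. Qed.

Lemma valX x n : x != 0 -> v (x ^+ n) = (n * v x)%N.
Proof.
move=> x0; elim: n => [|n IH]; first by rewrite expr0 val1.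
by rewrite exprS valM ?expf_neq0 // IH mulSn.
Qed.

Lemma vgeD n x y : vge v n x -> vge v n y -> vge v n (x + y).
Proof.
move=> hx hy; have [->|x0] := eqVneq x 0; first by rewrite add0r.
have [->|y0] := eqVneq y 0; first by rewrite addr0.
by move=> xy0; case: hv => _ /(_ x y x0 y0 xy0); have := hx x0; have := hy y0; lia.
Qed.

Lemma vge0 n : vge v n 0.
Proof. by rewrite /vge eqxx. Qed.

Lemma vge_sum n (I : Type) (r : seq I) (h : I -> R) :
  (forall i, vge v n (h i)) -> vge v n (\sum_(i <- r) h i).
Proof. by move=> hh; apply: big_ind => //; [exact: vge0 | exact: vgeD]. Qed.

Lemma vgeM n m x y : vge v n x -> vge v m y -> vge v (n + m) (x * y).
Proof.
move=> hx hy; rewrite /vge mulf_eq0 negb_or => /andP[x0 y0].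
by rewrite valM // leq_add ?hx ?hy.
Qed.

Lemma val_divides x y : y != 0 -> divides x y -> (v x <= v y)%N.
Proof.
move=> y0 [q e]; move: y0; rewrite e mulf_eq0 negb_or => /andP[q0 x0].
by rewrite valM // leq_addl.
Qed.

Definition center x := x = 0 \/ (0 < v x)%N.

Lemma center_vge x : center x <-> vge v 1 x.
Proof.
split=> [[->|h]|]; [exact: vge0 | by [] | move=> h].
by have [->|x0] := eqVneq x 0; [left | right; apply: h].
Qed.

Lemma center_prime : prime_ideal center.
Proof.
split; first split; first by left.
  split=> [x y /center_vge hx /center_vge hy|r x /center_vge hx].
    by apply/center_vge; apply: vgeD.
  by apply/center_vge; rewrite -[1%N]add0n; apply: vgeM.
split=> [[/eqP|]|x y].
- by rewrite oner_eq0.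
- by rewrite val1.
move=> /center_vge h; have [->|x0] := eqVneq x 0; first by left; left.
have [->|y0] := eqVneq y 0; first by right; left.
have := h (mulf_neq0 x0 y0); rewrite valM //.
by case: (posnP (v x)) => [-> ?|? _]; [right | left]; right.
Qed.

End Val.

Lemma is_val0 : is_val (fun=> 0%N).
Proof. by split. Qed.

Section Primes.
Variables (P : R -> Prop) (hP : prime_ideal P).

Lemma prime_mul_notin x y : ~ P x -> ~ P y -> ~ P (x * y).
Proof. by case: hP => _ [_ h] hx hy /h []. Qed.

Lemma ideal_mulr x y : P x -> P (y * x).
Proof. by case: hP => [[_ [_ h]] _]; apply: h. Qed.

Lemma ideal_mull x y : P x -> P (x * y).
Proof. by rewrite mulrC; apply: ideal_mulr. Qed.

Lemma ideal_divides x y : divides x y -> P x -> P y.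
Proof. by case=> q -> /ideal_mulr. Qed.

Lemma notin_neq0 x : ~ P x -> x != 0.
Proof. by move=> h; apply/eqP => x0; apply: h; rewrite x0; case: hP => [[]]. Qed.

Lemma prime_exp x n : P (x ^+ n) -> P x.
Proof.
elim: n => [|n IH]; first by rewrite expr0; case: hP => _ [h _] /h.
by rewrite exprS; case: hP => _ [_ h] /h [] // /IH.
Qed.

End Primes.

(* The localisation of R at P is a discrete valuation ring with uniformizer p. *)
Definition unif P p : Prop :=
  prime_ideal P /\ P p /\ p != 0 /\
  forall x, x != 0 -> exists n s t, ~ P s /\ ~ P t /\ s * x = t * p ^+ n.

Section Unif.
Variables (P : R -> Prop) (p : R) (hu : unif P p).
Let hP : prime_ideal P := hu.1.

(** In the localisation at P the prime is generated by p, so its m-th power is generated by p^m, and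
    s collects the denominators. A sum of products is treated term by term, the product of the
    multipliers staying outside P. *)
Lemma symb_powP m x :
  symb_pow P m x <-> exists s, ~ P s /\ divides (p ^+ m) (s * x).
Proof.
have [_ [Pp [p0 hx]]] := hu.
split.
  case=> s [Ps sx]; suff [t [Pt d]] : exists t, ~ P t /\ divides (p ^+ m) (t * (s * x)).
    by exists (t * s); split; [exact: prime_mul_notin | rewrite -mulrA].
  move: (s * x) sx => {s Ps} {}x; elim: m x => [|m IH] x.
    by exists 1; split; [case: hP => _ [] | exists (1 * x); rewrite expr0 mulr1].
  move=> /= [l [hl ->]]; elim: hl => [|[a b] l' [/= Pa /IH hb] _ [t [Pt d]]].
    by exists 1; split; [case: hP => _ [] | rewrite big_nil mulr0; apply: divides0].
  rewrite big_cons; have [s [Ps ds]] := hb.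
  have [s' [Ps' ds']] : exists s', ~ P s' /\ divides p (s' * a).
    have [->|a0] := eqVneq a 0.
      by exists 1; split; [case: hP => _ [] | rewrite mulr0; apply: divides0].
    have [[|n] [s' [t' [Ps' [Pt' e]]]]] := hx a a0.
      by case: Pt'; rewrite -[t']mulr1 -[1](expr0 p) -e; apply: ideal_mulr.
    by exists s'; split=> //; exists (t' * p ^+ n); rewrite e exprSr mulrA.
  exists (t * (s * s')); split; first by do !apply: prime_mul_notin.
  rewrite mulrDr; apply: divides_add.
    have -> : t * (s * s') * (a * b) = t * ((s' * a) * (s * b)) by ring.
    apply: divides_mull; rewrite exprS; apply: (@divides_trans _ (p * (s * b))).
      exact: divides_mul2l.
    by rewrite mulrC [X in divides _ X]mulrC; apply: divides_mul2l.
  by rewrite [t * _]mulrC -mulrA; apply: divides_mull.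
case=> s [Ps [q e]]; exists s; split=> //; rewrite {}e.
elim: m q => [|m IH] q //=; exists [:: (p, q * p ^+ m)]; split.
  by constructor; [split=> //=; exact: IH | constructor].
by rewrite big_seq1 /= exprS; ring.
Qed.

Lemma unif_symb_pow n s t x m : ~ P s -> ~ P t -> s * x = t * p ^+ n ->
  symb_pow P m x <-> (m <= n)%N.
Proof.
move=> Ps Pt e; have [_ [Pp [p0 _]]] := hu; split.
  case/symb_powP=> r [Pr d]; rewrite leqNgt; apply/negP => lt.
  have : divides (p ^+ m) (s * (r * x)) by apply: divides_mull.
  have -> : s * (r * x) = p ^+ n * (r * t) by rewrite mulrCA e; ring.
  rewrite -(subnKC lt) addSnnS exprD => /divides_pmul2l -/(_ (expf_neq0 _ p0)).
  rewrite exprS => d'; have : P (r * t).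
    by apply: (ideal_divides hP d'); apply: ideal_mull.
  exact: prime_mul_notin.
move=> le; apply/symb_powP; exists s; split=> //; rewrite e.
by rewrite -(subnK le) exprD mulrA; apply: divides_mull; apply: divides_refl.
Qed.

Lemma unif_ord_is n s t x m : ~ P s -> ~ P t -> s * x = t * p ^+ n ->
  ord_is P x m <-> m = n.
Proof.
move=> Ps Pt e; have h k := unif_symb_pow k Ps Pt e.
rewrite /ord_is !h; split=> [[le /negP]|->]; first by lia.
by split=> //; apply/negP; lia.
Qed.

End Unif.

(** Read off from [ord_is], so the value involves no choice of a uniformizer; the junk value is
    0. *)
Definition ord P x : nat :=
  if pselect (exists n, ord_is P x n) is left h then projT1 (cid h) else 0%N.

Section UnifOrd.
Variables (P : R -> Prop) (p : R) (hu : unif P p).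
Let hP : prime_ideal P := hu.1.

Lemma ordE n s t x : ~ P s -> ~ P t -> s * x = t * p ^+ n -> ord P x = n.
Proof.
move=> Ps Pt e; rewrite /ord; case: pselect => [h|[]].
  by case: cid => /= m /(unif_ord_is hu m Ps Pt e).
by exists n; apply/(unif_ord_is hu n Ps Pt e).
Qed.

Lemma ord_spec x : x != 0 ->
  exists s t, ~ P s /\ ~ P t /\ s * x = t * p ^+ ord P x.
Proof.
move=> x0; have [_ [_ [_ /(_ x x0) [n [s [t [Ps [Pt e]]]]]]]] := hu.
by exists s, t; rewrite (ordE Ps Pt e).
Qed.

Lemma ord_isP x n : x != 0 -> ord_is P x n <-> n = ord P x.
Proof. by case/ord_spec=> s [t [Ps [Pt e]]]; apply: (unif_ord_is hu n Ps Pt e). Qed.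

Lemma notin1 : ~ P 1.
Proof. by case: hP => _ []. Qed.

Lemma ord_unif : ord P p = 1%N.
Proof. by apply: (@ordE _ 1 1); rewrite ?expr1 //; exact: notin1. Qed.

Lemma ord_notin x : ~ P x -> ord P x = 0%N.
Proof. by move=> Px; apply: (@ordE _ 1 x) => //; [exact: notin1 | rewrite expr0; ring]. Qed.

Lemma ord_gt0 x : x != 0 -> P x <-> (0 < ord P x)%N.
Proof.
move=> x0; split; last by case: (pselect (P x)) => // /ord_notin ->.
have [s [t [Ps [Pt e]]]] := ord_spec x0.
case: (ord P x) e => // e Px; case: Pt.
by rewrite -[t]mulr1 -[1](expr0 p) -e; apply: ideal_mulr.
Qed.

Lemma is_val_ord : is_val (ord P).
Proof.
have [_ [Pp [p0 _]]] := hu; split=> x y x0 y0.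
  have [s [t [Ps [Pt e]]]] := ord_spec x0.
  have [s' [t' [Ps' [Pt' e']]]] := ord_spec y0.
  apply: (@ordE _ (s * s') (t * t')); try exact: prime_mul_notin.
  by rewrite mulrACA e e' exprD; ring.
move=> xy0; set n := minn _ _.
have ge z : z != 0 -> (n <= ord P z)%N -> symb_pow P n z.
  move=> z0 le; have [s [t [Ps [Pt e]]]] := ord_spec z0.
  by apply/(unif_symb_pow hu n Ps Pt e).
have /(symb_powP hu) [s [Ps ds]] := ge _ x0 (geq_minl _ _).
have /(symb_powP hu) [t [Pt dt]] := ge _ y0 (geq_minr _ _).
have : symb_pow P n (x + y).
  apply/(symb_powP hu); exists (s * t); split; first exact: prime_mul_notin.
  have -> : s * t * (x + y) = t * (s * x) + s * (t * y) by ring.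
  by apply: divides_add; apply: divides_mull.
have [s' [t' [Ps' [Pt' e]]]] := ord_spec xy0.
by move/(unif_symb_pow hu n Ps' Pt' e).
Qed.

(** A nonzero prime Q inside P contains some b with s b = t p^n and t outside P, hence outside Q; so
    Q contains p, and then every x in P by the same relation for x. *)
Lemma unif_height_one : height_one P.
Proof.
have [_ [Pp [p0 hx]]] := hu; split=> //; split; first by exists p.
move=> Q hQ [b [b0 Qb]] QP.
have Qp : Q p.
  have [n [s [t [Ps [Pt e]]]]] := hx b b0.
  have : Q (t * p ^+ n) by rewrite -e; apply: ideal_mulr.
  by case: (hQ) => _ [_ h] /h [/QP//|]; apply: prime_exp.
move=> x Px; have [->|x0] := eqVneq x 0; first by case: hQ => [[]].
have [[|n] [s [t [Ps [Pt e]]]]] := hx x x0.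
  by case: Pt; rewrite -[t]mulr1 -[1](expr0 p) -e; apply: ideal_mulr.
have : Q (s * x) by rewrite e exprS; apply: ideal_mulr => //; apply: ideal_mull.
by case: (hQ) => _ [_ h] /h [/QP//|].
Qed.

End UnifOrd.

(** The condition that R is the intersection of the valuation rings is phrased as divisibility in R,
    which avoids the fraction field. *)
Definition krull_family (I : Type) (v : I -> R -> nat) : Prop :=
  (forall i, is_val (v i)) /\
  (forall x, x != 0 -> exists s : seq I, forall i, v i x != 0%N -> List.In i s) /\
  (forall x y, x != 0 -> y != 0 -> (forall i, (v i x <= v i y)%N) -> divides x y).

Section KrullFamily.
Variables (I : Type) (v : I -> R -> nat) (kv : krull_family v).
Let hv i : is_val (v i) := kv.1 i.

(* The conductor of a suitable multiple x' of x into (y) is prime, and its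
   localisation is principal; x' is a multiple for which the total defect
   sum_i max(0, v_i y - v_i x') is minimal. *)
Lemma exists_unif_ord_lt x y : x != 0 -> y != 0 -> ~ divides y x ->
  exists P p, unif P p /\ (ord P x < ord P y)%N.
Proof.
move=> x0 y0 nyx; have [l hl] := kv.2.1 y y0.
pose mu z := (\sum_(i <- l) (v i y - v i z))%N.
have [m [[x' [x'0 [[r er] [nyx' mux']]]] min_m]] := @min_nat
  (fun n => exists x', x' != 0 /\ divides x x' /\ ~ divides y x' /\ mu x' = n)
  (ex_intro _ (mu x) (ex_intro _ x (conj x0 (conj (divides_refl x) (conj nyx erefl))))).
pose P a := divides y (a * x').
(* Otherwise a x' would be another multiple of x outside (y), with a smaller total defect. *)
have nP a : ~ P a -> forall i, (v i x' < v i y)%N -> v i a = 0%N.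
  move=> Pa i lt; have a0 : a != 0.
    by apply/eqP => a0; apply: Pa; rewrite a0 /P mul0r; apply: divides0.
  apply/eqP; rewrite -leqn0 leqNgt; apply/negP => ai.
  have : (mu (a * x')%R < mu x')%N.
    apply: (@In_sum_lt _ _ _ _ i) => [j|//|]; last by rewrite valM //; lia.
    - by rewrite valM // leq_sub2l // leq_addl.
    - by apply: hl; lia.
  rewrite mux' ltnNge => /negP; apply; apply: min_m.
  exists (a * x'); split; first exact: mulf_neq0.
  by split=> //; exists (a * r); rewrite er mulrA.
have primeP : prime_ideal P.
  split; first split; first by rewrite /P mul0r; apply: divides0.
    split=> [a b|a b] Pa; first by move=> Pb; rewrite /P mulrDl; apply: divides_add.
    by rewrite /P -mulrA; apply: divides_mull.
  split; first by rewrite /P mul1r.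
  move=> a b Pab; case: (pselect (P a)) => [|Pa]; [by left|right].
  have [->|b0] := eqVneq b 0; first by rewrite /P mul0r; apply: divides0.
  have a0 : a != 0.
    by apply/eqP => a0; apply: Pa; rewrite a0 /P mul0r; apply: divides0.
  apply: kv.2.2 => //; first exact: mulf_neq0.
  move=> i; rewrite valM //; case: (ltnP (v i x') (v i y)) => [lt|]; last by lia.
  have := val_divides (hv i) (mulf_neq0 (mulf_neq0 a0 b0) x'0) Pab.
  by rewrite !valM ?mulf_neq0 // (nP a).
have [i0 lt0] : exists i, (v i x' < v i y)%N.
  apply: contrapT => h; apply: nyx'; apply: kv.2.2 => // i.
  by rewrite leqNgt; apply/negP => lt; apply: h; exists i.
(* At i0 the value of y exceeds that of x'. An element a of P of least value at i0 has its cofactor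
   t outside P, since a x' = t y gives t a smaller value; this makes a a uniformizer. *)
have [n [[a [a0 [Pa na]]] min_n]] := @min_nat (fun n => exists a, a != 0 /\ P a /\ v i0 a = n)
  (ex_intro _ _ (ex_intro _ y (conj y0 (conj (divides_mulr x' (divides_refl y)) erefl)))).
case: (Pa) => t et; have t0 : t != 0.
  by apply/eqP => t0; have := mulf_neq0 a0 x'0; rewrite et t0 mul0r eqxx.
have v0 : (v i0 a + v i0 x' = v i0 t + v i0 y)%N by rewrite -!valM // et.
have Pt : ~ P t.
  by move=> Pt; have := min_n (v i0 t) (ex_intro _ t (conj t0 (conj Pt erefl))); lia.
(* If b is in P, say b x' = b' y, then t b = a b', and b' has a smaller value at i0 than b; hence
   the induction on that value. *)
have ua : unif P a.
  split=> //; split=> //; split=> // b; move: {2}(v i0 b).+1 (ltnSn (v i0 b)) => k.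
  elim: k b => // k IH b lt b0; case: (pselect (P b)) => Pb; last first.
    by exists 0%N, 1, b; split; [case: primeP => _ [] | rewrite expr0; split=> //; ring].
  case: (Pb) => b' eb; have b'0 : b' != 0.
    by apply/eqP => b'0; have := mulf_neq0 b0 x'0; rewrite eb b'0 mul0r eqxx.
  have e : t * b = a * b'.
    by apply: (mulIf y0); rewrite mulrAC -et -[RHS]mulrA -eb; ring.
  have vb : (v i0 b + v i0 x' = v i0 b' + v i0 y)%N by rewrite -!valM // eb.
  have lt' : (v i0 b' < k)%N by lia.
  have [j [s [t' [Ps [Pt' e']]]]] := IH b' lt' b'0.
  exists j.+1, (s * t), t'; split; first exact: prime_mul_notin.
  by split=> //; rewrite -mulrA e mulrCA e' exprS; ring.
have ho := is_val_ord ua.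
exists P, a; split=> //.
(* Orders in a x' = t y give ord y = ord x' + 1, while x divides x'. *)
have := valM ho a0 x'0; rewrite et valM // (ord_unif ua) (ord_notin ua Pt).
have : (ord P x <= ord P x')%N by apply: (val_divides ho x'0); exists r.
lia.
Qed.

(** The localisation at S is the intersection of the valuations trivial on S. Only the finitely many
    i with v_i(y) nonzero matter; at each one that is not trivial on S, some t in S has positive
    value and t^(v_i(y)) suffices. *)
Lemma clearing (S : R -> Prop) x y : S 1 -> (forall s, S s -> s != 0) ->
  (forall s t, S s -> S t -> S (s * t)) -> x != 0 -> y != 0 ->
  (forall i, (forall s, S s -> v i s = 0%N) -> (v i y <= v i x)%N) ->
  exists s, S s /\ divides y (s * x).
Proof.
move=> S1 S0 SM x0 y0 le; have [l hl] := kv.2.1 y y0.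
suff [s [Ss hs]] : exists s, S s /\ forall i, List.In i l -> (v i y <= v i (s * x)%R)%N.
  exists s; split=> //; apply: kv.2.2 => // [|i]; first by rewrite mulf_neq0 // S0.
  by case: (posnP (v i y)) => [->//|/lt0n_neq0/hl/hs].
elim: l {hl} => [|i l [s [Ss IH]]]; first by exists 1.
have [s' [Ss' hs']] : exists s', S s' /\ (v i y <= v i (s' * x)%R)%N.
  case: (pselect (forall s, S s -> v i s = 0%N)) => [h|].
    by exists 1; split=> //; rewrite mul1r le.
  move/existsNP=> [t /not_implyP [St /eqP ti]]; exists (t ^+ v i y); split.
    by elim: (v i y) => [|n IHn]; [rewrite expr0 | rewrite exprS; apply: SM].
  rewrite valM ?expf_neq0 ?valX //; try exact: S0.
  by apply: leq_trans (leq_addr _ _); rewrite leq_pmulr // lt0n.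
have [s0 s'0] := (S0 _ Ss, S0 _ Ss').
exists (s * s'); split; first exact: SM.
move=> j /= [<-|/IH h].
  by rewrite -mulrA valM ?mulf_neq0 //; apply: leq_trans (leq_addl _ _).
rewrite mulrAC valM ?mulf_neq0 //; apply: leq_trans (leq_addr _ _).
exact: h.
Qed.

(** [clearing] with S the complement of P yields a valuation trivial outside P and positive at b,
    since otherwise b would divide an element outside P. Its center is a nonzero prime inside P, so
    it equals P by minimality. *)
Lemma height_one_center P : height_one P -> exists i, P = center (v i).
Proof.
move=> [hP [[b [b0 Pb]] minP]].
have [i [hi bi]] : exists i, (forall s, ~ P s -> v i s = 0%N) /\ (0 < v i b)%N.
  apply: contrapT => h; case: (@clearing (fun s => ~ P s) 1 b) => //.
  - by case: hP => _ [].
  - exact: notin_neq0.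
  - exact: prime_mul_notin.
  - exact: oner_neq0.
  - by move=> i hi; rewrite leqNgt; apply/negP => lt; apply: h; exists i; split=> //; lia.
  by move=> s [Ps]; rewrite mulr1 => /(ideal_divides hP) /(_ Pb).
exists i; apply/funext => x; apply/propext; split; last first.
  case=> [->|xi]; first by case: hP => [[]].
  by apply: contrapT => /hi; lia.
apply: minP; first exact: center_prime.
  by exists b; split=> //; right.
move=> z [->|zi]; first by case: hP => [[]].
by apply: contrapT => /hi; lia.
Qed.

Lemma finite_height_one x : x != 0 ->
  exists l : seq (R -> Prop), forall P, height_one P -> P x -> List.In P l.
Proof.
move=> x0; have [l hl] := kv.2.1 x x0.
exists (map (fun i => center (v i)) l) => P /height_one_center [i ->].
case=> [e|xi]; first by rewrite e eqxx in x0.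
by apply: (In_map (fun i => center (v i))); apply: hl; lia.
Qed.

End KrullFamily.

(** The value 0 off the height-one primes allows the family to be indexed by all predicates on R. *)
Definition hord P : R -> nat := if pselect (height_one P) then ord P else fun=> 0%N.

Lemma hordE P x : height_one P -> hord P x = ord P x.
Proof. by rewrite /hord; case: pselect. Qed.

Definition Krull : Prop := exists (I : Type) (v : I -> R -> nat), krull_family v.

Hypothesis kR : Krull.

(** By [exists_unif_ord_lt] the orders at the primes that have a uniformizer already form a Krull
    family; every height-one prime is the center of a member of it, hence is one of these primes. *)
Lemma krull_unif P : height_one P -> exists p, unif P p.
Proof.
have [I [v kv]] := kR; move=> hP.
pose w Q := if pselect (exists p, unif Q p) then ord Q else fun=> 0%N.
have kw : krull_family w.
  split=> [Q|].
    by rewrite /w; case: pselect => [h|?]; [have [q hq] := h; exact: is_val_ord hq | exact: is_val0].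
  split=> [x x0|x y x0 y0 le].
    have [l hl] := finite_height_one kv x0; exists l => Q.
    rewrite /w; case: pselect => // h; have [q hq] := h; rewrite -lt0n => /(ord_gt0 hq x0).
    by apply: hl; apply: unif_height_one hq.
  apply: contrapT => /(exists_unif_ord_lt kv y0 x0) [Q [q [hq]]].
  by rewrite ltnNge; have := le Q; rewrite /w; case: pselect => [_ ->|[]]; last by exists q.
have [Q eP] := height_one_center kw hP.
move: eP; rewrite /w; case: pselect => [h eP|? eP]; last first.
  by have [_ [[x [x0 Px]] _]] := hP; move: Px; rewrite eP => -[/eqP|//]; rewrite (negPf x0).
have [q hq] := h; exists q; suff -> : P = Q by [].
rewrite eP; apply/funext => x; apply/propext.
have [->|x0] := eqVneq x 0.
  by split; [case: hq => [[[]]] | left].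
rewrite (ord_gt0 hq x0); split; last by right.
by case=> // /eqP; rewrite (negPf x0).
Qed.

Lemma is_val_hord P : is_val (hord P).
Proof.
rewrite /hord; case: pselect => [h|?]; last exact: is_val0.
by have [p hp] := krull_unif h; apply: is_val_ord hp.
Qed.

Lemma krull_hord : krull_family hord.
Proof.
have [I [v kv]] := kR; split; first exact: is_val_hord.
split=> [x x0|x y x0 y0 le].
  have [l hl] := finite_height_one kv x0; exists l => P.
  rewrite /hord; case: pselect => // h; have [p hp] := krull_unif h.
  by rewrite -lt0n => /(ord_gt0 hp x0) /(hl _ h).
apply: contrapT => /(exists_unif_ord_lt kv y0 x0) [Q [q [hq]]].
by rewrite ltnNge -!hordE ?le //; apply: unif_height_one hq.
Qed.

Lemma hord_gt0 P x : height_one P -> x != 0 -> P x <-> (0 < hord P x)%N.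
Proof.
by move=> hP x0; rewrite hordE //; have [p hp] := krull_unif hP; apply: ord_gt0 hp _ x0.
Qed.

Lemma ord_is_hord P x n : height_one P -> x != 0 -> ord_is P x n <-> n = hord P x.
Proof.
by move=> hP x0; rewrite hordE //; have [p hp] := krull_unif hP; apply: ord_isP hp _ _ x0.
Qed.

End Domain.

(** * Fraction fields and the two forms of the Krull property *)

Lemma tofrac_is_frac (R : idomainType) :
  is_frac_field (@FracField.tofrac R : {rmorphism R -> {fraction R}}).
Proof.
split=> [x y /eqP|k]; first by rewrite tofrac_eq => /eqP.
exists (\n_(repr k)), (\d_(repr k)); rewrite tofrac_eq0 denom_ratioP; split=> //.
apply: (canRL (mulfK _)); first by rewrite tofrac_eq0 denom_ratioP.
set r := repr k; have -> : k = (\pi_{fraction R} r)%qT by rewrite reprK.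
have e x : FracField.tofrac x = (\pi_{fraction R} (Ratio x 1))%qT by unlock FracField.tofrac.
rewrite /= !e; apply: etrans (esym (FracField.pi_mul _ _)) _.
apply/eqmodP/eqP => /=; rewrite /FracField.mulf /=.
have d0 := denom_ratioP r.
by rewrite !numden_Ratio ?oner_neq0 ?mulr1 // mulrC.
Qed.

Section FracField.
Variables (R : idomainType) (K : fieldType) (f : {rmorphism R -> K}).
Hypothesis ff : is_frac_field f.
Implicit Types (v : R -> nat) (a b x y : R) (k : K).

Lemma frac_eq0 x : (f x == 0) = (x == 0).
Proof.
by apply/eqP/eqP => [e|->]; [apply: ff.1; rewrite e rmorph0 | rewrite rmorph0].
Qed.

Lemma frac_rep k : k != 0 -> exists a b, a != 0 /\ b != 0 /\ k = f a / f b.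
Proof.
have [a [b [b0 e]]] := ff.2 k; move=> k0; exists a, b; rewrite -!(frac_eq0) b0.
by split=> //; apply: contraNneq k0 => a0; rewrite e a0 mul0r.
Qed.

Definition vext v k : int :=
  if pselect (exists n, exists a b, a != 0 /\ b != 0 /\ k = f a / f b /\
    n = (v a)%:Z - (v b)%:Z) is left h then projT1 (cid h) else 0.

Lemma vextE v a b : is_val v -> a != 0 -> b != 0 ->
  vext v (f a / f b) = (v a)%:Z - (v b)%:Z.
Proof.
move=> hv a0 b0; rewrite /vext; case: pselect => [h|[]]; last first.
  by exists ((v a)%:Z - (v b)%:Z), a, b.
case: cid => _ /= [a' [b' [a'0 [b'0 [e ->]]]]].
have e' : a * b' = a' * b.
  apply: ff.1; rewrite !rmorphM; move/eqP: e; rewrite eqr_div ?frac_eq0 // => /eqP ->.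
  by rewrite mulrC.
by have := congr1 v e'; rewrite !valM //; lia.
Qed.

Lemma vextE1 v a : is_val v -> a != 0 -> vext v (f a) = (v a)%:Z.
Proof.
move=> hv a0; have := vextE hv a0 (oner_neq0 R).
by rewrite rmorph1 divr1 val1 // subr0.
Qed.

Lemma vextM v k l : is_val v -> k != 0 -> l != 0 ->
  vext v (k * l) = vext v k + vext v l.
Proof.
move=> hv /frac_rep [a [b [a0 [b0 ->]]]] /frac_rep [c [d [c0 [d0 ->]]]].
rewrite mulf_div -!rmorphM !vextE ?mulf_neq0 // !valM //; lia.
Qed.

Lemma vextD v k l : is_val v -> k != 0 -> l != 0 -> k + l != 0 ->
  Num.min (vext v k) (vext v l) <= vext v (k + l).
Proof.
move=> hv /frac_rep [a [b [a0 [b0 ->]]]] /frac_rep [c [d [c0 [d0 ->]]]].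
rewrite addf_div ?frac_eq0 // -!rmorphM -rmorphD; set s := a * d + c * b => s0.
have sn : s != 0.
  by apply: contraNneq s0 => ->; rewrite rmorph0 mul0r.
rewrite !vextE ?mulf_neq0 //.
have := hv.2 _ _ (mulf_neq0 a0 d0) (mulf_neq0 c0 b0) sn; rewrite -/s !valM // minEle.
by case: ifP; lia.
Qed.

(** [is_dval] requires the value 1 to be attained, so the index type is cut down to the height-one
    primes, where a uniformizer attains it. *)
Lemma Krull_is_Krull : Krull R -> is_Krull R.
Proof.
move=> kR; exists K, f; split=> //.
exists {P : R -> Prop | height_one P}, (fun i => vext (hord (sval i))).
have hv := is_val_hord kR.
split; last split.
- move=> [P hP] /=; split; first by move=> *; apply: vextM.
  split; first by move=> *; apply: vextD.
  have [p hp] := krull_unif kR hP; exists (f p).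
  have p0 : p != 0 by case: hp => _ [_ []].
  by rewrite frac_eq0 p0 vextE1 // hordE // (ord_unif hp).
- move=> k /frac_rep [a [b [a0 [b0 ->]]]].
  have [l hl] : exists l, forall P, hord P a != 0%N \/ hord P b != 0%N -> List.In P l.
    have [la hla] := (krull_hord kR).2.1 _ a0; have [lb hlb] := (krull_hord kR).2.1 _ b0.
    by exists (la ++ lb) => P [/hla|/hlb] h; apply: In_cat; [left | right].
  exists (pmap (fun P => if pselect (height_one P) is left h then Some (exist _ P h) else None) l).
  move=> [P hP] /=; rewrite vextE // => ne0.
  have : List.In P l by apply: hl; case: (hord P a) ne0 => [|?]; [right; lia | left].
  elim: l {hl} => //= Q l IH [->|/IH h]; case: pselect => //= h'.
    by left; congr exist; apply: Prop_irrelevance.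
  by right.
- move=> k /frac_rep [a [b [a0 [b0 ->]]]]; split.
    move=> [r e] i; have r0 : r != 0.
      by rewrite -frac_eq0 -e mulf_neq0 ?invr_eq0 ?frac_eq0.
    by rewrite e vextE1.
  move=> h; have [q ->] : divides b a.
    apply: (krull_hord kR).2.2 => // P; case: (pselect (height_one P)) => hP.
      by have := h (exist _ P hP); rewrite /= vextE //; lia.
    by rewrite /hord; case: pselect.
  by exists q; rewrite rmorphM mulfK // frac_eq0.
Qed.

End FracField.

(** On R the given valuations are nonnegative, so [absz] changes only the type of the values. *)
Lemma is_Krull_Krull (R : idomainType) : is_Krull R -> Krull R.
Proof.
move=> [K [f [ff [I [v [dv [fin int]]]]]]].
have fE := @frac_eq0 R K f ff.
exists I, (fun i x => absz (v i (f x))).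
have ge0 i x : x != 0 -> 0 <= v i (f x).
  move=> x0; have /int [h _] : f x != 0 by rewrite fE.
  by apply: h; exists x.
split; last split.
- move=> i; have [vM [vD _]] := dv i; split=> x y x0 y0.
    by rewrite rmorphM vM ?fE //; have := ge0 i _ x0; have := ge0 i _ y0; lia.
  move=> s0; set r := v i (f (x + y)); have r0 : 0 <= r := ge0 i _ s0.
  have : Num.min (v i (f x)) (v i (f y)) <= r.
    by rewrite /r rmorphD; apply: vD; rewrite -?rmorphD fE.
  by rewrite minEle; have := ge0 i _ x0; have := ge0 i _ y0; case: ifP; lia.
- move=> x x0; have /fin [s hs] : f x != 0 by rewrite fE.
  exists s => i ne.
  by apply: hs; lia.
move=> x y x0 y0 le; have fx0 : f x != 0 by rewrite fE.
have q0 : f y / f x != 0 by rewrite mulf_neq0 ?invr_eq0 ?fE.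
have [r er] : exists r, f y / f x = f r.
  apply/(int _ q0) => i; have [vM _] := dv i.
  have := vM _ _ q0 fx0; rewrite divfK // => e; have := le i.
  by have := ge0 i _ x0; have := ge0 i _ y0; lia.
by exists r; apply: ff.1; rewrite rmorphM -er divfK.
Qed.

(** * Quotients of abelian groups by canonical representatives *)

Section QuotientGroup.
Variables (T : zmodType) (S N : T -> Prop).
Hypotheses (S0 : S 0) (SB : forall x y, S x -> S y -> S (x - y)).
Hypotheses (N0 : N 0) (NB : forall x y, N x -> N y -> N (x - y)).

Let NN x : N x -> N (- x).
Proof. by move=> Nx; rewrite -sub0r; apply: NB. Qed.

Let ND x y : N x -> N y -> N (x + y).
Proof. by move=> Nx Ny; rewrite -[y]opprK; apply: NB => //; apply: NN. Qed.

Let SD x y : S x -> S y -> S (x + y).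
Proof. by move=> Sx Sy; rewrite -[y]opprK; apply: SB => //; rewrite -sub0r; apply: SB. Qed.

(** [xget] depends only on the set, so congruent elements get the same representative and the
    quotient has Leibniz equality. [S y] is imposed separately because N need not lie in S:
    [is_principal] leaves the values off the height-one primes free. *)
Definition canon_rep (x : T) : T := xget 0 [set y | S y /\ N (y - x)].

Lemma canon_repP x : S x -> S (canon_rep x) /\ N (canon_rep x - x).
Proof.
move=> Sx; rewrite /canon_rep; case: xgetP => [y _ [Sy Ny] //|/(_ x)].
by case; split=> //; rewrite subrr.
Qed.

Lemma canon_rep_eq x y : N (x - y) -> canon_rep x = canon_rep y.
Proof.
move=> Nxy; rewrite /canon_rep; congr xget; apply/seteqP; split=> z /= [Sz Nz]; split=> //.
  by have := ND Nz Nxy; rewrite addrA subrK.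
by have := NB Nz Nxy; rewrite opprB addrA subrK.
Qed.

Definition quot := {x : T | S x /\ canon_rep x = x}.
HB.instance Definition _ := gen_eqMixin quot.
HB.instance Definition _ := gen_choiceMixin quot.

Lemma quot_subproof x : S x -> S (canon_rep x) /\ canon_rep (canon_rep x) = canon_rep x.
Proof. by move=> Sx; have [? ?] := canon_repP Sx; split=> //; apply: canon_rep_eq. Qed.

Definition proj_quot (x : T) (Sx : S x) : quot := exist _ (canon_rep x) (quot_subproof Sx).

Lemma proj_quot_eq x y (Sx : S x) (Sy : S y) : N (x - y) -> proj_quot Sx = proj_quot Sy.
Proof.
move=> Nxy; apply: eq_exist; exact: canon_rep_eq.
Qed.

Lemma sval_quotK (q : quot) (h : S (sval q)) : proj_quot h = q.
Proof. by case: q h => x [Sx e] h; apply: eq_exist. Qed.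

Definition quot_add (p q : quot) : quot := proj_quot (SD (svalP p).1 (svalP q).1).
Definition quot_opp (p : quot) : quot := proj_quot (SB S0 (svalP p).1).
Definition quot_zero : quot := proj_quot S0.

Lemma quot_addE x y (Sx : S x) (Sy : S y) (Sxy : S (x + y)) :
  quot_add (proj_quot Sx) (proj_quot Sy) = proj_quot Sxy.
Proof.
apply: proj_quot_eq => /=; have [_ hx] := canon_repP Sx; have [_ hy] := canon_repP Sy.
by have := ND hx hy; rewrite opprD addrACA.
Qed.

Lemma quot_addC : commutative quot_add.
Proof. by move=> p q; apply: proj_quot_eq; rewrite [sval q + _]addrC subrr. Qed.

Lemma quot_addA : associative quot_add.
Proof.
move=> p q r; rewrite -[p](sval_quotK (svalP p).1) -[r](sval_quotK (svalP r).1).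
have Spq := SD (svalP p).1 (svalP q).1; have Sqr := SD (svalP q).1 (svalP r).1.
rewrite -{1 2}[q](sval_quotK (svalP q).1).
rewrite (quot_addE _ _ Spq) (quot_addE _ _ Sqr).
rewrite (quot_addE _ _ (SD (svalP p).1 Sqr)) (quot_addE _ _ (SD Spq (svalP r).1)).
by apply: proj_quot_eq; rewrite addrA subrr.
Qed.

Lemma quot_add0 : left_id quot_zero quot_add.
Proof.
move=> p; rewrite -{1}[p](sval_quotK (svalP p).1) (quot_addE _ _ (SD S0 (svalP p).1)).
by rewrite -[RHS](sval_quotK (svalP p).1); apply: proj_quot_eq; rewrite add0r subrr.
Qed.

Lemma quot_addN : left_inverse quot_zero quot_opp quot_add.
Proof.
move=> p; rewrite -{2}[p](sval_quotK (svalP p).1).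
rewrite (quot_addE _ _ (SD (SB S0 (svalP p).1) (svalP p).1)).
by apply: proj_quot_eq; rewrite subrK subr0.
Qed.

HB.instance Definition _ := GRing.isZmodule.Build quot quot_addA quot_addC quot_add0 quot_addN.

Lemma quotient_exists : exists (G : zmodType) (phi : T -> G),
  (forall x y, S x -> S y -> phi (x + y) = phi x + phi y) /\
  (forall g, exists x, S x /\ phi x = g) /\
  (forall x, S x -> (phi x = 0 <-> N x)).
Proof.
exists quot, (fun x => if pselect (S x) is left h then proj_quot h else 0).
have E x (Sx : S x) : (if pselect (S x) is left h then proj_quot h else 0) = proj_quot Sx.
  by case: pselect => // h; apply: proj_quot_eq; rewrite subrr.
split=> [x y Sx Sy|]; first by rewrite (E _ Sx) (E _ Sy) (E _ (SD Sx Sy)) -quot_addE.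
split=> [g|x Sx]; first by exists (sval g); rewrite (E _ (svalP g).1) sval_quotK; case: (svalP g).
rewrite (E _ Sx); split=> [/(congr1 sval) /= e|Nx]; last first.
  by apply: proj_quot_eq; rewrite subr0.
have [_ h0] := canon_repP S0; have [_ hx] := canon_repP Sx.
by have := NB h0 hx; rewrite -e subr0 opprB addrC subrK.
Qed.

End QuotientGroup.

(** * Divisors and divisorial closures *)

Section Sets.
Variable R : idomainType.
Implicit Types (E F : R -> Prop) (x y r s c : R) (P Q : R -> Prop).

Definition nonzero_set E : Prop := exists e, E e /\ e != 0.
Definition mulset r E : R -> Prop := fun c => exists e, E e /\ c = r * e.
Definition setprod E F : R -> Prop := fun c => exists e f, E e /\ F f /\ c = e * f.

(* c lies in the divisorial closure of the ideal generated by E *)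
Definition vle E c : Prop :=
  forall x y, y != 0 -> (forall e, E e -> divides y (x * e)) -> divides y (x * c).

Definition veq E F : Prop := (forall c, F c -> vle E c) /\ (forall c, E c -> vle F c).

(* the divisorial closures of E and F lie in the same divisor class *)
Definition vsim E F : Prop :=
  exists r s, r != 0 /\ s != 0 /\ veq (mulset r E) (mulset s F).

Lemma mulset_nonzero r E : r != 0 -> nonzero_set E -> nonzero_set (mulset r E).
Proof.
by move=> r0 [e [Ee e0]]; exists (r * e); split; [exists e | exact: mulf_neq0].
Qed.

Lemma setprod_nonzero E F : nonzero_set E -> nonzero_set F -> nonzero_set (setprod E F).
Proof.
move=> [e [Ee e0]] [f [Ff f0]]; exists (e * f); split; last exact: mulf_neq0.
by exists e, f.
Qed.

(** Valid for every Krull family, not only for [hord]; on B it will be applied to the valuations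
    extended from A. *)
Lemma vle_dom (I : Type) (v : I -> R -> nat) E c : krull_family v ->
  (c != 0 -> forall i, exists e, E e /\ e != 0 /\ (v i e <= v i c)%N) -> vle E c.
Proof.
move=> [hv [_ int]] h x y y0 d; have [->|c0] := eqVneq c 0.
  by rewrite mulr0; apply: divides0.
have [->|x0] := eqVneq x 0; first by rewrite mul0r; apply: divides0.
apply: int => // [|i]; first exact: mulf_neq0.
have [e [Ee [e0 le]]] := h c0 i.
by have := val_divides (hv i) (mulf_neq0 x0 e0) (d e Ee); rewrite !valM //; lia.
Qed.

Hypothesis kR : Krull R.
Let hv := is_val_hord kR.
Let kv := krull_hord kR.

Lemma hord_out P x : ~ height_one P -> hord P x = 0%N.
Proof. by rewrite /hord; case: pselect. Qed.

(** Distinct height-one primes are not contained in each other, so each Q in the list has an element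
    outside P; a product of powers of such elements works. *)
Lemma krull_approx P (n : (R -> Prop) -> nat) (l : seq (R -> Prop)) : height_one P ->
  exists x, x != 0 /\ ~ P x /\
    forall Q, List.In Q l -> height_one Q -> Q <> P -> (n Q <= hord Q x)%N.
Proof.
move=> hP; elim: l => [|Q l [x [x0 [Px hx]]]].
  by exists 1; rewrite oner_neq0; split=> //; split=> //; case: hP => -[_ []].
case: (pselect (height_one Q /\ Q <> P)) => [[hQ QP]|nQ]; last first.
  by exists x; do 2!split=> //; move=> Q' [<-|/hx //] h1 h2; case: nQ.
have [s [Qs Ps]] : exists s, Q s /\ ~ P s.
  apply: contrapT => h; apply: QP; apply/funext => z; apply/propext.
  have QP z' : Q z' -> P z' by move=> Qz; apply: contrapT => Pz; apply: h; exists z'.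
  split; first exact: QP.
  by case: hP => _ [_ minP]; apply: minP => //; [case: hQ | case: hQ => _ []].
have s0 : s != 0 by apply: notin_neq0 Ps; case: hP.
exists (x * s ^+ n Q); rewrite mulf_neq0 ?expf_neq0 //; split=> //.
split.
  have [[_ [_ pP]] _] := hP; case/pP => //; apply: contra_not Ps.
  by apply: prime_exp; case: hP.
move=> Q' hQ' h1 h2; rewrite valM ?expf_neq0 // valX //.
case: hQ' => [<-|/hx h]; last by apply: leq_trans (leq_addr _ _); apply: h.
apply: leq_trans (leq_addl _ _); rewrite leq_pmulr //.
by apply/(hord_gt0 kR).
Qed.

(** A converse of [vle_dom]. If every e had order above n = ord c at P, let y = p^(n+1) and let x
    have order 0 at P and cancel y at all other primes: then y divides x E but not x c. *)
Lemma vle_hord E c P : nonzero_set E -> vle E c -> c != 0 ->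
  exists e, E e /\ e != 0 /\ (hord P e <= hord P c)%N.
Proof.
move=> [e0 [Ee0 e00]] Ec c0; case: (pselect (height_one P)) => hP; last first.
  by exists e0; rewrite !hord_out.
apply: contrapT => h; have [p hp] := krull_unif kR hP.
have p0 : p != 0 by case: hp => _ [_ []].
have p1 : hord P p = 1%N by rewrite hordE // (ord_unif hp).
pose y := p ^+ (hord P c).+1; have y0 : y != 0 by apply: expf_neq0.
have yP : hord P y = (hord P c).+1 by rewrite valX // p1 muln1.
have [l hl] := kv.2.1 y y0.
have [x [x0 [Px hx]]] := krull_approx (fun Q => hord Q y) l hP.
have xP : hord P x = 0%N by rewrite hordE // (ord_notin hp Px).
have : divides y (x * c).
  apply: Ec => // e Ee; have [->|en0] := eqVneq e 0.
    by rewrite mulr0; apply: divides0.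
  apply: kv.2.2 => // [|Q]; first exact: mulf_neq0.
  rewrite valM //; case: (pselect (Q = P)) => [->|QP].
    rewrite xP yP ltnNge; apply/negP => le; apply: h; by exists e.
  case: (pselect (height_one Q)) => hQ; last by rewrite !(hord_out _ hQ).
  have [->//|lt] := posnP (hord Q y).
  by apply: leq_trans (leq_addr _ _); apply: hx => //; apply: hl; rewrite -lt0n.
move/(val_divides (hv P) (mulf_neq0 x0 c0)); rewrite valM // xP yP; lia.
Qed.

Definition dmin E P : nat := mins (fun n => exists e, E e /\ e != 0 /\ hord P e = n).

Lemma dminP E P : nonzero_set E ->
  (exists e, E e /\ e != 0 /\ hord P e = dmin E P) /\
  forall e, E e -> e != 0 -> (dmin E P <= hord P e)%N.
Proof.
move=> [e0 [Ee0 e00]]; have [|h min_h] :=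
  @minsP (fun n => exists e, E e /\ e != 0 /\ hord P e = n); first by exists (hord P e0), e0.
by split=> // e Ee en0; apply: min_h; exists e.
Qed.

Lemma dmin_eq E P n : (exists e, E e /\ e != 0 /\ hord P e = n) ->
  (forall e, E e -> e != 0 -> (n <= hord P e)%N) -> dmin E P = n.
Proof.
move=> [e [Ee [e0 <-]]] h; have [|[e' [Ee' [e'0 <-]]] min_e] := @dminP E P.
  by exists e.
have := h _ Ee' e'0; have := min_e _ Ee e0.
have [|[e'' [Ee'' [e''0 <-]]] _] := @dminP E P; first by exists e.
by have := h _ Ee'' e''0; lia.
Qed.

Lemma dmin_mulset r E P : r != 0 -> nonzero_set E ->
  dmin (mulset r E) P = (hord P r + dmin E P)%N.
Proof.
move=> r0 /(@dminP _ P) [[e [Ee [e0 he]]] h]; apply: dmin_eq.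
  exists (r * e); split; first by exists e.
  by rewrite valM // he mulf_neq0.
move=> _ [f [Ef ->]]; rewrite mulf_eq0 negb_or => /andP[_ f0].
by rewrite valM // leq_add2l; apply: h.
Qed.

Lemma dmin_setprod E F P : nonzero_set E -> nonzero_set F ->
  dmin (setprod E F) P = (dmin E P + dmin F P)%N.
Proof.
move=> /(@dminP _ P) [[e [Ee [e0 he]]] hE] /(@dminP _ P) [[f [Ff [f0 hf]]] hF].
apply: dmin_eq.
  exists (e * f); split; first by exists e, f.
  by rewrite valM // he hf mulf_neq0.
move=> _ [e' [f' [Ee' [Ff' ->]]]]; rewrite mulf_eq0 negb_or => /andP[e'0 f'0].
by rewrite valM // leq_add ?hE ?hF.
Qed.

Lemma veq_dmin E F : nonzero_set E -> nonzero_set F ->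
  veq E F <-> forall P, dmin E P = dmin F P.
Proof.
move=> nE nF.
have le E' F' : nonzero_set E' -> nonzero_set F' ->
    (forall c, F' c -> vle E' c) <-> forall P, (dmin E' P <= dmin F' P)%N.
  move=> nE' nF'; split=> [h P|h c Fc].
    have [[f [Ff [f0 <-]]] _] := dminP P nF'.
    have [e [Ee [e0 le]]] := vle_hord P nE' (h f Ff) f0.
    by apply: leq_trans le; apply: (dminP P nE').2.
  apply: (vle_dom kv) => c0 P; have [[e [Ee [e0 he]]] _] := dminP P nE'.
  exists e; rewrite he; split=> //; split=> //; apply: leq_trans (h P) _.
  exact: (dminP P nF').2.
split=> [[/le h1 /le h2] P|h].
  by apply/eqP; rewrite eqn_leq h1 ?h2.
by split; apply/le => // P; rewrite h.
Qed.

Definition Div E : (R -> Prop) -> int := fun P => (dmin E P)%:Z.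

Lemma Div_divisor E : nonzero_set E -> is_divisor (Div E).
Proof.
move=> nE; split=> [P hP|].
  by have [[e [Ee [e0 he]]] _] := dminP P nE; rewrite /Div -he hord_out.
have [e [Ee e0]] := nE; have [l hl] := kv.2.1 e e0; exists l => P.
rewrite /Div => ne; apply: hl; rewrite -lt0n.
by apply: leq_trans ((dminP P nE).2 e Ee e0); rewrite lt0n.
Qed.

Lemma principalP (D : (R -> Prop) -> int) : is_principal D <->
  exists a b, a != 0 /\ b != 0 /\
    forall P, height_one P -> D P = (hord P a)%:Z - (hord P b)%:Z.
Proof.
split=> -[a [b [a0 [b0 h]]]]; exists a, b; do 2!split=> //; move=> P hP.
  have [n [m [/(ord_is_hord kR n hP a0) -> [/(ord_is_hord kR m hP b0) -> ->]]]] := h P hP.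
  by [].
exists (hord P a), (hord P b); split; first exact/(ord_is_hord kR _ hP a0).
by split; [exact/(ord_is_hord kR _ hP b0) | exact: h].
Qed.

Lemma principal_Div E F : nonzero_set E -> nonzero_set F ->
  is_principal (fun P => Div E P - Div F P) <-> vsim E F.
Proof.
move=> nE nF; split.
  case/principalP=> a [b [a0 [b0 h]]]; exists b, a; do 2!split=> //.
  apply/veq_dmin; try exact: mulset_nonzero.
  move=> P; rewrite !dmin_mulset //; case: (pselect (height_one P)) => hP.
    by have := h P hP; rewrite /Div; lia.
  rewrite !(hord_out _ hP) !add0n; have := (Div_divisor nE).1 _ hP.
  by have := (Div_divisor nF).1 _ hP; rewrite /Div; lia.
case=> r [s [r0 [s0 /veq_dmin h]]]; apply/principalP; exists s, r.
do 2!split=> //; move=> P hP.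
have := h (mulset_nonzero r0 nE) (mulset_nonzero s0 nF) P.
by rewrite !dmin_mulset // /Div; lia.
Qed.

(** E consists of the elements with divisor at least D; [krull_approx] shows that the bound is
    attained at each height-one prime. *)
Lemma effective_Div D : is_divisor D -> (forall P, 0 <= D P) ->
  exists E, nonzero_set E /\ D = Div E.
Proof.
move=> [out [l hl]] D0.
pose E x := forall P, height_one P -> x != 0 -> (absz (D P) <= hord P x)%N.
have ex P : height_one P -> exists x, E x /\ x != 0 /\ hord P x = absz (D P).
  move=> hP; have [p hp] := krull_unif kR hP.
  have p0 : p != 0 by case: hp => _ [_ []].
  have p1 : hord P p = 1%N by rewrite hordE // (ord_unif hp).
  have [x [x0 [Px hx]]] := krull_approx (fun Q => absz (D Q)) l hP.
  have xP : hord P x = 0%N by rewrite hordE // (ord_notin hp Px).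
  exists (x * p ^+ absz (D P)); split; last first.
    by rewrite mulf_neq0 ?expf_neq0 // valM ?expf_neq0 // valX // p1 xP muln1.
  move=> Q hQ _; rewrite valM ?expf_neq0 // valX //.
  case: (pselect (Q = P)) => [->|QP]; first by rewrite p1 xP muln1.
  apply: leq_trans (leq_addr _ _); have [->//|D0'] := eqVneq (D Q) 0.
  by apply: hx => //; apply: hl.
have nE : nonzero_set E.
  case: (pselect (exists P : R -> Prop, height_one P)) => [[P /ex [x [Ex [x0 _]]]]|h].
    by exists x.
  by exists 1; split=> [P hP|]; [case: h; exists P | exact: oner_neq0].
exists E; split=> //; apply/funext => P; rewrite /Div.
case: (pselect (height_one P)) => hP; last by have := (Div_divisor nE).1 P hP; rewrite out.
suff -> : dmin E P = absz (D P) by have := D0 P; lia.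
by apply: dmin_eq => [|e Ee e0]; [exact: ex | exact: Ee].
Qed.

Lemma divisor_bounded D : is_divisor D ->
  exists b, b != 0 /\ forall P, 0 <= D P + (hord P b)%:Z.
Proof.
move=> [out [l hl]].
have [b [b0 hb]] : exists b, b != 0 /\
    forall P, List.In P l -> height_one P -> (absz (D P) <= hord P b)%N.
  elim: l {hl} => [|Q l [b [b0 hb]]]; first by exists 1; rewrite oner_neq0.
  case: (pselect (height_one Q)) => hQ; last first.
    by exists b; split=> // P [<- //|]; apply: hb.
  have [_ [[q [q0 Qq]] _]] := hQ; exists (b * q ^+ absz (D Q)).
  rewrite mulf_neq0 ?expf_neq0 //; split=> // P hP hP'.
  rewrite valM ?expf_neq0 // valX //; case: hP => [<-|/hb h].
    apply: leq_trans (leq_addl _ _); rewrite leq_pmulr //; by apply/(hord_gt0 kR).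
  by apply: leq_trans (leq_addr _ _); apply: h.
exists b; split=> // P; case: (pselect (height_one P)) => hP; last by rewrite out.
have [->//|/hl/hb/(_ hP)] := eqVneq (D P) 0; lia.
Qed.

Lemma is_divisorB D1 D2 : is_divisor D1 -> is_divisor D2 ->
  is_divisor (fun P => D1 P - D2 P).
Proof.
move=> [o1 [l1 h1]] [o2 [l2 h2]]; split=> [P hP|]; first by rewrite o1 // o2.
exists (l1 ++ l2) => P ne; apply: In_cat.
have [e|/h1 h] := eqVneq (D1 P) 0; last by left.
by right; apply: h2; apply: contraNneq ne => ->; rewrite e.
Qed.

Lemma is_divisor_hord b : b != 0 -> is_divisor (fun P => (hord P b)%:Z).
Proof.
move=> b0; split=> [P hP|]; first by rewrite hord_out.
by have [l hl] := kv.2.1 b b0; exists l => P ne; apply: hl; lia.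
Qed.

Lemma class_group_exists : exists G : zmodType, class_group_iso R G.
Proof.
pose S (D : (R -> Prop) -> int) := is_divisor D.
pose N (D : (R -> Prop) -> int) := is_principal D.
have S0 : S 0 by split=> //; exists [::] => P; rewrite eqxx.
have N0 : N 0.
  apply/principalP; exists 1, 1; rewrite oner_neq0; do 2!split=> //; move=> P _.
  by rewrite subrr.
have NB D1 D2 : N D1 -> N D2 -> N (D1 - D2).
  move=> /principalP [a [b [a0 [b0 h]]]] /principalP [a' [b' [a'0 [b'0 h']]]].
  apply/principalP; exists (a * b'), (b * a'); rewrite !mulf_neq0 //.
  do 2!split=> //; move=> P hP; rewrite !valM //.
  have -> : (D1 - D2) P = D1 P - D2 P by [].
  by rewrite h // h' //; lia.
have [G [phi [h1 [h2 h3]]]] := quotient_exists S0 is_divisorB N0 NB.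
by exists G, phi.
Qed.

(* The class group as the group of sets modulo [vsim], multiplied elementwise. *)
Lemma class_group_sets (G : zmodType) : class_group_iso R G ->
  exists psi : (R -> Prop) -> G,
    (forall E F, nonzero_set E -> nonzero_set F ->
       psi (setprod E F) = psi E + psi F) /\
    (forall g, exists E, nonzero_set E /\ psi E = g) /\
    (forall E F, nonzero_set E -> nonzero_set F -> psi E = psi F <-> vsim E F).
Proof.
move=> [phi [phiD [phi_surj phi0]]]; exists (fun E => phi (Div E)).
split; last split.
- move=> E F nE nF; rewrite -phiD; try exact: Div_divisor.
  by congr phi; apply/funext => P; rewrite /Div dmin_setprod //; lia.
- move=> g; have [D [hD <-]] := phi_surj g.
  (* Adding the principal divisor of b makes D effective, hence the divisor of a set, without
     changing its class. *)
  have [b [b0 hb]] := divisor_bounded hD.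
  have dN : is_divisor (fun P => - (hord P b)%:Z : int).
    have := is_divisorB (is_divisor_hord (oner_neq0 R)) (is_divisor_hord b0).
    by congr is_divisor; apply/funext => P; rewrite val1 // sub0r.
  have dD : is_divisor (fun P => D P + (hord P b)%:Z).
    have := is_divisorB hD dN; congr is_divisor; apply/funext => P; by rewrite opprK.
  have [E [nE eE]] := effective_Div dD hb.
  exists E; split=> //; rewrite -eE phiD //; last exact: is_divisor_hord.
  suff -> : phi (fun P => (hord P b)%:Z) = 0 by rewrite addr0.
  apply/phi0; first exact: is_divisor_hord.
  apply/principalP; exists b, 1; rewrite oner_neq0; do 2!split=> //.
  by move=> P _; rewrite val1 // subr0.
move=> E F nE nF; rewrite -principal_Div // -phi0; last first.
  by apply: is_divisorB; apply: Div_divisor.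
have := phiD _ _ (is_divisorB (Div_divisor nE) (Div_divisor nF)) (Div_divisor nF).
have -> : (fun P => Div E P - Div F P + Div F P) = Div E.
  by apply/funext => P; rewrite subrK.
move=> ->; split=> [/(canRL (addrK _)) ->|->]; last by rewrite add0r.
by rewrite subrr.
Qed.

End Sets.

(** * Gradings by the integers *)

Section Grading.
Variables (R : idomainType) (Ad : int -> R -> Prop).
Hypothesis hA : Zgrading Ad.
Implicit Types (x y a b : R) (d e k n m : int) (h : int -> R).

Lemma gr0 d : Ad d 0.
Proof. by case: (hA.1 d). Qed.

Lemma grB d x y : Ad d x -> Ad d y -> Ad d (x - y).
Proof. by case: (hA.1 d) => _; apply. Qed.

Lemma grN d x : Ad d x -> Ad d (- x).
Proof. by move=> hx; rewrite -sub0r; apply: grB => //; apply: gr0. Qed.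

Lemma grD d x y : Ad d x -> Ad d y -> Ad d (x + y).
Proof. by move=> hx hy; rewrite -[y]opprK; apply: grB => //; apply: grN. Qed.

Lemma grM d e x y : Ad d x -> Ad e y -> Ad (d + e) (x * y).
Proof. exact: hA.2.1. Qed.

Lemma gr_sum d (I : Type) (r : seq I) (p : pred I) (F : I -> R) :
  (forall i, p i -> Ad d (F i)) -> Ad d (\sum_(i <- r | p i) F i).
Proof. by move=> hF; apply: big_ind => //; [exact: gr0 | exact: grD]. Qed.

Lemma sum_supp (s t : seq int) h : uniq s -> uniq t -> {subset s <= t} ->
  (forall d, d \notin s -> h d = 0) -> \sum_(d <- s) h d = \sum_(d <- t) h d.
Proof.
move=> us ut st h0; rewrite [RHS](bigID (mem s)) /= [X in _ + X]big1 ?addr0 => [|d /h0 //].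
rewrite -[RHS]big_filter; apply: perm_big; apply: uniq_perm => //.
  exact: filter_uniq.
by move=> d; rewrite mem_filter andb_idr // => /st.
Qed.

Let decomp x h : Prop := (forall d, Ad d (h d)) /\
  exists s, uniq s /\ x = \sum_(d <- s) h d /\ forall d, d \notin s -> h d = 0.

(** The list provided by the grading may repeat degrees and its family may be nonzero off the list;
    summing over equal degrees repairs both. *)
Let decomp_ex x : exists h, decomp x h.
Proof.
have [s [h [Ah ->]]] := hA.2.2.1 x.
exists (fun d => \sum_(e <- s | e == d) h e); split.
  by move=> d; apply: gr_sum => e /eqP <-.
exists (undup s); rewrite undup_uniq; split=> //; split; last first.
  move=> d; rewrite mem_undup => ds; rewrite big_seq_cond big1 // => e /andP[es /eqP ed].
  by rewrite -ed es in ds.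
rewrite (exchange_big_dep predT) //= [LHS]big_seq [RHS]big_seq; apply: eq_bigr => e es.
rewrite (eq_bigl (pred1 e)) => [|d]; last by rewrite /= eq_sym.
by rewrite -big_filter filter_pred1_uniq ?undup_uniq ?mem_undup // big_seq1.
Qed.

Let decomp_uniq x h h' : decomp x h -> decomp x h' -> h = h'.
Proof.
move=> [Ah [s [us [e h0]]]] [Ah' [s' [us' [e' h0']]]].
pose t := undup (s ++ s'); have ut : uniq t by apply: undup_uniq.
have st : {subset s <= t} by move=> d ds; rewrite mem_undup mem_cat ds.
have st' : {subset s' <= t} by move=> d ds; rewrite mem_undup mem_cat ds orbT.
apply/funext => d; apply/eqP; rewrite -subr_eq0; apply/eqP.
have [dt|dt] := boolP (d \in t); last first.
  by rewrite h0 ?h0' ?subr0 //; apply: contra dt; [apply: st' | apply: st].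
apply: (hA.2.2.2 t ut (fun d => h d - h' d)) => // [k|]; first exact: grB.
rewrite sumrB -(sum_supp us ut st h0) -(sum_supp us' ut st' h0').
by rewrite -e -e' subrr.
Qed.

Definition cmp d x : R := sval (cid (decomp_ex x)) d.

Let cmp_decomp x : decomp x (cmp^~ x).
Proof. by rewrite /cmp; case: cid => h /=. Qed.

Lemma cmp_gr d x : Ad d (cmp d x).
Proof. by case: (cmp_decomp x). Qed.

Lemma cmp_supp x : exists s, uniq s /\ x = \sum_(d <- s) cmp d x /\
  forall d, d \notin s -> cmp d x = 0.
Proof. by case: (cmp_decomp x). Qed.

Let cmp_unique x h : decomp x h -> forall d, cmp d x = h d.
Proof. by move=> hx d; rewrite -(decomp_uniq (cmp_decomp x) hx). Qed.

Lemma cmp_hom e x d : Ad e x -> cmp d x = if d == e then x else 0.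
Proof.
move=> Ax; apply: (@cmp_unique x (fun d => if d == e then x else 0)); split.
  by move=> k; case: eqP => [->|_]; [| exact: gr0].
exists [:: e]; split=> //; split; first by rewrite big_seq1 eqxx.
by move=> k; rewrite inE => /negPf ->.
Qed.

Lemma cmp_hom_id e x : Ad e x -> cmp e x = x.
Proof. by move=> Ax; rewrite (cmp_hom _ Ax) eqxx. Qed.

Lemma cmpB d x y : cmp d (x - y) = cmp d x - cmp d y.
Proof.
apply: (@cmp_unique (x - y) (fun d => cmp d x - cmp d y)); split.
  by move=> k; apply: grB; apply: cmp_gr.
have [s [us [ex hx]]] := cmp_supp x; have [t [ut [ey hy]]] := cmp_supp y.
pose r := undup (s ++ t); have ur : uniq r by apply: undup_uniq.
have sr : {subset s <= r} by move=> k ks; rewrite mem_undup mem_cat ks.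
have tr : {subset t <= r} by move=> k ks; rewrite mem_undup mem_cat ks orbT.
exists r; split=> //; split.
  by rewrite sumrB -(sum_supp us ur sr hx) -(sum_supp ut ur tr hy) -ex -ey.
move=> k; rewrite mem_undup mem_cat negb_or => /andP[ks kt].
by rewrite hx // hy // subr0.
Qed.

Lemma cmp0 d : cmp d 0 = 0.
Proof. by have := cmpB d 0 0; rewrite !subrr. Qed.

Lemma cmpN d x : cmp d (- x) = - cmp d x.
Proof. by rewrite -sub0r cmpB cmp0 sub0r. Qed.

Lemma cmpD d x y : cmp d (x + y) = cmp d x + cmp d y.
Proof. by rewrite -{1}[y]opprK cmpB cmpN opprK. Qed.

Lemma cmp_sum d (I : Type) (r : seq I) (p : pred I) (F : I -> R) :
  cmp d (\sum_(i <- r | p i) F i) = \sum_(i <- r | p i) cmp d (F i).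
Proof. by apply: (big_morph (cmp d)) => [x y|]; [exact: cmpD | exact: cmp0]. Qed.

Lemma cmp_inj x : (forall d, cmp d x = 0) -> x = 0.
Proof. by move=> h; have [s [_ [-> _]]] := cmp_supp x; rewrite big1. Qed.

Lemma cmp_neq0 x : x != 0 -> exists d, cmp d x != 0.
Proof.
move=> x0; apply: contrapT => h; case/eqP: x0; apply: cmp_inj => d.
by apply: contrapT => /eqP hd; apply: h; exists d.
Qed.

Lemma cmp_homM e a d x : Ad e a -> cmp d (a * x) = a * cmp (d - e) x.
Proof.
move=> Aa; have [s [us [ex hx]]] := cmp_supp x; rewrite [in LHS]ex.
rewrite mulr_sumr cmp_sum.
transitivity (\sum_(k <- s) if k == d - e then a * cmp (d - e) x else 0).
  apply: eq_bigr => k _; rewrite (cmp_hom _ (grM Aa (cmp_gr k x))).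
  have -> : (d == e + k) = (k == d - e) by lia.
  by case: eqP => [->|].
rewrite -big_mkcond -big_filter /=.
have [ds|/hx ->] := boolP (d - e \in s); last by rewrite mulr0 big1.
by rewrite (filter_pred1_uniq us ds) big_seq1.
Qed.

(** Let e be a degree with 1_e nonzero. The degree e part of 1_e * 1 = 1_e reads 1_e * 1_0 = 1_e,
    and 1_e cancels. *)
Lemma gr1 : Ad 0 1.
Proof.
suff -> : 1 = cmp 0 1 by apply: cmp_gr.
have [e he] := cmp_neq0 (oner_neq0 R); apply: (mulfI he).
by rewrite -(subrr e) -(cmp_homM _ _ (cmp_gr e 1)) mulr1 (cmp_hom_id (cmp_gr e 1)).
Qed.

Definition hom x := exists d, Ad d x.

Lemma hom_cmp d x : hom (cmp d x).
Proof. by exists d; apply: cmp_gr. Qed.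

Lemma homM x y : hom x -> hom y -> hom (x * y).
Proof. by move=> [d hx] [e hy]; exists (d + e); apply: grM. Qed.

Lemma hom1 : hom 1.
Proof. by exists 0; apply: gr1. Qed.

Lemma hom_factor a x : hom a -> a != 0 -> hom (a * x) -> hom x.
Proof.
move=> [e Aa] a0 [k Aax]; exists (k - e).
suff -> : x = cmp (k - e) x by apply: cmp_gr.
by apply: (mulfI a0); rewrite -(cmp_homM _ _ Aa) (cmp_hom_id Aax).
Qed.

Definition deg_le n x : Prop := forall m, n < m -> cmp m x = 0.

(** From degree n + m on, only the leading component of x can contribute. This gives both the degree
    bound and the leading component of a product. *)
Lemma cmp_topM n m k x y : deg_le n x -> deg_le m y -> n + m <= k ->
  cmp k (x * y) = cmp n x * cmp (k - n) y.
Proof.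
move=> Dx Dy le; have [s [us [ex hx]]] := cmp_supp x; rewrite [in LHS]ex.
rewrite mulr_suml cmp_sum.
transitivity (\sum_(d <- s) if d == n then cmp n x * cmp (k - n) y else 0).
  apply: eq_bigr => d _; rewrite (cmp_homM _ _ (cmp_gr d x)).
  have [->//|ne] := eqVneq d n; case: (ltP n d) => [/Dx ->|le']; first by rewrite mul0r.
  by rewrite (Dy (k - d)) ?mulr0 //; lia.
rewrite -big_mkcond -big_filter /=.
have [ns|/hx ->] := boolP (n \in s); last by rewrite mul0r big1.
by rewrite (filter_pred1_uniq us ns) big_seq1.
Qed.

Lemma deg_leM n m x y : deg_le n x -> deg_le m y -> deg_le (n + m) (x * y).
Proof.
move=> Dx Dy k lt; rewrite (cmp_topM Dx Dy) ?(ltW lt) // (Dy (k - n)) ?mulr0 //; lia.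
Qed.

Lemma cmp_top n m x y : deg_le n x -> deg_le m y ->
  cmp (n + m) (x * y) = cmp n x * cmp m y.
Proof. by move=> Dx Dy; rewrite (cmp_topM Dx Dy) // addrAC subrr add0r. Qed.

Lemma deg_le_gr n x : Ad n x -> deg_le n x.
Proof. by move=> Ax m lt; rewrite (cmp_hom _ Ax); case: eqP => // e; lia. Qed.

(** The length n serves as a Euclidean size, like the degree plus one of a polynomial: n = 0 forces
    x = 0. *)
Definition in_window (a : int) (n : nat) x : Prop :=
  forall d, cmp d x != 0 -> (a <= d) && (d < a + n%:Z).

Lemma in_window_ex x : exists (a : int) (n : nat), in_window a n x.
Proof.
have [s [_ [_ hx]]] := cmp_supp x.
pose N := (\sum_(d <- s) absz d)%N; exists (- N%:Z), (N + N).+1 => d hd.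
have : (absz d <= N)%N; last by lia.
have ds : d \in s by apply: contraNT hd => /hx ->.
by rewrite /N (big_rem d) //= leq_addr.
Qed.

Lemma in_window0 (a : int) x : in_window a 0 x -> x = 0.
Proof.
by move=> h; apply: cmp_inj => d; apply/eqP/negP => /negP /h; lia.
Qed.

Lemma in_window_top (a : int) (n : nat) x : in_window a n.+1 x -> deg_le (a + n%:Z) x.
Proof. by move=> h m lt; apply/eqP/negP => /negP /h; lia. Qed.

Lemma in_window_shrink (a : int) (n : nat) x : in_window a n.+1 x -> cmp (a + n%:Z) x = 0 ->
  in_window a n x.
Proof.
move=> h e d hd; have := h d hd; suff : d != a + n%:Z by lia.
by apply: contraNneq hd => ->; rewrite e.
Qed.

Lemma top_ex x : x != 0 -> exists n, cmp n x != 0 /\ deg_le n x.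
Proof.
move=> x0; have [a [n]] := in_window_ex x; elim: n => [/in_window0 e|n IH h].
  by rewrite e eqxx in x0.
have [/(in_window_shrink h) //|ne] := eqVneq (cmp (a + n%:Z) x) 0.
by exists (a + n%:Z); split=> //; apply: in_window_top.
Qed.

Lemma top_unique n m x : cmp n x != 0 -> deg_le n x -> cmp m x != 0 -> deg_le m x -> n = m.
Proof.
move=> n0 Dn m0 Dm; apply/eqP; rewrite eq_le !leNgt; apply/andP; split; apply/negP.
  by move/Dm => e; rewrite e eqxx in n0.
by move/Dn => e; rewrite e eqxx in m0.
Qed.

(** * Gauss extension of a valuation given on homogeneous elements *)

Section Gauss.
Variable V : R -> nat.
Hypothesis VM : forall x y, hom x -> hom y -> x != 0 -> y != 0 ->
  V (x * y) = (V x + V y)%N.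
Hypothesis VD : forall d x y, Ad d x -> Ad d y -> x != 0 -> y != 0 -> x + y != 0 ->
  (minn (V x) (V y) <= V (x + y)%R)%N.

Let V1 : V 1 = 0%N.
Proof. by apply: (@addnI (V 1)); rewrite -VM ?oner_neq0 ?mulr1 ?addn0 //; apply: hom1. Qed.

Let V_N d x : Ad d x -> x != 0 -> V (- x) = V x.
Proof.
move=> Ax x0; have h1 : hom (- 1) by exists 0; apply: grN; apply: gr1.
have n0 : - 1 != 0 :> R by rewrite oppr_eq0 oner_neq0.
have : V (-1 * -1) = 0%N by rewrite mulrNN mulr1 V1.
rewrite VM // => e; rewrite -mulN1r VM //; last by exists d.
by move: e; case: (V (-1)).
Qed.

Let ge (k : nat) x : Prop := forall d, cmp d x != 0 -> (k <= V (cmp d x))%N.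

Let geD (k : nat) x y : ge k x -> ge k y -> ge k (x + y).
Proof.
move=> hx hy d; rewrite cmpD.
have [->|x0] := eqVneq (cmp d x) 0; first by rewrite add0r; apply: hy.
have [->|y0] := eqVneq (cmp d y) 0; first by rewrite addr0; apply: hx.
move=> s0; have := VD (cmp_gr d x) (cmp_gr d y) x0 y0 s0.
by apply: leq_trans; rewrite leq_min hx // hy.
Qed.

Let ge0 (k : nat) : ge k 0.
Proof. by move=> d; rewrite cmp0 eqxx. Qed.

Let ge_sum (k : nat) (I : Type) (r : seq I) (p : pred I) (F : I -> R) :
  (forall i, p i -> ge k (F i)) -> ge k (\sum_(i <- r | p i) F i).
Proof. by move=> hF; apply: (big_ind (ge k)) => // x y; exact: geD. Qed.

Let geM (k l : nat) x y : ge k x -> ge l y -> ge (k + l) (x * y).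
Proof.
move=> hx hy; have [s [_ [-> _]]] := cmp_supp x; rewrite mulr_suml.
apply: ge_sum => d _ m; rewrite (cmp_homM _ _ (cmp_gr d x)) mulf_eq0 negb_or.
move=> /andP[x0 y0]; rewrite VM //; try exact: hom_cmp.
by rewrite leq_add ?hx ?hy.
Qed.

Definition gauss x : nat := mins (fun n : nat => exists d, cmp d x != 0 /\ V (cmp d x) = n).

Lemma gaussP x : x != 0 -> (exists d, cmp d x != 0 /\ V (cmp d x) = gauss x) /\
  forall d, cmp d x != 0 -> (gauss x <= V (cmp d x))%N.
Proof.
move=> x0; have [|h min_h] := @minsP (fun n : nat => exists d, cmp d x != 0 /\ V (cmp d x) = n).
  by have [d hd] := cmp_neq0 x0; exists (V (cmp d x)), d.
by split=> // d hd; apply: min_h; exists d.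
Qed.

Let gauss_ge (k : nat) x : x != 0 -> ge k x -> (k <= gauss x)%N.
Proof. by move=> /gaussP [[d [hd <-]] _]; apply. Qed.

Lemma gauss_hom d x : Ad d x -> x != 0 -> gauss x = V x.
Proof.
move=> Ax x0; have [[e [he <-]] _] := gaussP x0.
by move: he; rewrite (cmp_hom _ Ax); case: (e =P d) => // _; rewrite eqxx.
Qed.

Let lead_split x : x != 0 -> exists x1 x2, x = x1 + x2 /\ x1 != 0 /\
  (forall d, cmp d x1 != 0 -> V (cmp d x1) = gauss x) /\ ge (gauss x).+1 x2.
Proof.
move=> x0; have [s [us [ex hx]]] := cmp_supp x.
pose p d := V (cmp d x) == gauss x.
exists (\sum_(d <- s | p d) cmp d x), (\sum_(d <- s | ~~ p d) cmp d x).
split; first by rewrite [LHS]ex (bigID p).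
have e1 e : cmp e (\sum_(d <- s | p d) cmp d x) = if p e then cmp e x else 0.
  rewrite cmp_sum (eq_bigr (fun d => if d == e then cmp e x else 0)); last first.
    by move=> d _; rewrite (cmp_hom _ (cmp_gr d x)) eq_sym; case: eqP => [->|].
  rewrite -big_mkcondr -big_filter.
  rewrite (eq_filter (a2 := predI p (pred1 e))) // filter_predI.
  have [es|/hx ->] := boolP (e \in s); last by rewrite big1 ?if_same.
  by rewrite (filter_pred1_uniq us es) /=; case: (p e); rewrite ?big_seq1 ?big_nil.
split.
  have [[d [hd /eqP pd]] _] := gaussP x0; apply: contraNneq hd => e.
  by have := e1 d; rewrite e cmp0 /p pd => <-.
split=> [d|]; first by rewrite e1; case: ifP => [/eqP|]; rewrite ?eqxx.
apply: ge_sum => d pd e; rewrite (cmp_hom _ (cmp_gr d x)); case: (e =P d) => [_ hd|_]; last by rewrite eqxx.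
by rewrite ltn_neqAle eq_sym pd; apply: (gaussP x0).2.
Qed.

(** Gauss's lemma. Split off the parts x1, y1 formed by the components of minimal values k, l. The
    leading component of x1 y1 has value exactly k + l, while x y - x1 y1 has only components of
    larger value, so k + l is attained in x y. *)
Lemma is_val_gauss : is_val gauss.
Proof.
have gx x : x != 0 -> ge (gauss x) x by move=> x0 d; apply: (gaussP x0).2.
split=> x y x0 y0; last first.
  move=> s0; apply: gauss_ge => //; apply: geD => d hd.
    by apply: leq_trans (geq_minl _ _) _; apply: gx.
  by apply: leq_trans (geq_minr _ _) _; apply: gx.
have xy0 := mulf_neq0 x0 y0.
apply/eqP; rewrite eqn_leq andbC gauss_ge //=; last by apply: geM; apply: gx.
have [x1 [x2 [ex [x10 [hx1 hx2]]]]] := lead_split x0.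
have [y1 [y2 [ey [y10 [hy1 hy2]]]]] := lead_split y0.
have [n [xn Dx]] := top_ex x10; have [m [ym Dy]] := top_ex y10.
set k := gauss x in hx1 hx2 *; set l := gauss y in hy1 hy2 *.
pose r := x1 * y2 + x2 * y; have exy : x * y = x1 * y1 + r.
  by rewrite /r ex ey; ring.
have gr : ge (k + l).+1 r.
  apply: geD; first by rewrite -addnS; apply: geM => // d hd; rewrite hx1.
  by rewrite -addSn; apply: geM => //; apply: gx.
have := cmp_top Dx Dy; have : cmp (n + m) (x1 * y1) = cmp (n + m) (x * y) - cmp (n + m) r.
  by rewrite exy cmpD addrK.
move=> -> e; have t0 : cmp n x1 * cmp m y1 != 0 by apply: mulf_neq0.
have Vt : V (cmp n x1 * cmp m y1) = (k + l)%N.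
  by rewrite VM ?hx1 ?hy1 //; apply: hom_cmp.
rewrite leqNgt; apply/negP => lt.
have hxy : ge (k + l).+1 (x * y).
  by move=> d hd; apply: leq_trans lt _; apply: (gaussP xy0).2.
have : ge (k + l).+1 (x * y - r).
  apply: geD => // d; rewrite cmpN oppr_eq0 => hd.
  by rewrite (V_N (cmp_gr d r) hd); apply: gr.
move/(_ (n + m)); rewrite cmpB e => /(_ t0).
by rewrite Vt ltnn.
Qed.

End Gauss.

End Grading.

(** * Homogeneous divisors of a graded Krull domain *)

Section VleClosure.
Variable R : idomainType.
Implicit Types (E F : R -> Prop) (x y r s c g : R).

Lemma vle_in E c : E c -> vle E c.
Proof. by move=> Ec x y _; apply. Qed.

Lemma vle0 E : vle E 0.
Proof. by move=> x y _ _; rewrite mulr0; apply: divides0. Qed.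

Lemma vleD E c g : vle E c -> vle E g -> vle E (c + g).
Proof.
move=> hc hg x y y0 h; rewrite mulrDr; apply: divides_add; [exact: hc | exact: hg].
Qed.

Lemma vleM E r c : vle E c -> vle E (r * c).
Proof. by move=> hc x y y0 h; rewrite mulrCA; apply/divides_mull/hc. Qed.

Lemma vle_sum E (I : Type) (l : seq I) (h : I -> R) :
  (forall i, vle E (h i)) -> vle E (\sum_(i <- l) h i).
Proof. by move=> hh; apply: big_ind => //; [exact: vle0 | exact: vleD]. Qed.

Lemma vle_mulset E s g : vle E g -> vle (mulset s E) (s * g).
Proof.
move=> hg x y y0 h; rewrite mulrA; apply: hg => // e Ee.
by rewrite -mulrA; apply: h; exists e.
Qed.

Lemma vle_mulsetK E s g : s != 0 -> vle (mulset s E) (s * g) -> vle E g.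
Proof.
move=> s0 hg x y y0 h; apply: (divides_pmul2l s0); rewrite mulrCA.
apply: hg; first exact: mulf_neq0.
by move=> _ [e [Ee ->]]; rewrite mulrCA; apply/divides_mul2l/h.
Qed.

Lemma vle_mulset_factor E s c : s != 0 -> vle (mulset s E) c ->
  exists g, c = s * g /\ vle E g.
Proof.
move=> s0 hc; have [|g] := hc 1 s s0.
  by move=> _ [e [_ ->]]; rewrite mul1r; apply/divides_mulr/divides_refl.
rewrite mul1r mulrC => e; exists g; split=> //.
by apply: (vle_mulsetK s0); rewrite -e.
Qed.

End VleClosure.

Section GradedKrull.
Variables (R : idomainType) (Ad : int -> R -> Prop) (hA : Zgrading Ad) (kR : Krull R).
Implicit Types (E F : R -> Prop) (P : R -> Prop) (x y r s c e f g h u : R) (d : int).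
Local Notation cmp := (cmp hA).
Local Notation hom := (hom Ad).
Let hv := is_val_hord kR.
Let kv := krull_hord kR.

(** If [hord P] is not trivial on homogeneous elements, let W be the Gauss extension of its
    restriction. Then W is at most [hord P], so the center of W lies in P and equals it by
    minimality. Hence W agrees with [hord P] on a uniformizer and outside P, and so everywhere. *)
Lemma graded_dichotomy P :
  (forall h, hom h -> h != 0 -> hord P h = 0%N) \/
  (forall x d, cmp d x != 0 -> (hord P x <= hord P (cmp d x))%N).
Proof.
case: (pselect (forall h, hom h -> h != 0 -> hord P h = 0%N)) => [|nt]; [by left | right].
have [h [hh [h0 hPh]]] : exists h, hom h /\ h != 0 /\ hord P h <> 0%N.
  by apply: contrapT => no; apply: nt => h hh h0; apply: contrapT => ne; apply: no; exists h.
have hP : height_one P by apply: contrapT => out; apply: hPh; apply: hord_out.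
have VM x y : hom x -> hom y -> x != 0 -> y != 0 -> hord P (x * y) = (hord P x + hord P y)%N.
  by move=> _ _; apply: valM.
have VD d x y : Ad d x -> Ad d y -> x != 0 -> y != 0 -> x + y != 0 ->
    (minn (hord P x) (hord P y) <= hord P (x + y)%R)%N.
  by move=> _ _; apply: (hv P).2.
pose W := gauss hA (hord P); have hW : is_val W := is_val_gauss hA VM VD.
have WP x : x != 0 -> (W x <= hord P x)%N.
  move=> x0; have [s [_ [e _]]] := cmp_supp hA x.
  suff : vge (hord P) (W x) x by apply.
  by rewrite [X in vge _ _ X]e; apply: vge_sum => // d; apply: (gaussP hA (hord P) x0).2.
have PW x : P x -> center W x.
  case: (hP) => _ [_]; apply; first exact: center_prime.
    exists h; split=> //; right; have [d Ah] := hh.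
    by rewrite /W (gauss_hom hA _ Ah) // lt0n; apply/eqP.
  move=> y [->|]; first by case: hP => -[[]].
  have [->|y0] := eqVneq y 0; first by case: hP => -[[]].
  by move=> lt; apply/(hord_gt0 kR) => //; apply: leq_trans lt (WP _ y0).
have [p hp] := krull_unif kR hP; have [primeP [Pp [p0 _]]] := hp.
have p1 : hord P p = 1%N by rewrite hordE // (ord_unif hp).
have Wp : W p = 1%N.
  have := WP p p0; rewrite p1; case: (PW p Pp) => [e|]; last by lia.
  by rewrite e eqxx in p0.
have W0 s : ~ P s -> W s = 0%N.
  move=> Ps; have s0 := notin_neq0 primeP Ps.
  by have := WP s s0; rewrite [hord _ _]hordE // (ord_notin hp Ps); lia.
move=> x d hd; have x0 : x != 0 by apply: contraNneq hd => ->; rewrite cmp0.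
suff -> : hord P x = W x by apply: (gaussP hA (hord P) x0).2.
have [s [t [Ps [Pt e]]]] := ord_spec hp x0; rewrite hordE //.
have s0 := notin_neq0 primeP Ps; have t0 := notin_neq0 primeP Pt.
by have := congr1 W e; rewrite !valM ?expf_neq0 // valX // Wp (W0 s Ps) (W0 t Pt) muln1 !add0n => ->.
Qed.

(** Checked at each P: either u has value 0 there, or passing from g and h to components does not
    lower values. *)
Lemma hom_divides_cmp u g h k l : hom u -> u != 0 -> divides u (g * h) ->
  divides u (cmp k g * cmp l h).
Proof.
move=> hu u0 d.
have [->|g0] := eqVneq (cmp k g) 0; first by rewrite mul0r; apply: divides0.
have [->|h0] := eqVneq (cmp l h) 0; first by rewrite mulr0; apply: divides0.
have gn : g != 0 by apply: contraNneq g0 => ->; rewrite cmp0.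
have hn : h != 0 by apply: contraNneq h0 => ->; rewrite cmp0.
apply: kv.2.2 => // [|P]; first exact: mulf_neq0.
case: (graded_dichotomy P) => [-> //|hP]; rewrite valM //.
have := val_divides (hv P) (mulf_neq0 gn hn) d; rewrite valM //.
by have := hP _ _ g0; have := hP _ _ h0; lia.
Qed.

(** The closure of a homogeneous set is a graded ideal: where homogeneous elements have value 0 the
    bound is trivial, elsewhere components have larger values than g. *)
Lemma vle_cmp F g j : nonzero_set F -> (forall f, F f -> hom f) -> vle F g ->
  vle F (cmp j g).
Proof.
move=> nF hF Fg; apply: (vle_dom kv) => g0 P.
have gn : g != 0 by apply: contraNneq g0 => ->; rewrite cmp0.
case: (graded_dichotomy P) => hP.
  by have [f [Ff f0]] := nF; exists f; rewrite (hP f) //; apply: hF.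
have [f [Ff [f0 le]]] := vle_hord kR P nF Fg gn.
by exists f; do 2!split=> //; apply: leq_trans le (hP _ _ g0).
Qed.

(** Write r e = s g with g in the closure of F. The leading components satisfy the same equation,
    and that of g is again in the closure by [vle_cmp]; so r and s may be replaced by their leading
    components. *)
Lemma veq_top E F r s : nonzero_set E -> nonzero_set F ->
  (forall e, E e -> hom e) -> (forall f, F f -> hom f) -> r != 0 -> s != 0 ->
  veq (mulset r E) (mulset s F) ->
  exists r' s', hom r' /\ hom s' /\ r' != 0 /\ s' != 0 /\
    veq (mulset r' E) (mulset s' F).
Proof.
move=> nE nF hE hF r0 s0 [h1 h2].
have [n [rn Dr]] := top_ex hA r0; have [m [sm Ds]] := top_ex hA s0.
have aux E' F' r' s' n' m' : nonzero_set F' -> (forall e, E' e -> hom e) ->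
    (forall f, F' f -> hom f) -> s' != 0 -> cmp n' r' != 0 -> deg_le hA n' r' ->
    cmp m' s' != 0 -> deg_le hA m' s' ->
    (forall c, mulset r' E' c -> vle (mulset s' F') c) ->
    forall c, mulset (cmp n' r') E' c -> vle (mulset (cmp m' s') F') c.
  move=> nF' hE' hF' s'0 rn' Dr' sm' Ds' h _ [e [Ee ->]].
  have [->|e0] := eqVneq e 0; first by rewrite mulr0; apply: vle0.
  have [|g [eg Fg]] := vle_mulset_factor s'0 (h (r' * e) _); first by exists e.
  have r'0 : r' != 0 by apply: contraNneq rn' => ->; rewrite cmp0.
  have g0 : g != 0.
    by apply: contraNneq (mulf_neq0 r'0 e0) => g0; rewrite eg g0 mulr0.
  have [k Ae] := hE' e Ee; have [j [gj Dg]] := top_ex hA g0.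
  have De := deg_le_gr hA Ae; have ek := cmp_hom_id hA Ae.
  have t1 := cmp_top Dr' De; have t2 := cmp_top Ds' Dg.
  have nk : n' + k = m' + j.
    apply: (@top_unique _ _ hA _ _ (r' * e)).
    - by rewrite t1 mulf_neq0 // ek.
    - exact: deg_leM.
    - by rewrite eg t2 mulf_neq0.
    - by rewrite eg; apply: deg_leM.
  have -> : cmp n' r' * e = cmp m' s' * cmp j g by rewrite -t2 -eg -nk t1 ek.
  by apply: vle_mulset; apply: vle_cmp.
exists (cmp n r), (cmp m s); do 2!(split; first exact: hom_cmp).
do 2!split=> //; split; [exact: aux h1 | exact: aux h2].
Qed.

(** Pseudo-division of f by g: leading coefficients are homogeneous, so multiplying by them is
    harmless once homogeneous elements are inverted. Remainders stay in the closure of E, and one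
    with a window shorter than that of g is 0. *)
Lemma hom_euclid E g a n : g != 0 -> vle E g -> in_window hA a n g ->
  (forall f b m, vle E f -> in_window hA b m f -> (m < n)%N -> f = 0) ->
  forall f, vle E f -> exists u h, hom u /\ u != 0 /\ u * f = g * h.
Proof.
move=> g0 Eg gn small f Ef; have [b [N fN]] := in_window_ex hA f.
elim: N b f Ef fN => [|N IH] b f Ef fN.
  have -> := in_window0 fN; exists 1, 0; rewrite !mulr0 oner_neq0.
  by split=> //; exact: hom1.
case: n gn small => [/in_window0 e _|n gn small]; first by rewrite e eqxx in g0.
have [lt|le] := ltnP N n.
  exists 1, 0; rewrite (small f b N.+1) // !mulr0 oner_neq0.
  by split=> //; exact: hom1.
have Dg := in_window_top gn; have Df := in_window_top fN.
set gt := cmp (a + n%:Z) g; set ft := cmp (b + N%:Z) f.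
have gt0 : gt != 0.
  apply/eqP => /(in_window_shrink gn) gn'.
  by move: g0; rewrite (small g a n) ?eqxx.
have Agt := cmp_gr hA (a + n%:Z) g; have Aft := cmp_gr hA (b + N%:Z) f.
(* As n <= N, both products have their degrees among the N + 1 ones starting at a + n + b, and their
   top components cancel. *)
have [||u [h [hu [u0 e]]]] := IH (a + n%:Z + b) (gt * f - ft * g).
- by apply: vleD; [apply: vleM | rewrite -mulNr; apply: vleM].
- apply: in_window_shrink; last first.
    rewrite cmpB !(cmp_homM _ _ _ Agt) !(cmp_homM _ _ _ Aft).
    have -> : a + n%:Z + b + N%:Z - (a + n%:Z) = b + N%:Z by lia.
    have -> : a + n%:Z + b + N%:Z - (b + N%:Z) = a + n%:Z by lia.
    by rewrite mulrC subrr.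
  move=> d; rewrite cmpB (cmp_homM _ _ _ Agt) (cmp_homM _ _ _ Aft).
  have [f0|/fN] := eqVneq (cmp (d - (a + n%:Z)) f) 0; last by lia.
  rewrite f0 mulr0 sub0r oppr_eq0 mulf_eq0 negb_or => /andP[_ /gn]; lia.
exists (u * gt), (h + u * ft); split; first by apply: homM => //; apply: hom_cmp.
by rewrite mulf_neq0 //; split=> //; rewrite mulrDr -e; ring.
Qed.

(* After inverting the homogeneous elements R becomes a principal ideal domain,
   in which the divisorial closure of E is generated by an element g with the
   least number of degrees in its support. *)
Lemma homogenize E : nonzero_set E ->
  exists E', nonzero_set E' /\ (forall e, E' e -> hom e) /\ vsim E E'.
Proof.
move=> nE; have [e0 [Ee0 e00]] := nE.
have [n [[g [a [g0 [Eg gn]]]] min_n]] : exists n : nat,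
    (exists g a, g != 0 /\ vle E g /\ in_window hA a n g) /\
    forall m : nat, (exists g a, g != 0 /\ vle E g /\ in_window hA a m g) -> (n <= m)%N.
  apply: min_nat; have [a [n hn]] := in_window_ex hA e0.
  by exists n, e0, a; split=> //; split=> //; apply: vle_in.
have small f b m : vle E f -> in_window hA b m f -> (m < n)%N -> f = 0.
  move=> Ef fm lt; apply/eqP/negP => /negP f0.
  by have := min_n m (ex_intro _ f (ex_intro _ b (conj f0 (conj Ef fm)))); lia.
have div := hom_euclid g0 Eg gn small.
have [t [gt0 Dg]] := top_ex hA g0; set gt := cmp t g in gt0.
have hgt : hom gt by apply: hom_cmp.
(* From f / g = h / u the fraction f / g has the homogeneous components h_l / u. The factor gt
   clears the denominators, since u divides gt h_l by [hom_divides_cmp]. So E' holds the components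
   of gt E / g, and gt f is g times a sum of elements of E'. *)
pose E' m := exists f u h l, E f /\ hom u /\ u != 0 /\ u * f = g * h /\
  u * m = gt * cmp l h.
have exm f u h l : E f -> hom u -> u != 0 -> u * f = g * h -> exists m, u * m = gt * cmp l h.
  move=> Ef hu u0 e; have [m em] : divides u (gt * cmp l h).
    apply: hom_divides_cmp => //.
    by rewrite -e mulrC; apply/divides_mull/divides_refl.
  by exists m; rewrite mulrC.
have hE' m : E' m -> hom m.
  move=> [f [u [h [l [_ [hu [u0 [_ e]]]]]]]]; apply: (hom_factor hA hu u0).
  by rewrite e; apply: homM => //; apply: hom_cmp.
exists E'; split; last split=> //.
  have [u [h [hu [u0 e]]]] := div e0 (vle_in Ee0).
  have h0 : h != 0 by apply: contraNneq (mulf_neq0 u0 e00) => h0; rewrite e h0 mulr0.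
  have [l hl] := cmp_neq0 hA h0; have [m em] := exm _ _ _ l Ee0 hu u0 e.
  exists m; split; first by exists e0, u, h, l.
  by apply: contraNneq (mulf_neq0 gt0 hl) => m0; rewrite -em m0 mulr0.
exists gt, g; do 2!split=> //; split=> _ [f [Ef ->]]; last first.
  have [u [h [hu [u0 e]]]] := div f (vle_in Ef).
  have [s [_ [eh _]]] := cmp_supp hA h.
  have [m hm] := choice (fun l => exm _ _ _ l Ef hu u0 e).
  have -> : gt * f = \sum_(l <- s) g * m l.
    apply: (mulfI u0); rewrite mulrCA e eh !mulr_sumr; apply: eq_bigr => l _.
    by rewrite [RHS]mulrCA hm; ring.
  apply: vle_sum => l; apply: vle_in; exists (m l); split=> //.
  by exists f, u, h, l.
case: Ef => f' [u [h [l [Ef' [hu [u0 [e em]]]]]]]; set m := f in em *.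
apply: (vle_dom kv) => c0 P.
have m0 : m != 0 by apply: contraNneq c0 => ->; rewrite mulr0.
have hl0 : cmp l h != 0.
  by apply: contraNneq (mulf_neq0 u0 m0) => h0; rewrite em h0 mulr0.
have h0 : h != 0 by apply: contraNneq hl0 => ->; rewrite cmp0.
have f'0 : f' != 0.
  by apply: contraNneq (mulf_neq0 g0 h0) => f0; rewrite -e f0 mulr0.
(* Where homogeneous elements have value 0, gt is invisible, and g, being in the closure of E, has
   at least the value of some element of E. *)
case: (graded_dichotomy P) => hP.
  have [e1 [Ee1 [e10 le]]] := vle_hord kR P nE Eg g0.
  exists (gt * e1); split; first by exists e1.
  by rewrite mulf_neq0 // !valM // (hP gt) //; split=> //; lia.
exists (gt * f'); split; first by exists f'.
rewrite mulf_neq0 //; split=> //; rewrite !valM //.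
have := congr1 (hord P) e; have := congr1 (hord P) em; rewrite !valM //.
by have := hP _ _ hl0; lia.
Qed.

End GradedKrull.

(** * Promoting commutative rings to integral domains *)

Section DomainStructure.
Variable R : comPzRingType.
Hypothesis dom : is_domain R.
Definition cinv (x : R) : R := if pselect (exists y, y * x = 1) is left h then projT1 (cid h) else x.
Definition cunit : pred R := fun x => `[< exists y, y * x = 1 >].
Lemma cmulVr : {in cunit, left_inverse 1 cinv *%R}.
Proof. move=> x /asboolP hx; rewrite /cinv; case: pselect => // h; by case: (cid h). Qed.
Lemma cunitP x y : y * x = 1 -> cunit x.
Proof. by move=> h; apply/asboolP; exists y. Qed.
Lemma cinv_out : {in [predC cunit], cinv =1 id}.
Proof. move=> x /negP hx; rewrite /cinv; case: pselect => // h; by case: hx; apply/asboolP. Qed.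
Lemma cidom (x y : R) : x * y = 0 -> (x == 0) || (y == 0).
Proof. by move/(proj2 dom) => [->|->]; rewrite eqxx ?orbT. Qed.
End DomainStructure.

Lemma nonzero_nzring (R : comPzRingType) : 1 != 0 :> R -> exists R' : comNzRingType, R = R' :> comPzRingType.
Proof.
case: R => T cls n1.
pose R := GRing.ComPzRing.Pack cls.
pose nz := GRing.PzSemiRing_isNonZero.Build R n1.
pose N : comNzRingType := HB.pack (GRing.ComPzRing.sort R) nz.
by exists N.
Qed.

(** An equality of structures allows B to be replaced by [subst], with no transport of [presents],
    [is_Krull] or class groups. *)
Lemma domain_idomain (R : comPzRingType) : is_domain R -> exists R' : idomainType, R = R' :> comPzRingType.
Proof.
case: R => T cls dom.
pose R := GRing.ComPzRing.Pack cls.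
pose nz := GRing.PzSemiRing_isNonZero.Build R (proj1 dom).
pose N : comNzRingType := HB.pack (GRing.ComPzRing.sort R) nz.
pose um := GRing.ComNzRing_hasMulInverse.Build N (@cmulVr R) (@cunitP R) (@cinv_out R).
pose U : comUnitRingType := HB.pack (GRing.ComPzRing.sort R) nz um.
pose im := GRing.ComUnitRing_isIntegral.Build U (@cidom R dom).
pose D : idomainType := HB.pack (GRing.ComPzRing.sort R) nz um im.
by exists D.
Qed.

(** * Dividing the degrees by their common factor *)

Section Regrading.
Variables (A : idomainType) (Ad : int -> A -> Prop) (hA : Zgrading Ad).
Implicit Types (a x : A) (n k : int).

Lemma hom_exp n a (i : nat) : Ad n a -> Ad (n * i%:Z) (a ^+ i).
Proof.
move=> Aa; elim: i => [|i IH]; first by rewrite mulr0 expr0; apply: gr1.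
by rewrite exprS intS mulrDr mulr1; apply: grM.
Qed.

Lemma regrade (m : nat) : (0 < m)%N ->
  (forall n a, Ad n a -> a != 0 -> exists k, n = m%:Z * k) ->
  Zgrading (fun k => Ad (m%:Z * k)).
Proof.
move=> m0 hm; split; last split; last split.
- by move=> d; split; [exact: gr0 | move=> x y; apply: grB].
- by move=> d e x y; rewrite mulrDr; apply: grM.
- move=> x; have [s [us [ex hx]]] := cmp_supp hA x.
  exists [seq (d %/ m)%Z | d <- s & cmp hA d x != 0], (fun k => cmp hA (m%:Z * k) x).
  split=> [d|]; first exact: cmp_gr.
  rewrite big_map big_filter [LHS]ex (bigID (fun d => cmp hA d x != 0)) /= [X in _ + X]big1.
    rewrite addr0; apply: eq_bigr => d hd; congr (cmp hA _ x).
    have [k ->] := hm _ _ (cmp_gr hA d x) hd; by rewrite mulKz //; lia.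
  by move=> d /negPn /eqP.
move=> s us h Ah hs d ds.
have us' : uniq [seq m%:Z * k | k <- s].
  by rewrite map_inj_uniq // => k k' /mulfI; apply; lia.
(* The independence axiom wants a homogeneous family over all integers, so the entries at
   non-multiples of m are set to 0. *)
have := hA.2.2.2 _ us' (fun n => h (n %/ m)%Z *+ (n == m%:Z * (n %/ m)%Z)).
have mK k : (m%:Z * k %/ m)%Z = k by rewrite mulKz //; lia.
move=> /(_ _ _ (m%:Z * d)) /=; rewrite mK eqxx mulr1n; apply.
- by move=> n; case: eqP => [e|_]; rewrite ?mulr1n ?mulr0n; [rewrite [n in Ad n]e | exact: gr0].
- by rewrite big_map -[RHS]hs; apply: eq_bigr => k _; rewrite mK eqxx.
- exact: map_f.
Qed.

(** Take the least positive difference m of two degrees of nonzero homogeneous elements. The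
    remainder of any degree modulo m would again be such a difference, so m divides all degrees, and
    after division the gap is 1. Without any gap F has the degree 0 of the unit, whence c = 1. *)
Lemma exists_unit_gap (c : nat) (F : A) d : F != 0 -> Ad d F -> coprime c `|d|%N ->
  exists Ad' : int -> A -> Prop, Zgrading Ad' /\
    (exists d', Ad' d' F /\ coprime c `|d'|%N) /\
    (c = 1%N \/ exists n w1 w2, Ad' (n + 1) w1 /\ Ad' n w2 /\ w1 != 0 /\ w2 != 0).
Proof.
move=> F0 AF cd.
pose gap (m : nat) := (0 < m)%N /\ exists n w1 w2,
  Ad (n + m%:Z) w1 /\ Ad n w2 /\ w1 != 0 /\ w2 != 0.
case: (pselect (exists m, gap m)) => [/min_nat [m [[m0 [k [w1 [w2 [A1 [A2 [w10 w20]]]]]]] min_m]]|no].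
  have dvd n a : Ad n a -> a != 0 -> exists q, n = m%:Z * q.
    move=> Aa a0; have [q [r [e [r0 rm]]]] : exists q r : int, n = q * m%:Z + r /\ 0 <= r /\ r < m%:Z.
      exists (n %/ m)%Z, (n %% m)%Z; rewrite -divz_eq modz_ge0 ?ltz_pmod //; lia.
    exists q.
    suff r_0 : r = 0 by rewrite e r_0 addr0 mulrC.
    apply/eqP; apply: contraT => rn.
    have : (m <= absz r)%N; last by lia.
    apply: min_m; split; first by lia.
    have e1 (i : nat) := hom_exp i A1; have e2 (i : nat) := hom_exp i A2.
    (* With n = q m + r, the degrees of a w2^q and w1^q differ by exactly r; for negative q the
       roles of w1 and w2 are exchanged to keep exponents natural. *)
    case: (lerP 0 q) => q0.
      exists ((k + m%:Z) * (absz q)%:Z), (a * w2 ^+ absz q), (w1 ^+ absz q).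
      split; last by rewrite mulf_neq0 ?expf_neq0.
      have -> : (k + m%:Z) * (absz q)%:Z + (absz r)%:Z = n + k * (absz q)%:Z.
        have -> : (absz q)%:Z = q by lia.
        have -> : (absz r)%:Z = r by lia.
        by rewrite e; ring.
      exact: grM.
    exists (k * (absz q)%:Z), (a * w1 ^+ absz q), (w2 ^+ absz q).
    split; last by rewrite mulf_neq0 ?expf_neq0.
    have -> : k * (absz q)%:Z + (absz r)%:Z = n + (k + m%:Z) * (absz q)%:Z.
      have -> : (absz q)%:Z = - q by lia.
      have -> : (absz r)%:Z = r by lia.
      by rewrite e; ring.
    exact: grM.
  exists (fun k => Ad (m%:Z * k)); split; first exact: regrade.
  have [d' ed] := dvd d F AF F0.
  split.
    exists d'; rewrite -ed; split=> //; apply: coprime_dvdr cd.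
    by rewrite ed abszM dvdn_mull.
  right; have [k' ek] := dvd k w2 A2 w20; exists k', w1, w2.
  by rewrite -ek mulrDr mulr1 -ek.
exists Ad; split=> //; split; first by exists d.
left; suff d0 : d = 0 by move: cd; rewrite d0 /coprime gcdn0 => /eqP.
apply: contrapT => d0; apply: no; exists (absz d); split; first by lia.
have A1 := gr1 hA.
case: (lerP 0 d) => dp.
  by exists 0, F, 1; rewrite add0r oner_neq0; have -> : (absz d)%:Z = d by lia.
by exists d, 1, F; rewrite oner_neq0; have -> : d + (absz d)%:Z = 0 by lia.
Qed.

End Regrading.

(** * Homogeneous fractions and the embedding of B *)

Section HomogeneousFractions.
Variables (A : idomainType) (Ad : int -> A -> Prop) (hA : Zgrading Ad).
Variables (K : fieldType) (f : {rmorphism A -> K}) (ff : is_frac_field f).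
Implicit Types (a b x : A) (n m : int) (k l u : K).
Let f_eq0 := frac_eq0 ff.

Definition fhom n k : Prop := exists m a b,
  Ad (n + m) a /\ Ad m b /\ b != 0 /\ k = f a / f b.

Lemma fhom_f n a : Ad n a -> fhom n (f a).
Proof.
move=> Aa; exists 0, a, 1; rewrite addr0 rmorph1 divr1 oner_neq0.
by do !split=> //; apply: gr1.
Qed.

Lemma fhom1 : fhom 0 1.
Proof. by rewrite -(rmorph1 f); apply: fhom_f; apply: gr1. Qed.

Lemma fhomM n m k l : fhom n k -> fhom m l -> fhom (n + m) (k * l).
Proof.
move=> [n' [a [b [Aa [Ab [b0 ->]]]]]] [m' [a' [b' [Aa' [Ab' [b'0 ->]]]]]].
exists (n' + m'), (a * a'), (b * b'); rewrite addrACA mulf_neq0 //.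
do 3?[split => //]; try exact: grM.
by rewrite !rmorphM mulf_div.
Qed.

Lemma fhomV n k : k != 0 -> fhom n k -> fhom (- n) k^-1.
Proof.
move=> k0 [m [a [b [Aa [Ab [b0 e]]]]]]; exists (n + m), b, a.
rewrite addKr e invf_div; do 2!split=> //.
by split=> //; apply: contraNneq k0 => a0; rewrite e a0 rmorph0 mul0r.
Qed.

Lemma fhomX n k (i : nat) : fhom n k -> fhom (n * i%:Z) (k ^+ i).
Proof.
move=> hk; elim: i => [|i IH]; first by rewrite mulr0; apply: fhom1.
by rewrite exprS intS mulrDr mulr1; apply: fhomM.
Qed.

Lemma fhomXz n k (e : int) : k != 0 -> fhom n k -> fhom (n * e) (k ^ e).
Proof.
move=> k0 hk; case: e => i; first exact: fhomX.
by rewrite NegzE mulrN -exprnN; apply: fhomV; [apply: expf_neq0 | apply: fhomX].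
Qed.

Lemma fhom_common_den (J : eqType) (s : seq J) (deg : J -> int) (k : J -> K) :
  (forall j, j \in s -> fhom (deg j) (k j)) ->
  exists D M, Ad M D /\ D != 0 /\
    forall j, j \in s -> exists a, Ad (deg j + M) a /\ f D * k j = f a.
Proof.
elim: s => [|j s IH] hk; first by exists 1, 0; rewrite oner_neq0; split=> //; apply: gr1.
have [|D [M [AD [D0 hD]]]] := IH; first by move=> i si; apply: hk; rewrite inE si orbT.
have [|m [a [b [Aa [Ab [b0 ek]]]]]] := hk j; first by rewrite inE eqxx.
exists (D * b), (M + m); rewrite mulf_neq0 //; split; first exact: grM.
split=> // i; rewrite inE => /orP[/eqP ->|/hD [a' [Aa' e']]].
  exists (D * a); rewrite addrCA; split; first exact: grM.
  by rewrite ek !rmorphM; field; rewrite f_eq0.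
exists (a' * b); rewrite addrA; split; first exact: grM.
by rewrite !rmorphM -e' mulrAC.
Qed.

(** Multiplying by a homogeneous common denominator moves the relation into A, where components are
    unique. *)
Lemma fhom_indep (J : eqType) (s : seq J) (deg : J -> int) (k : J -> K) :
  uniq s -> {in s &, injective deg} ->
  (forall j, j \in s -> fhom (deg j) (k j)) ->
  \sum_(j <- s) k j = 0 -> forall j, j \in s -> k j = 0.
Proof.
move=> us dinj hk s0 j sj; have [D [M [AD [D0 hD]]]] := fhom_common_den hk.
have [a ha] : exists a : J -> A, forall i, i \in s -> Ad (deg i + M) (a i) /\ f D * k i = f (a i).
  have [|a ha] := choice (P := fun i a => i \in s -> Ad (deg i + M) a /\ f D * k i = f a).
    move=> i; case: (boolP (i \in s)) => [/hD [a ha]|_]; [by exists a | by exists 0].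
  by exists a.
have : \sum_(i <- s) a i = 0.
  have e : \sum_(i <- s) f D * k i = 0 by rewrite -mulr_sumr s0 mulr0.
  apply: ff.1; rewrite rmorph0 rmorph_sum /= -[RHS]e.
  by rewrite [LHS]big_seq [RHS]big_seq; apply: eq_bigr => i /ha [_ ->].
move/(congr1 (cmp hA (deg j + M))); rewrite cmp0 cmp_sum big_seq.
rewrite (eq_bigr (fun i => if i == j then a j else 0)); last first.
  move=> i si; have [Ai _] := ha i si; rewrite (cmp_hom hA _ Ai).
  have [->|ne] := eqVneq i j; first by rewrite eqxx.
  by case: eqP => // /addIr /(dinj _ _ sj si) e; rewrite e eqxx in ne.
rewrite -big_seq -big_mkcond -big_filter (filter_pred1_uniq us sj) big_seq1 => aj0.
have [_] := ha j sj; rewrite aj0 rmorph0 => /eqP.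
by rewrite mulf_eq0 f_eq0 (negPf D0) => /eqP.
Qed.

Section Twist.
Variables (u : K) (u0 : u != 0).

(** The coaction A -> A[t, 1/t] of the grading, followed by t = u. *)
Definition twist x : K := \sum_(n <- sval (cid (cmp_supp hA x))) f (cmp hA n x) * u ^ n.

Lemma twistE x (s : seq int) : uniq s -> (forall n, n \notin s -> cmp hA n x = 0) ->
  twist x = \sum_(n <- s) f (cmp hA n x) * u ^ n.
Proof.
move=> us hs; rewrite /twist; case: cid => t /= [ut [_ ht]].
pose r := undup (s ++ t); have ur : uniq r by apply: undup_uniq.
have sr : {subset s <= r} by move=> i si; rewrite mem_undup mem_cat si.
have tr : {subset t <= r} by move=> i si; rewrite mem_undup mem_cat si orbT.
transitivity (\sum_(n <- r) f (cmp hA n x) * u ^ n).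
  by apply: sum_supp => // n /ht ->; rewrite rmorph0 mul0r.
by apply/esym/sum_supp => // n /hs ->; rewrite rmorph0 mul0r.
Qed.

Lemma twist_hom n a : Ad n a -> twist a = f a * u ^ n.
Proof.
move=> Aa; rewrite (@twistE a [:: n]) //; first by rewrite big_seq1 (cmp_hom_id hA Aa).
by move=> m; rewrite inE (cmp_hom hA _ Aa) => /negPf ->.
Qed.

Lemma twist_zmod : zmod_morphism twist.
Proof.
move=> x y; have [s [us [_ hs]]] := cmp_supp hA x; have [t [ut [_ ht]]] := cmp_supp hA y.
pose r := undup (s ++ t); have ur : uniq r by apply: undup_uniq.
have hx n : n \notin r -> cmp hA n x = 0.
  by rewrite mem_undup mem_cat negb_or => /andP[/hs].
have hy n : n \notin r -> cmp hA n y = 0.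
  by rewrite mem_undup mem_cat negb_or => /andP[_ /ht].
rewrite !(twistE ur) //; last by move=> n nr; rewrite cmpB hx ?hy ?subr0.
by rewrite -sumrB; apply: eq_bigr => n _; rewrite cmpB rmorphB mulrBl.
Qed.

HB.instance Definition _ := GRing.isZmodMorphism.Build A K twist twist_zmod.

Lemma twist_homM n a x : Ad n a -> twist (a * x) = f a * u ^ n * twist x.
Proof.
move=> Aa; have [s [us [ex hx]]] := cmp_supp hA x.
rewrite [in LHS]ex [in RHS]ex mulr_sumr !raddf_sum /= mulr_sumr; apply: eq_bigr => m _.
have Am := cmp_gr hA m x; rewrite (twist_hom (grM hA Aa Am)) (twist_hom Am).
by rewrite rmorphM expfzDr //; ring.
Qed.

Lemma twist_monoid : monoid_morphism twist.
Proof.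
split; first by rewrite (twist_hom (gr1 hA)) rmorph1 mul1r.
move=> x y; have [s [us [ex hx]]] := cmp_supp hA x.
rewrite [in LHS]ex [in RHS]ex mulr_suml !raddf_sum /= mulr_suml; apply: eq_bigr => m _.
by have Am := cmp_gr hA m x; rewrite (twist_homM _ Am) (twist_hom Am).
Qed.

HB.instance Definition _ := GRing.isMonoidMorphism.Build A K twist twist_monoid.

Definition twist_rmorphism : {rmorphism A -> K} := twist.

End Twist.

Lemma mulzX (x y : K) (i j i' j' : int) : x != 0 -> y != 0 ->
  (x ^ i * y ^ j) * (x ^ i' * y ^ j') = x ^ (i + i') * y ^ (j + j').
Proof. by move=> x0 y0; rewrite mulrACA -!expfzDr. Qed.

Lemma mulzXX (x y : K) (i j e : int) : (x ^ i * y ^ j) ^ e = x ^ (i * e) * y ^ (j * e).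
Proof. by rewrite expfzMl -!exprz_exp. Qed.

(* With w of degree 1 and d * p + c * q = -1, take u = F^p w^(c (1 + q)) and
   zeta = F^(-q) w^(d (1 + q)); then u = (w u)^(1 + q) zeta^p. *)
Lemma exists_twist_root (c : nat) (F : A) (d : int) : F != 0 -> Ad d F -> coprime c `|d|%N ->
  (c = 1%N \/ exists n w1 w2, Ad (n + 1) w1 /\ Ad n w2 /\ w1 != 0 /\ w2 != 0) ->
  exists u zeta, u != 0 /\ zeta != 0 /\ fhom (c%:Z - 1) u /\ fhom d zeta /\
    zeta ^+ c = f F * u ^ d /\
    forall L : K -> Prop, L 1 -> (forall k l, L k -> L l -> L (k * l)) ->
      (forall k, k != 0 -> L k -> L k^-1) -> L zeta ->
      (forall n a, Ad n a -> a != 0 -> L (f a * u ^ n)) -> L u.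
Proof.
move=> F0 AF cd [->|[k [w1 [w2 [A1 [A2 [w10 w20]]]]]]].
  (* For c = 1 the required degree of u is 0, so u = 1 serves. *)
  exists 1, (f F); rewrite oner_neq0 f_eq0 F0 subrr expr1 exp1rz mulr1.
  do 2!split=> //; split; first exact: fhom1.
  by split; first exact: fhom_f.
have [p [q epq]] : exists p q : int, d * p + c%:Z * q = -1.
  have [x [y e]] : exists x y : int, x * d + y * c%:Z = 1.
    have [x [y e]] := Bezoutz d c; exists x, y; rewrite e.
    by move: cd; rewrite coprime_sym /coprime => /eqP cd; rewrite /gcdz absz_nat cd.
  by exists (- x), (- y); lia.
pose w := f w1 / f w2.
have w0 : w != 0 by rewrite mulf_neq0 ?invr_eq0 ?f_eq0.
have fF0 : f F != 0 by rewrite f_eq0.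
have fw : fhom 1 w by exists k, w1, w2; rewrite addrC.
have fF := fhom_f AF.
pose u := f F ^ p * w ^ (c%:Z * (1 + q)); pose zeta := f F ^ (- q) * w ^ (d * (1 + q)).
have u0 : u != 0 by rewrite mulf_neq0 // expfz_neq0.
have zeta0 : zeta != 0 by rewrite mulf_neq0 // expfz_neq0.
exists u, zeta; do 2!split=> //; split.
  have -> : c%:Z - 1 = d * p + 1 * (c%:Z * (1 + q)).
    by rewrite mul1r mulrDr mulr1 addrCA epq.
  by apply: fhomM; apply: fhomXz.
split.
  have -> : d = d * (- q) + 1 * (d * (1 + q)) by ring.
  by apply: fhomM; apply: fhomXz.
split.
  rewrite exprnP /zeta /u !mulzXX.
  have -> : f F * (f F ^ (p * d) * w ^ (c%:Z * (1 + q) * d)) =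
      f F ^ (1 + p * d) * w ^ (c%:Z * (1 + q) * d) by rewrite mulrA expfzDr // expr1z.
  (* The exponents of F agree because -q c = 1 + p d, which is the relation [epq]. *)
  by congr (_ ^ _ * _ ^ _); lia.
(* L stands for the fractions of homogeneous elements in the image of B; u in L means that the twist
   can be undone inside the image. *)
move=> L L1 LM LV Lz Lu.
have LX l (i : nat) : L l -> L (l ^+ i).
  by move=> Ll; elim: i => [|i IH]; rewrite ?expr0 // exprS; apply: LM.
have LXz l (e : int) : l != 0 -> L l -> L (l ^ e).
  move=> l0 Ll; case: e => i; first exact: LX.
  by rewrite NegzE -exprnN; apply: LV; [apply: expf_neq0 | apply: LX].
(* As w1 and w2 differ in degree by one, w u is the quotient of the twists of w1 and w2. *)
have Lwu : L (w * u).
  have -> : w * u = (f w1 * u ^ (k + 1)) * (f w2 * u ^ k)^-1.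
    rewrite /w expfzDr // expr1z; have uk : u ^ k != 0 by rewrite expfz_neq0.
    have fw20 : f w2 != 0 by rewrite f_eq0.
    by field; rewrite uk fw20.
  by apply: LM; [apply: Lu | apply: LV; [rewrite mulf_neq0 ?f_eq0 ?expfz_neq0 | apply: Lu]].
have -> : u = (w * u) ^ (1 + q) * zeta ^ p.
  have -> : w * u = f F ^ p * w ^ (c%:Z * (1 + q) + 1) by rewrite mulrCA expfzDr // expr1z [w * _]mulrC.
  rewrite !mulzXX mulzX //; congr (_ ^ _ * _ ^ _); first by ring.
  transitivity ((1 + q) * (c%:Z * q + c%:Z + 1 + d * p)); last by ring.
  have -> : d * p = -1 - c%:Z * q by rewrite -epq addrK.
  by ring.
by apply: LM; apply: LXz => //; rewrite mulf_neq0.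
Qed.

End HomogeneousFractions.

(** * Normal forms modulo Z^c - F and maps out of B *)

Section NormalForm.
Import Pdiv.Ring Pdiv.RingMonic.
Variables (A : idomainType) (F : A) (c : nat) (B : comNzRingType).
Variables (iota : {rmorphism A -> B}) (z : B).
Hypotheses (c0 : (0 < c)%N) (hp : presents iota z c F).
Implicit Types (p q r : {poly A}) (a : A) (b : B).

Let M : {poly A} := 'X^c - F%:P.

Let sizeM : size M = c.+1.
Proof.
rewrite size_polyDl ?size_polyXn // size_polyN.
by apply: leq_ltn_trans (size_polyC_leq1 _) _.
Qed.

Let monicM : M \is monic.
Proof. by rewrite monicE lead_coefE sizeM coefB coefXn eqxx coefC eqn0Ngt c0 subr0. Qed.

Definition pev p : B := (map_poly iota p).[z].

Lemma pevE p : peval iota z p = pev p.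
Proof. by rewrite /pev /map_poly horner_poly. Qed.

Lemma pevB p q : pev (p - q) = pev p - pev q.
Proof. by rewrite /pev rmorphB hornerD hornerN. Qed.

Lemma pevM p q : pev (p * q) = pev p * pev q.
Proof. by rewrite /pev rmorphM hornerM. Qed.

Lemma pevC a : pev a%:P = iota a.
Proof. by rewrite /pev map_polyC hornerC. Qed.

Lemma pevX : pev 'X = z.
Proof. by rewrite /pev map_polyX hornerX. Qed.

Lemma pevXn j : pev 'X^j = z ^+ j.
Proof. by rewrite /pev rmorphXn /= map_polyX hornerXn. Qed.

Lemma pevZ a p : pev (a *: p) = iota a * pev p.
Proof. by rewrite -mul_polyC pevM pevC. Qed.

Lemma pev_surj b : exists p, b = pev p.
Proof. by have [p ->] := hp.1 b; exists p; rewrite pevE. Qed.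

Lemma pev_eq0 p : pev p = 0 <-> exists q, p = q * M.
Proof. by rewrite -pevE; apply: hp.2. Qed.

Lemma z_exp : z ^+ c = iota F.
Proof.
apply/eqP; rewrite -subr_eq0 -pevXn -pevC -pevB; apply/eqP/pev_eq0.
by exists 1; rewrite mul1r.
Qed.

Lemma pev_small_eq0 r : (size r <= c)%N -> pev r = 0 -> r = 0.
Proof.
move=> sr /pev_eq0 [q e]; apply/eqP; apply: contraT => r0.
have q0 : q != 0 by apply: contraNneq r0 => q0; rewrite e q0 mul0r.
have : (size r < size M)%N by rewrite sizeM ltnS.
by rewrite e size_Mmonic // sizeM; have := size_poly_gt0 q; rewrite q0; lia.
Qed.

Lemma nf_ex b : exists r, (size r <= c)%N /\ pev r = b.
Proof.
have [p ->] := pev_surj b; exists (rmodp p M).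
have sr := ltn_rmodp p M; rewrite monic_neq0 // sizeM ltnS in sr; split=> //.
have -> : rmodp p M = p - rdivp p M * M.
  by rewrite {2}(rdivp_eq monicM p) addrAC subrr add0r.
rewrite pevB; have -> : pev (rdivp p M * M) = 0 by apply/pev_eq0; exists (rdivp p M).
by rewrite subr0.
Qed.

Definition nf b : {poly A} := sval (cid (nf_ex b)).

Lemma size_nf b : (size (nf b) <= c)%N.
Proof. by rewrite /nf; case: cid => r []. Qed.

Lemma nfK b : pev (nf b) = b.
Proof. by rewrite /nf; case: cid => r []. Qed.

Lemma nfE r : (size r <= c)%N -> nf (pev r) = r.
Proof.
move=> sr; apply/eqP; rewrite -subr_eq0; apply/eqP/pev_small_eq0.
  by apply: leq_trans (size_polyD _ _) _; rewrite size_polyN geq_max size_nf.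
by rewrite pevB nfK subrr.
Qed.

Lemma nfB b b' : nf (b - b') = nf b - nf b'.
Proof.
rewrite -[b - b'](_ : pev (nf b - nf b') = _) ?nfE ?pevB ?nfK //.
by apply: leq_trans (size_polyD _ _) _; rewrite size_polyN geq_max !size_nf.
Qed.

Lemma nf0 : nf 0 = 0.
Proof. by have := nfB 0 0; rewrite !subrr. Qed.

Lemma nfN b : nf (- b) = - nf b.
Proof. by rewrite -sub0r nfB nf0 sub0r. Qed.

Lemma nfD b b' : nf (b + b') = nf b + nf b'.
Proof. by rewrite -{1}[b']opprK nfB nfN opprK. Qed.

Lemma nf_sum (I : Type) (s : seq I) (h : I -> B) :
  nf (\sum_(i <- s) h i) = \sum_(i <- s) nf (h i).
Proof. by apply: (big_morph nf) => [x y|]; [exact: nfD | exact: nf0]. Qed.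

Lemma nf_iotaM a b : nf (iota a * b) = a *: nf b.
Proof.
rewrite -{1}[b]nfK -pevZ nfE //; exact: leq_trans (size_scale_leq _ _) (size_nf b).
Qed.

Lemma nf_iotaMz a j : (j < c)%N -> nf (iota a * z ^+ j) = a *: 'X^j.
Proof.
move=> jc; rewrite -pevXn -pevZ nfE //.
by apply: leq_trans (size_scale_leq _ _) _; rewrite size_polyXn.
Qed.

Lemma nf_iota a : nf (iota a) = a%:P.
Proof. by have := nf_iotaMz a c0; rewrite expr0 mulr1 alg_polyC. Qed.

Lemma iota_inj : injective iota.
Proof. by move=> a a' /(congr1 nf); rewrite !nf_iota => /polyC_inj. Qed.

Lemma nf_expand b : b = \sum_(0 <= j < c) iota (nf b)`_j * z ^+ j.
Proof.
rewrite -{1}[b]nfK /pev (@horner_coef_wide _ c); last first.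
  exact: leq_trans (size_poly _ _) (size_nf b).
by rewrite big_mkord; apply: eq_bigr => j _; rewrite coef_map.
Qed.

Section Extension.
Variables (K : fieldType) (psi : {rmorphism A -> K}) (zeta : K).
Hypothesis zeta_exp : zeta ^+ c = psi F.

Definition pres_ext b : K := (map_poly psi (nf b)).[zeta].

(** Two representatives differ by a multiple of Z^c - F, which vanishes at zeta. *)
Lemma pres_extE p : pres_ext (pev p) = (map_poly psi p).[zeta].
Proof.
have : pev (p - nf (pev p)) = 0 by rewrite pevB nfK subrr.
move/pev_eq0 => [q e]; apply/eqP; rewrite eq_sym -subr_eq0 /pres_ext.
rewrite -hornerN -hornerD -!rmorphN -rmorphD e rmorphM hornerM.
by rewrite rmorphB rmorphXn /= map_polyX map_polyC !hornerE zeta_exp subrr mulr0.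
Qed.

Lemma pres_ext_zmod : zmod_morphism pres_ext.
Proof. by move=> b b'; rewrite /pres_ext nfB rmorphB hornerD hornerN. Qed.

Lemma pres_ext_monoid : monoid_morphism pres_ext.
Proof.
split; first by rewrite -[1](rmorph1 iota) -pevC pres_extE map_polyC hornerC -[RHS](rmorph1 psi).
move=> b b'; rewrite -[b]nfK -[b']nfK -pevM !pres_extE.
by rewrite rmorphM hornerM.
Qed.

HB.instance Definition _ := GRing.isZmodMorphism.Build B K pres_ext pres_ext_zmod.
HB.instance Definition _ := GRing.isMonoidMorphism.Build B K pres_ext pres_ext_monoid.

Definition pres_ext_rmorphism : {rmorphism B -> K} := pres_ext.

Lemma pres_ext_iota a : pres_ext (iota a) = psi a.
Proof. by rewrite -pevC pres_extE map_polyC hornerC. Qed.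

Lemma pres_ext_z : pres_ext z = zeta.
Proof. by rewrite -pevX pres_extE map_polyX hornerX. Qed.

End Extension.

End NormalForm.

Section Embedding.
Variables (A : idomainType) (F : A) (c : nat) (B : comNzRingType).
Variables (iota : {rmorphism A -> B}) (z : B).
Hypotheses (c0 : (0 < c)%N) (F0 : F != 0) (hp : presents iota z c F).
Variables (Ad : int -> A -> Prop) (hA : Zgrading Ad) (d : int).
Hypotheses (AF : Ad d F) (cd : coprime c `|d|%N).
Variables (K : fieldType) (f : {rmorphism A -> K}) (ff : is_frac_field f).
Implicit Types (a : A) (b : B) (n : int).
Local Notation nf := (nf c0 hp).

(* frac B as an extension of A that multiplies the degree by c:
   an element a z^j with a of degree n goes to degree c n + d j. *)
Lemma exists_graded_embedding :
  (c = 1%N \/ exists n w1 w2, Ad (n + 1) w1 /\ Ad n w2 /\ w1 != 0 /\ w2 != 0) ->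
  exists fB : {rmorphism B -> K}, is_frac_field fB /\
    (forall n a j, Ad n a -> fhom Ad f (c%:Z * n + d * j%:Z) (fB (iota a * z ^+ j))) /\
    (forall n a, Ad n a -> a != 0 -> exists n1 a1 j1 n2 a2 j2,
       Ad n1 a1 /\ Ad n2 a2 /\ a1 != 0 /\ a2 != 0 /\
       f a * fB (iota a2 * z ^+ j2) = fB (iota a1 * z ^+ j1)).
Proof.
have fE := frac_eq0 ff; move=> gap.
have [u [zeta [u0 [zeta0 [hu [hz [ez Lu]]]]]]] := exists_twist_root hA ff F0 AF cd gap.
pose psi := twist_rmorphism hA f u0.
have psi_hom n a : Ad n a -> psi a = f a * u ^ n by apply: twist_hom.
have ez' : zeta ^+ c = psi F by rewrite ez (psi_hom d).
pose fB := pres_ext_rmorphism c0 hp ez'.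
have fBi a : fB (iota a) = psi a by apply: pres_ext_iota.
have fBz : fB z = zeta by apply: pres_ext_z.
have fB_hom n a j : Ad n a -> fB (iota a * z ^+ j) = f a * u ^ n * zeta ^+ j.
  by move=> Aa; rewrite rmorphM rmorphXn fBi fBz (psi_hom n).
have hfB n a j : Ad n a -> fhom Ad f (c%:Z * n + d * j%:Z) (fB (iota a * z ^+ j)).
  move=> Aa; rewrite (fB_hom n) //.
  (* The summand (c - 1) n is the degree of u^n. *)
  have -> : c%:Z * n = n + (c%:Z - 1) * n by ring.
  apply: (fhomM hA); last exact: (fhomX hA).
  by apply: (fhomM hA); [exact: (fhom_f hA) | exact: (fhomXz hA)].
(* Expand b into terms a z^j with a homogeneous and j < c. Their images are homogeneous of pairwise
   distinct degrees, so all vanish by [fhom_indep]. *)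
have fB_inj b : fB b = 0 -> b = 0.
  move=> e; pose r := nf b.
  have [S [uS hS]] : exists S : seq int, uniq S /\
      forall j n, (j < c)%N -> n \notin S -> cmp hA n r`_j = 0.
    have [S hS] := choice (fun j => cmp_supp hA r`_j).
    exists (undup (flatten [seq S j | j <- index_iota 0 c])); rewrite undup_uniq; split=> // j n jc.
    rewrite mem_undup => nS; have [_ [_ h]] := hS j; apply: h; apply: contra nS => nS.
    by apply/flattenP; exists (S j) => //; apply: map_f; rewrite mem_index_iota.
  pose k (p : nat * int) := f (cmp hA p.2 r`_p.1) * u ^ p.2 * zeta ^+ p.1.
  pose deg (p : nat * int) := c%:Z * p.2 + d * p.1%:Z.
  pose s := [seq (j, n) | j <- index_iota 0 c, n <- S].
  have us : uniq s.
    by apply: allpairs_uniq => //; [exact: iota_uniq | by move=> [j m] [j' m'] _ _ /= [-> ->]].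
  have sP p : p \in s -> (p.1 < c)%N.
    by move=> /allpairsP [[j n] [/= ]]; rewrite mem_index_iota => jc _ ->.
  have k0 : \sum_(p <- s) k p = 0.
    rewrite -[RHS]e /s big_allpairs [in RHS](nf_expand c0 hp b) rmorph_sum /=.
    rewrite !big_nat; apply: eq_bigr => j /andP[_ jc].
    rewrite rmorphM rmorphXn fBz fBi /psi /= (twistE f u uS) => [|n nS]; last exact: hS.
    by rewrite mulr_suml.
  have dinj : {in s &, injective deg}.
    move=> [j n] [j' n'] /sP /= jc /sP /= jc'; rewrite /deg /= => ed.
    have jj : j = j'.
      have dv : (c %| `|d| * `|j%:Z - j'%:Z|)%N.
        rewrite -abszM; apply/dvdnP; exists `|n' - n|%N.
        rewrite -[X in (_ * X)%N]absz_nat -abszM; congr absz; lia.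
      move: dv; rewrite Gauss_dvdr // => /dvdnP [q eq].
      by case: q eq => [|q] eq; [lia | nia].
    have c0' : c%:Z != 0 by lia.
    by rewrite jj in ed *; congr pair; apply: (mulfI c0'); apply: (addIr (d * j'%:Z)).
  have hk p : p \in s -> fhom Ad f (deg p) (k p).
    move=> _; rewrite /k -fB_hom; first exact: hfB (cmp_gr _ _ _).
    exact: cmp_gr.
  have k_0 := fhom_indep hA ff us dinj hk k0.
  have r0 : r = 0.
    apply/polyP => j; rewrite coef0; case: (ltnP j c) => jc; last first.
      by rewrite nth_default //; apply: leq_trans (size_nf c0 hp b) jc.
    apply: (@cmp_inj _ _ hA) => n; case: (boolP (n \in S)) => nS; last exact: hS.
    have /k_0 /eqP : (j, n) \in s by apply: allpairs_f => //; rewrite mem_index_iota.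
    rewrite /k /= !mulf_eq0 fE expf_eq0 (negPf zeta0) andbF orbF.
    by rewrite (negPf (expfz_neq0 n u0)) orbF => /eqP.
  by rewrite -[b](nfK c0 hp) -/r r0 -[0]/(0%:P) pevC rmorph0.
have fB_neq0 n a j : Ad n a -> a != 0 -> fB (iota a * z ^+ j) != 0.
  by move=> Aa a0; rewrite (fB_hom n) // !mulf_neq0 ?fE ?expfz_neq0 ?expf_neq0.
pose L k := exists n1 a1 j1 n2 a2 j2, Ad n1 a1 /\ Ad n2 a2 /\ a1 != 0 /\ a2 != 0 /\
  k * fB (iota a2 * z ^+ j2) = fB (iota a1 * z ^+ j1).
have fB_mul a a' j j' : fB (iota (a * a') * z ^+ (j + j')%N) =
    fB (iota a * z ^+ j) * fB (iota a' * z ^+ j').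
  by rewrite exprD (rmorphM iota) mulrACA -(rmorphM fB).
have A1 := gr1 hA; have n1 := oner_neq0 A.
have LM k l : L k -> L l -> L (k * l).
  move=> [n1' [a1 [j1 [n2 [a2 [j2 [h1 [h2 [a10 [a20 e]]]]]]]]]].
  move=> [n1'' [a1' [j1' [n2' [a2' [j2' [h1' [h2' [a10' [a20' e']]]]]]]]]].
  exists (n1' + n1''), (a1 * a1'), (j1 + j1')%N, (n2 + n2'), (a2 * a2'), (j2 + j2')%N.
  rewrite !mulf_neq0 //; split; first exact: grM.
  split; first exact: grM.
  do 2!split=> //; by rewrite !fB_mul -e -e'; ring.
have LV k : k != 0 -> L k -> L k^-1.
  move=> k0 [m1 [a1 [j1 [m2 [a2 [j2 [h1 [h2 [a10 [a20 e]]]]]]]]]].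
  exists m2, a2, j2, m1, a1, j1; do 4!split=> //.
  by rewrite -e mulKf.
have Lf n a : Ad n a -> a != 0 -> L (f a * u ^ n).
  move=> Aa a0; exists n, a, 0%N, 0, 1, 0%N; do 4!split=> //.
  by rewrite (fB_hom 0) // (fB_hom n) // rmorph1 !expr0 !mulr1.
have L1 : L 1 by exists 0, 1, 0%N, 0, 1, 0%N; do 4!split=> //; rewrite mul1r.
have Lz : L zeta.
  exists 0, 1, 1%N, 0, 1, 0%N; do 4!split=> //.
  by rewrite !(fB_hom 0) // rmorph1 !expr0 !mulr1 !mul1r expr1.
(* Once u is in L, f a = (f a u^n) u^(-n) is a fraction of elements of the image; hence the image
   generates K. *)
have Lhom n a : Ad n a -> a != 0 -> L (f a).
  move=> Aa a0; have Lu' := Lu L L1 LM LV Lz Lf.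
  have LX l (i : nat) : L l -> L (l ^+ i).
    by move=> Ll; elim: i => [|i IH]; rewrite ?expr0 // exprS; apply: LM.
  have LXz (e : int) : L (u ^ e).
    case: e => i; first exact: LX.
    by rewrite NegzE -exprnN; apply: LV; [apply: expf_neq0 | apply: LX].
  have -> : f a = (f a * u ^ n) * u ^ (- n) by rewrite -mulrA -expfzDr // subrr mulr1.
  by apply: LM; [apply: Lf | apply: LXz].
exists fB; split=> //; split.
  move=> b b' e; apply/eqP; rewrite -subr_eq0; apply/eqP/fB_inj.
  by rewrite rmorphB e subrr.
have fr a : exists b1 b2, fB b2 != 0 /\ f a = fB b1 / fB b2.
  have [s [us [ea _]]] := cmp_supp hA a; rewrite ea rmorph_sum.
  elim: s {us ea} => [|n s [b1 [b2 [b20 e]]]].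
    by exists 0, 1; rewrite rmorph1 oner_neq0 big_nil rmorph0 mul0r.
  rewrite big_cons e; have [->|a0] := eqVneq (cmp hA n a) 0.
    by exists b1, b2; rewrite rmorph0 add0r.
  have [m1 [a1 [j1 [m2 [a2 [j2 [h1 [h2 [a10 [a20 ek]]]]]]]]]] := Lhom _ _ (cmp_gr hA n a) a0.
  set x2 := iota a2 * _ in ek; set x1 := iota a1 * _ in ek.
  have x20 : fB x2 != 0 by apply: (fB_neq0 m2).
  clearbody x1 x2.
  exists (x1 * b2 + b1 * x2), (x2 * b2); rewrite !rmorphD !rmorphM mulf_neq0 //; split=> //.
  by rewrite -ek; field; rewrite x20 b20.
move=> k; have [a [a' [a'0 ->]]] := ff.2 k.
have [b1 [b2 [b20 e]]] := fr a; have [b1' [b2' [b20' e']]] := fr a'.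
have b10' : fB b1' != 0 by apply: contraNneq a'0 => h; rewrite e' h mul0r.
exists (b1 * b2'), (b2 * b1'); rewrite !rmorphM mulf_neq0 //; split=> //.
by rewrite e e'; field; rewrite b20 b20' b10'.
Qed.

End Embedding.

(** The grading returned may differ from the given one, because its degrees may have been divided to
    create a gap of 1. *)
Lemma presentation_embedding (A : idomainType) (F : A) (c : nat) (B : comPzRingType)
  (iota : {rmorphism A -> B}) (z : B) :
  F != 0 -> (0 < c)%N -> presents iota z c F ->
  (exists Ad : int -> A -> Prop, Zgrading Ad /\
     exists d : int, Ad d F /\ coprime c `|d|%N) ->
  exists (Ad : int -> A -> Prop) (d : int) (fB : {rmorphism B -> {fraction A}}),
    Zgrading Ad /\ Ad d F /\ coprime c `|d|%N /\ is_frac_field fB /\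
    let f := @FracField.tofrac A : {rmorphism A -> {fraction A}} in
    (forall n a j, Ad n a -> fhom Ad f (c%:Z * n + d * j%:Z) (fB (iota a * z ^+ j))) /\
    (forall n a, Ad n a -> a != 0 -> exists n1 a1 j1 n2 a2 j2,
       Ad n1 a1 /\ Ad n2 a2 /\ a1 != 0 /\ a2 != 0 /\
       f a * fB (iota a2 * z ^+ j2) = fB (iota a1 * z ^+ j1)).
Proof.
move=> F0 c0 hp [Ad [hA [d [AF cd]]]].
(* Otherwise 1 would be a multiple of Z^c - F, which has positive degree. *)
have B1 : 1 != 0 :> B.
  apply/eqP => e; have e1 : peval iota z 1 = 1.
    by rewrite /peval size_poly1 big_ord1 coef1 expr0 mulr1 rmorph1.
  have [q eq] : exists q, 1 = q * ('X^c - F%:P) by apply/hp.2; rewrite e1.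
  have q0 : q != 0 by apply/eqP => q0; move/eqP: eq; rewrite q0 mul0r oner_eq0.
  have sM : size ('X^c - F%:P) = c.+1.
    by rewrite size_polyDl ?size_polyXn // size_polyN; apply: leq_ltn_trans (size_polyC_leq1 _) _.
  have M0 : 'X^c - F%:P != 0 by rewrite -size_poly_eq0 sM.
  have := size_poly1 A; rewrite eq size_mul // sM.
  have : (0 < size q)%N by rewrite size_poly_gt0.
  case: (size q) => // n _; rewrite addSn /= addnS => -[/eqP].
  by rewrite addn_eq0 => /andP[_ /eqP c_0]; rewrite c_0 in c0.
have [B' eB] := nonzero_nzring B1; subst B.
have [Ad' [hA' [[d' [AF' cd']] gap]]] := exists_unit_gap hA F0 AF cd.
have [fB h] := exists_graded_embedding c0 F0 hp hA' AF' cd' (tofrac_is_frac A) gap.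
by exists Ad', d', fB; do 3!split=> //; case: h.
Qed.

(** * The grading of B *)

Section GradedPresentation.
Variables (A B : idomainType) (F : A) (c : nat) (iota : {rmorphism A -> B}) (z : B).
Hypotheses (c0 : (0 < c)%N) (F0 : F != 0) (hp : presents iota z c F).
Variables (Ad : int -> A -> Prop) (hA : Zgrading Ad) (d : int).
Hypotheses (AF : Ad d F) (cd : coprime c `|d|%N).
Implicit Types (a x y : A) (b : B) (n m : int) (j k : nat).
Local Notation nf := (nf c0 hp).
Local Notation cmp := (cmp hA).

Lemma iota_eq0 a : (iota a == 0) = (a == 0).
Proof.
by apply/eqP/eqP => [e|->]; [apply: (iota_inj c0 hp); rewrite e rmorph0 | rewrite rmorph0].
Qed.

Lemma z_neq0 : z != 0.
Proof.
have : iota F != 0 by rewrite iota_eq0.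
by rewrite -(z_exp hp) expf_eq0 c0.
Qed.

Lemma iotaMz_eq0 a j : (iota a * z ^+ j == 0) = (a == 0).
Proof. by rewrite mulf_eq0 iota_eq0 expf_eq0 (negPf z_neq0) andbF orbF. Qed.

Lemma z_exp_mod a j : iota a * z ^+ j = iota (a * F ^+ (j %/ c)) * z ^+ (j %% c).
Proof.
by rewrite {1}(divn_eq j c) exprD mulnC exprM (z_exp hp) -rmorphXn mulrA -rmorphM.
Qed.

Lemma nf_inj b b' : nf b = nf b' -> b = b'.
Proof. by move=> e; rewrite -(nfK c0 hp b) e nfK. Qed.

Lemma coef_nf_iotaMz a j k : (j < c)%N -> (nf (iota a * z ^+ j))`_k = if k == j then a else 0.
Proof.
move=> jc; rewrite nf_iotaMz // coefZ coefXn; case: eqP => _; by rewrite ?mulr1 ?mulr0.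
Qed.

(** B is free over A on the z^j with j < c, so coefficients of z^j can be compared. *)
Lemma divides_iotaMz y x j : (j < c)%N -> divides (iota y) (iota x * z ^+ j) -> divides y x.
Proof.
move=> jc [q /(congr1 (fun b => (nf b)`_j))]; rewrite coef_nf_iotaMz // eqxx => ->.
by exists (nf q)`_j; rewrite mulrC nf_iotaM coefZ mulrC.
Qed.

Lemma divides_iota y x : divides (iota y) (iota x) <-> divides y x.
Proof.
split=> [h|[q ->]]; last by exists (iota q); rewrite rmorphM.
by apply: (@divides_iotaMz _ _ 0%N) => //; rewrite expr0 mulr1.
Qed.

(** Valuations are restricted along iota; the divisibility condition survives because divisibility
    in B between elements of A already holds in A. *)
Lemma Krull_descent : Krull B -> Krull A.
Proof.
move=> [I [v [hv [fin int]]]]; exists I, (fun i a => v i (iota a)).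
split; last split.
- move=> i; split=> x y x0 y0; first by rewrite rmorphM valM ?iota_eq0.
  by move=> s0; rewrite rmorphD; apply: (hv i).2; rewrite -?rmorphD iota_eq0.
- by move=> x; rewrite -iota_eq0 => /fin.
- by move=> x y x0 y0 le; apply/divides_iota/int; rewrite ?iota_eq0.
Qed.

(** c divides d (j - k), hence j - k, which is smaller than c in absolute value. *)
Lemma degree_inj j k n m : (j < c)%N -> (k < c)%N ->
  c%:Z * n + d * j%:Z = c%:Z * m + d * k%:Z -> j = k /\ n = m.
Proof.
move=> jc kc e; have jk : j = k.
  have dv : (c %| `|d| * `|j%:Z - k%:Z|)%N.
    rewrite -abszM; apply/dvdnP; exists `|m - n|%N.
    rewrite -[X in (_ * X)%N]absz_nat -abszM; congr absz; lia.
  move: dv; rewrite Gauss_dvdr // => /dvdnP [q eq].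
  by case: q eq => [|q] eq; [lia | nia].
split=> //; have c0' : c%:Z != 0 by lia.
by move: e; rewrite jk => /addIr /(mulfI c0').
Qed.

(* z has degree d and the elements of A have their degree multiplied by c *)
Definition Bd n b : Prop :=
  forall j m, cmp m (nf b)`_j != 0 -> c%:Z * m + d * j%:Z = n.

Lemma Bd_iotaMz n a j : Ad n a -> Bd (c%:Z * n + d * j%:Z) (iota a * z ^+ j).
Proof.
move=> Aa; rewrite z_exp_mod => k m; rewrite coef_nf_iotaMz ?ltn_pmod //.
case: (k =P _) => [->|_]; last by rewrite cmp0 eqxx.
have Am : Ad (n + d * (j %/ c)%:Z) (a * F ^+ (j %/ c)) by apply: grM => //; apply: hom_exp.
rewrite (cmp_hom hA _ Am); case: (m =P _) => [-> _|]; last by rewrite eqxx.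
have -> : j%:Z = (j %/ c)%:Z * c%:Z + (j %% c)%:Z by rewrite {1}(divn_eq j c); lia.
by ring.
Qed.

(** By [degree_inj] the degree determines both j and m, so the normal form has a single nonzero
    homogeneous coefficient. *)
Lemma Bd_form n b : Bd n b -> b != 0 -> exists a j m,
  (j < c)%N /\ a != 0 /\ Ad m a /\ n = c%:Z * m + d * j%:Z /\ b = iota a * z ^+ j.
Proof.
move=> hb b0.
have [j [m hjm]] : exists j m, cmp m (nf b)`_j != 0.
  apply: contrapT => no; case/eqP: b0; apply: nf_inj; rewrite nf0.
  apply/polyP => j; rewrite coef0; apply: (@cmp_inj _ _ hA) => m.
  by apply/eqP/negP => /negP h; apply: no; exists j, m.
have jc : (j < c)%N.
  rewrite ltnNge; apply: contra hjm => cj.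
  by rewrite nth_default ?cmp0 //; apply: leq_trans (size_nf c0 hp b) cj.
have en := hb j m hjm.
exists (cmp m (nf b)`_j), j, m; do 2!split=> //; split; first exact: cmp_gr.
split=> //; apply: nf_inj; rewrite nf_iotaMz //; apply/polyP => k.
rewrite coefZ coefXn; apply/eqP; rewrite -subr_eq0; apply/eqP/(@cmp_inj _ _ hA) => l.
rewrite cmpB; case: (ltnP k c) => kc; last first.
  rewrite nth_default ?cmp0; last exact: leq_trans (size_nf c0 hp b) kc.
  by rewrite (_ : (k == j) = false) ?mulr0 ?cmp0 ?subr0 //; apply/eqP; lia.
have [h0|h] := eqVneq (cmp l (nf b)`_k) 0.
  rewrite h0; case: (k =P j) h0 => [-> h0|_ _]; last by rewrite mulr0 cmp0 subr0.
  rewrite mulr1 (cmp_hom hA _ (cmp_gr hA m _)); case: (l =P m) => [e|_]; last by rewrite subr0.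
  by rewrite -e h0 subr0.
have [-> ->] := degree_inj kc jc (etrans (hb _ _ h) (esym en)).
by rewrite eqxx mulr1 (cmp_hom_id hA (cmp_gr hA m _)) subrr.
Qed.

Let decomp_of_sum (I : eqType) (s : seq I) (deg : I -> int) (h : I -> B) :
  (forall n, Bd n 0) -> (forall n b b', Bd n b -> Bd n b' -> Bd n (b + b')) ->
  (forall i, Bd (deg i) (h i)) -> exists (t : seq int) (g : int -> B),
    (forall n, Bd n (g n)) /\ \sum_(i <- s) h i = \sum_(n <- t) g n.
Proof.
move=> h0 hD hh; exists (undup (map deg s)), (fun n => \sum_(i <- s | deg i == n) h i).
split=> [n|]; first by apply: big_ind => // [|i /eqP <-]; [exact: hD|].
rewrite (exchange_big_dep predT) //= [LHS]big_seq [RHS]big_seq; apply: eq_bigr => i si.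
rewrite (eq_bigl (pred1 (deg i))) => [|n]; last by rewrite /= eq_sym.
rewrite -big_filter filter_pred1_uniq ?undup_uniq ?big_seq1 //.
by rewrite mem_undup map_f.
Qed.


Lemma Bd_grading : Zgrading Bd.
Proof.
have Bd0 n : Bd n 0 by move=> j m; rewrite nf0 coef0 cmp0 eqxx.
have BdB n b b' : Bd n b -> Bd n b' -> Bd n (b - b').
  move=> hb hb' j m; rewrite nfB coefB cmpB => h.
  have [h0|h1] := eqVneq (cmp m (nf b)`_j) 0; last exact: hb.
  by apply: hb'; apply: contraNneq h => h1; rewrite h0 h1 subrr.
have BdD n b b' : Bd n b -> Bd n b' -> Bd n (b + b').
  by move=> hb hb'; rewrite -[b']opprK; apply: (BdB) => //; rewrite -sub0r; apply: (BdB).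
split; first by split; [exact: Bd0 | exact: BdB].
split; last split.
- move=> n m b b' hb hb'; have [->|b0] := eqVneq b 0; first by rewrite mul0r.
  have [->|b'0] := eqVneq b' 0; first by rewrite mulr0.
  have [a [j [n' [jc [a0 [Aa [-> ->]]]]]]] := Bd_form hb b0.
  have [a' [j' [m' [jc' [a'0 [Aa' [-> ->]]]]]]] := Bd_form hb' b'0.
  rewrite mulrACA -rmorphM -exprD.
  have -> : c%:Z * n' + d * j%:Z + (c%:Z * m' + d * j'%:Z) =
      c%:Z * (n' + m') + d * (j + j')%N%:Z by rewrite PoszD; ring.
  by apply: Bd_iotaMz; apply: grM.
- move=> b.
  have [S hS] := choice (fun j : nat => cmp_supp hA (nf b)`_j).
  pose I := [seq (j, m) | j <- index_iota 0 c, m <- S j].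
  have -> : b = \sum_(p <- I) iota (cmp p.2 (nf b)`_p.1) * z ^+ p.1.
    rewrite big_allpairs_dep {1}(nf_expand c0 hp b); apply: eq_bigr => j _ /=.
    by have [_ [e _]] := hS j; rewrite {1}e rmorph_sum mulr_suml.
  have [t [g [hg e]]] := @decomp_of_sum _ I (fun p => c%:Z * p.2 + d * p.1%:Z)
     (fun p => iota (cmp p.2 (nf b)`_p.1) * z ^+ p.1) Bd0 BdD
     (fun p => @Bd_iotaMz _ _ _ (cmp_gr hA _ _)).
  by exists t, g.
move=> s us h Bh e n ns.
have [//|hn] := eqVneq (h n) 0.
have [a [j [m [jc [a0 [Aa [en eh]]]]]]] := Bd_form (Bh n) hn.
have := congr1 (fun b => cmp m (nf b)`_j) e; rewrite nf0 coef0 cmp0 nf_sum coef_sum cmp_sum.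
rewrite (bigD1_seq n) //= big1 ?addr0 => [|k kn].
  by rewrite eh coef_nf_iotaMz // eqxx (cmp_hom_id hA Aa) => ->; rewrite rmorph0 mul0r.
apply/eqP; apply: contraT => hk; have := Bh k _ _ hk.
by rewrite -en => e'; rewrite e' eqxx in kn.
Qed.

Local Notation homB := (hom Bd).

Lemma homB_iotaMz a j : hom Ad a -> homB (iota a * z ^+ j).
Proof. by move=> [n Aa]; exists (c%:Z * n + d * j%:Z); apply: Bd_iotaMz. Qed.

Lemma homB_form b : homB b -> b != 0 ->
  exists a j, (j < c)%N /\ a != 0 /\ hom Ad a /\ b = iota a * z ^+ j.
Proof.
move=> [n hb] b0; have [a [j [m [jc [a0 [Aa [_ ->]]]]]]] := Bd_form hb b0.
by exists a, j; do 2!split=> //; split=> //; exists m.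
Qed.

(** If iota a = q z, reducing q Z modulo Z^c - F turns its top coefficient q_(c-1) into the constant
    term F q_(c-1), which must equal a. *)
Lemma divides_z_iota a : divides z (iota a) <-> divides F a.
Proof.
split=> [[q e]|[q ->]]; last first.
  rewrite rmorphM -(z_exp hp); apply: divides_mull.
  by case: c c0 => // c' _; rewrite exprSr; apply/divides_mull/divides_refl.
pose M : {poly A} := 'X^c - F%:P.
have sz : (size (nf q * 'X - (nf q)`_c.-1 *: M)%R <= c)%N.
  apply/leq_sizeP => j cj; rewrite coefB coefMX coefZ coefB coefXn coefC.
  rewrite (_ : (j == 0)%N = false); last by apply/eqP; lia.
  rewrite subr0; case: (j =P c) => [->|jc]; first by rewrite mulr1 subrr.
  rewrite mulr0 subr0 nth_default //; apply: leq_trans (size_nf c0 hp q) _; lia.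
have := nfE c0 hp sz; rewrite pevB pevM pevX nfK -e pevZ.
have -> : pev iota z M = 0 by apply/(pev_eq0 hp); exists 1; rewrite mul1r.
rewrite mulr0 subr0 nf_iota => /(congr1 (fun p : {poly A} => p`_0)).
rewrite coefC eqxx coefB coefMX eqxx coefZ coefB coefXn coefC eqxx.
rewrite (_ : (0 == c)%N = false); last by apply/eqP; lia.
by rewrite !sub0r mulrN opprK => ->; exists ((nf q)`_c.-1).
Qed.

(** Every element of B is congruent modulo z to some iota a, and z divides iota a exactly when F
    divides a, so B/zB is A/FA. *)
Lemma prime_z : prime_elt F -> prime_elt z.
Proof.
move=> [_ [nu pF]]; split; first exact: z_neq0.
split=> [[q e]|b b'].
  apply: nu; have [q' e'] : divides F 1.
    by apply/divides_z_iota; rewrite rmorph1; exists q; rewrite mulrC.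
  by exists q'; rewrite mulrC.
have split0 e : exists a t, e = iota a + z * t.
  exists (nf e)`_0, (\sum_(1 <= j < c) iota (nf e)`_j * z ^+ j.-1).
  rewrite {1}(nf_expand c0 hp e) big_ltn // expr0 mulr1; congr (_ + _).
  rewrite mulr_sumr !big_nat; apply: eq_bigr => j /andP[j0 _].
  by rewrite mulrCA -exprS prednK.
have [a [t ->]] := split0 b; have [a' [t' ->]] := split0 b'.
have zz e : divides z (z * e) by apply/divides_mulr/divides_refl.
move=> [q eq]; have : divides z (iota (a * a')).
  exists (q - t * (iota a' + z * t') - iota a * t').
  by rewrite !mulrBl -eq rmorphM; ring.
move/divides_z_iota/pF => [] /divides_z_iota h; [left | right]; exact: divides_add.
Qed.

End GradedPresentation.

(** * Extending valuations from A to B *)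

Section PrimeElements.
Variables (R : idomainType) (kR : Krull R) (p : R) (pp : prime_elt p).
Implicit Types (P : R -> Prop).

Lemma prime_elt_ideal : prime_ideal (divides p).
Proof.
have [_ [nu pM]] := pp; split; first split; first exact: divides0.
  by split=> [x y|r x]; [exact: divides_add | exact: divides_mull].
by split=> // -[q e]; apply: nu; exists q; rewrite mulrC -e.
Qed.

Lemma height_one_prime_elt P : height_one P -> P p -> P = divides p.
Proof.
move=> [hP [_ minP]] Pp; apply/funext => x; apply/propext; split; last first.
  by move=> h; apply: ideal_divides h Pp.
apply: minP; first exact: prime_elt_ideal.
  by exists p; split; [case: pp | exact: divides_refl].
by move=> y h; apply: ideal_divides h Pp.
Qed.

(** P is (p), so p divides a uniformizer of P and cannot have order above 1. *)
Lemma hord_prime_elt P : height_one P -> P p -> hord P p = 1%N.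
Proof.
move=> hP Pp; have [p0 _] := pp; have hv := is_val_hord kR P.
have [q hq] := krull_unif kR hP; have [_ [Pq [q0 _]]] := hq.
have : (0 < hord P p)%N by apply/(hord_gt0 kR).
have q1 : hord P q = 1%N by rewrite hordE // (ord_unif hq).
have : divides p q by rewrite -(height_one_prime_elt hP Pp).
by move/(val_divides hv q0); lia.
Qed.

Lemma hord_prime_elt_le1 P : (hord P p <= 1)%N.
Proof.
case: (pselect (height_one P)) => hP; last by rewrite hord_out.
case: (pselect (P p)) => Pp; first by rewrite hord_prime_elt.
have [p0 _] := pp; case: (posnP (hord P p)) => [->//|].
by move/(hord_gt0 kR hP p0).
Qed.

End PrimeElements.

Section KrullAscent.
Variables (A B : idomainType) (F : A) (c : nat) (iota : {rmorphism A -> B}) (z : B).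
Hypotheses (c0 : (0 < c)%N) (F0 : F != 0) (hp : presents iota z c F).
Variables (Ad : int -> A -> Prop) (hA : Zgrading Ad) (d : int).
Hypotheses (AF : Ad d F) (cd : coprime c `|d|%N).
Hypotheses (kA : Krull A) (pF : prime_elt F).
Variables (K : fieldType) (f : {rmorphism A -> K}) (ff : is_frac_field f).
Variables (fB : {rmorphism B -> K}) (ffB : is_frac_field fB).
Hypothesis fB_hom : forall n a j, Ad n a ->
  fhom Ad f (c%:Z * n + d * j%:Z) (fB (iota a * z ^+ j)).
Hypothesis fB_surj : forall n a, Ad n a -> a != 0 -> exists n1 a1 j1 n2 a2 j2,
  Ad n1 a1 /\ Ad n2 a2 /\ a1 != 0 /\ a2 != 0 /\
  f a * fB (iota a2 * z ^+ j2) = fB (iota a1 * z ^+ j1).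
Implicit Types (P : A -> Prop) (a x y : A) (b : B) (n m : int) (j k : nat).
Local Notation nf := (nf c0 hp).
Local Notation hB := (Bd_grading c0 F0 hp hA AF cd).
Local Notation homB := (hom (Bd c0 hp hA d)).
Let hv := is_val_hord kA.
Let kv := krull_hord kA.
Let iE := iota_eq0 c0 hp.
Let izE := iotaMz_eq0 c0 F0 hp.
Let fBE := frac_eq0 ffB.

(* On homogeneous elements, c times the extension of v_P with v_P(z) = v_P(F) / c:
   the c-th power of a z^j is the element a^c F^j of A. *)
Definition cval P b : nat := hord P (nf (b ^+ c))`_0.

Lemma cvalE P a j : a != 0 -> cval P (iota a * z ^+ j) = (c * hord P a + j * hord P F)%N.
Proof.
move=> a0; rewrite /cval exprMn -exprM mulnC exprM (z_exp hp) -!rmorphXn -rmorphM nf_iota.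
by rewrite coefC eqxx valM ?expf_neq0 // !valX.
Qed.

Lemma cvalM P b b' : homB b -> homB b' -> b != 0 -> b' != 0 ->
  cval P (b * b') = (cval P b + cval P b')%N.
Proof.
move=> hb hb' b0 b'0.
have [a [j [jc [a0 [ha ->]]]]] := homB_form F0 cd hb b0.
have [a' [j' [jc' [a'0 [ha' ->]]]]] := homB_form F0 cd hb' b'0.
rewrite mulrACA -rmorphM -exprD !cvalE ?mulf_neq0 // valM //; lia.
Qed.

Lemma cvalD P n b b' : Bd c0 hp hA d n b -> Bd c0 hp hA d n b' -> b != 0 -> b' != 0 ->
  b + b' != 0 -> (minn (cval P b) (cval P b') <= cval P (b + b')%R)%N.
Proof.
move=> hb hb' b0 b'0.
have [a [j [m [jc [a0 [Aa [e ->]]]]]]] := Bd_form F0 cd hb b0.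
have [a' [j' [m' [jc' [a'0 [Aa' [e' ->]]]]]]] := Bd_form F0 cd hb' b'0.
have [<- _] := degree_inj c0 F0 cd jc jc' (etrans (esym e) e').
rewrite -mulrDl -rmorphD izE => s0; rewrite !cvalE //.
rewrite -addn_minl leq_add2r -minnMr leq_mul2l.
by rewrite (hv P).2 ?orbT.
Qed.

Definition trivial_on_hom P : Prop := forall a, hom Ad a -> a != 0 -> hord P a = 0%N.

(** In the first case [absz] is harmless, since [vext_ge0] shows nonnegativity on B. In the second
    the values are scaled by c to stay integral; a Krull family may contain such unnormalized
    valuations. *)
Definition ascend P : B -> nat :=
  if pselect (trivial_on_hom P) then fun b => absz (vext f (hord P) (fB b))
  else gauss hB (cval P).


Let fhom0 P n (k : K) : trivial_on_hom P -> fhom Ad f n k -> k != 0 -> vext f (hord P) k = 0.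
Proof.
move=> tP [m [a [a' [Aa [Aa' [a'0 ->]]]]]] k0.
have a0 : a != 0 by apply: contraNneq k0 => ->; rewrite rmorph0 mul0r.
have ta : hord P a = 0%N by apply: tP => //; exists (n + m).
have ta' : hord P a' = 0%N by apply: tP => //; exists m.
by rewrite (vextE ff) // ta ta' subr0.
Qed.

Let ascend_triv P : trivial_on_hom P -> ascend P = fun b => absz (vext f (hord P) (fB b)).
Proof. by rewrite /ascend; case: pselect. Qed.

Let ascend_gauss P : ~ trivial_on_hom P -> ascend P = gauss hB (cval P).
Proof. by rewrite /ascend; case: pselect. Qed.

(** Homogeneous elements of B become homogeneous fractions, on which the valuation is 0; sums of
    them therefore have nonnegative value. *)
Let vext_ge0 P b : trivial_on_hom P -> b != 0 -> 0 <= vext f (hord P) (fB b).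
Proof.
move=> tP; have [s [_ [e _]]] := cmp_supp hB b.
rewrite -fBE; have -> : fB b = \sum_(n <- s) fB (cmp hB n b) by rewrite {1}e rmorph_sum.
elim: s {e} => [|n s IH]; first by rewrite big_nil eqxx.
rewrite big_cons; set k := fB _; set l := \sum_(_ <- _) _ in IH *.
have hk : k != 0 -> vext f (hord P) k = 0.
  move=> k0; have b0 : cmp hB n b != 0 by rewrite -fBE.
  have [a [j [m [jc [a0 [Aa [_ eb]]]]]]] := Bd_form F0 cd (cmp_gr hB n b) b0.
  apply: (fhom0 tP _ k0); rewrite /k eb; exact: fB_hom Aa.
have [->|k0] := eqVneq k 0; first by rewrite add0r.
have [->|l0] := eqVneq l 0; first by rewrite addr0 hk.
move=> s0; apply: le_trans (vextD ff (hv P) k0 l0 s0).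
by rewrite hk // le_min lexx IH.
Qed.

Lemma is_val_ascend P : is_val (ascend P).
Proof.
case: (pselect (trivial_on_hom P)) => tP; last first.
  by rewrite ascend_gauss //; apply: is_val_gauss; [exact: cvalM | exact: cvalD].
rewrite ascend_triv //; split=> b b' b0 b'0.
  rewrite rmorphM (vextM ff) ?fBE //.
  by have := vext_ge0 tP b0; have := vext_ge0 tP b'0; lia.
move=> s0; set u := vext _ _ (fB (b + b')); have u0 : 0 <= u := vext_ge0 tP s0.
have : Num.min (vext f (hord P) (fB b)) (vext f (hord P) (fB b')) <= u.
  by rewrite /u rmorphD; apply: (vextD ff) => //; rewrite -?rmorphD fBE.
by rewrite minEle; have := vext_ge0 tP b0; have := vext_ge0 tP b'0; case: ifP; lia.
Qed.

Lemma ascend_hom P a : hom Ad a -> a != 0 ->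
  (trivial_on_hom P /\ ascend P (iota a) = 0%N) \/
  (~ trivial_on_hom P /\ ascend P (iota a) = (c * hord P a)%N).
Proof.
move=> ha a0; case: (pselect (trivial_on_hom P)) => tP; [left | right]; split=> //.
  have [n Aa] := ha; have h := fB_hom 0%N Aa; rewrite expr0 mulr1 in h.
  by rewrite ascend_triv // (fhom0 tP h) ?fBE ?iE.
rewrite ascend_gauss //; have := homB_iotaMz c0 F0 hp hA AF cd 0%N ha.
rewrite expr0 mulr1 => -[n hn]; rewrite (gauss_hom hB _ hn) ?iE //.
by have := cvalE P 0%N a0; rewrite expr0 mulr1 addn0.
Qed.

(* F is a uniformizer or a unit at each P, so v(z) = v(F) / c < 1 and
   comparing values of a z^k and b z^j for j, k < c amounts to comparing values in A. *)
Let hom_divides h b : homB h -> homB b -> h != 0 -> b != 0 ->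
  (forall P, (cval P h <= cval P b)%N) -> divides h b.
Proof.
move=> hh hb h0 b0.
have [x [k [kc [x0 [hx ->]]]]] := homB_form F0 cd hh h0.
have [y [j [jc [y0 [hy ->]]]]] := homB_form F0 cd hb b0 => le.
have {}le P : (c * hord P x + k * hord P F <= c * hord P y + j * hord P F)%N.
  by rewrite -!cvalE.
have le1 := hord_prime_elt_le1 kA pF.
case: (leqP k j) => kj.
  have [q ->] : divides x y.
    apply: kv.2.2 => // P; have := le P; have := le1 P.
    case: (hord P F) => [|[|//]] _; first by rewrite !muln0 !addn0 leq_pmul2l.
    (* Here v(F) = 1, and the excess j - k is below c, hence too small to make up for a difference
       in v. *)
    rewrite !muln1 => xy; have : (c * hord P x < c * (hord P y).+1)%N by rewrite mulnS; lia.
    by rewrite ltn_pmul2l.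
  by exists (iota q * z ^+ (j - k)); rewrite -{1}(subnK kj) exprD rmorphM; ring.
(* For k > j the quotient borrows one factor F = z^c. Where v(F) = 1, the inequality forces v(x) <
   v(y), which leaves room for F. *)
have [q ->] : divides (x * F) y.
  apply: kv.2.2; rewrite ?mulf_neq0 // => P; rewrite valM //; have := le P; have := le1 P.
  case: (hord P F) => [|[|//]] _; first by rewrite !muln0 !addn0 leq_pmul2l.
  rewrite !muln1 => xy; have : (c * hord P x < c * hord P y)%N by lia.
  by rewrite ltn_pmul2l // addn1.
have e : z ^+ (c + j - k) * z ^+ k = z ^+ c * z ^+ j.
  by rewrite -!exprD; congr (_ ^+ _); lia.
exists (iota q * z ^+ (c + j - k)); rewrite mulrACA e !rmorphM -(z_exp hp); ring.
Qed.

Let surj_A q : exists h b, homB h /\ h != 0 /\ f q * fB h = fB b.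
Proof.
have [s [_ [e _]]] := cmp_supp hA q; rewrite e rmorph_sum {e}.
elim: s => [|n s [h [b [hh [h0 e]]]]].
  by exists 1, 0; rewrite big_nil mul0r rmorph0 oner_neq0; split=> //; apply: hom1 hB.
have [a0|a0] := eqVneq (cmp hA n q) 0.
  by exists h, b; rewrite big_cons a0 rmorph0 add0r.
have [n1 [a1 [j1 [n2 [a2 [j2 [A1 [A2 [a10 [a20 e']]]]]]]]]] := fB_surj (cmp_gr hA n q) a0.
have h2 : homB (iota a2 * z ^+ j2) by apply: homB_iotaMz => //; exists n2.
exists (h * (iota a2 * z ^+ j2)), (iota a1 * z ^+ j1 * h + b * (iota a2 * z ^+ j2)).
split; first exact: (homM hB).
rewrite mulf_neq0 ?izE //; split=> //; rewrite big_cons rmorphD.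
by rewrite (rmorphM fB) (rmorphM fB (iota a1 * _)) (rmorphM fB b) -e -e'; ring.
Qed.

(** For divisibility, the valuations trivial on homogeneous elements first show that y / x becomes a
    member of A after multiplication by a homogeneous s. Back in B this gives g y = b' x with g
    homogeneous, and the Gauss valuations show that g divides each component of b'. *)
Lemma krull_ascend : krull_family ascend.
Proof.
split; first exact: is_val_ascend.
split=> [b b0|x y x0 y0 le].
  have [a1 [a2 [a10 [a20 e]]]] := frac_rep ff (etrans (congr1 negb (fBE b)) b0).
  have [n hn] := cmp_neq0 hB b0.
  have [a [j [jc [a0 [ha eb]]]]] := homB_form F0 cd (hom_cmp hB n b) hn.
  have [l1 hl1] := kv.2.1 _ a10; have [l2 hl2] := kv.2.1 _ a20.
  have [l3 hl3] := kv.2.1 _ a0; have [l4 hl4] := kv.2.1 _ F0.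
  (* Valuations of the first kind are controlled by numerator and denominator of the image of b,
     Gauss valuations by a single component a z^j of b, that is, by a and F. *)
  exists ((l1 ++ l2) ++ (l3 ++ l4)) => P.
  case: (pselect (trivial_on_hom P)) => tP.
    rewrite ascend_triv // e (vextE ff) // => ne; apply: In_cat; left; apply: In_cat.
    have [h|h] := eqVneq (hord P a1) 0%N; last by left; apply: hl1.
    by right; apply: hl2; apply: contraNneq ne => h'; rewrite h h'.
  rewrite ascend_gauss // => ne; apply: In_cat; right; apply: In_cat.
  have [h|h] := eqVneq (hord P a) 0%N; last by left; apply: hl3.
  right; apply: hl4; apply: contraNneq ne => h'.
  by have := (gaussP hB (cval P) b0).2 n hn; rewrite eb cvalE // h h' !muln0 leqn0.
have fy0 : fB y != 0 by rewrite fBE.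
have fx0 : fB x != 0 by rewrite fBE.
have q0 : fB y / fB x != 0 by rewrite mulf_neq0 ?invr_eq0.
have [a1 [a2 [a10 [a20 e]]]] := frac_rep ff q0.
have [s [[hs s0] [q eq]]] : exists s, (hom Ad s /\ s != 0) /\ divides a2 (s * a1).
  apply: (clearing kv) => //.
  - by split; [exact: hom1 hA | exact: oner_neq0].
  - by move=> s [].
  - by move=> s t [hs s0] [ht t0]; split; [exact: (homM hA) | exact: mulf_neq0].
  move=> P tP; have {}tP : trivial_on_hom P by move=> a ha a0; apply: tP.
  have := le P; rewrite ascend_triv //.
  have -> : fB y = (f a1 / f a2) * fB x by rewrite -e divfK.
  rewrite (vextM ff) ?(vextE ff) // -?e //.
  have := vext_ge0 tP y0; have -> : fB y = (f a1 / f a2) * fB x by rewrite -e divfK.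
  rewrite (vextM ff) ?(vextE ff) // -?e //.
  have := vext_ge0 tP x0; lia.
have [n Ans] := hs; have [n1 [t1 [j1 [n2 [t2 [j2 [T1 [T2 [t10 [t20 es]]]]]]]]]] := fB_surj Ans s0.
set u2 := iota t2 * _ in es; set u1 := iota t1 * _ in es.
have hu1 : homB u1 by apply: homB_iotaMz => //; exists n1.
have u10 : u1 != 0 by rewrite izE.
clearbody u1 u2; have [h [b [hh [h0 eb]]]] := surj_A q.
(* Here s is the quotient u1 / u2 and q the quotient b / h in the image of B, with u1 and h
   homogeneous; so the multiplier of y is homogeneous. *)
have key : (u1 * h) * y = (b * u2) * x.
  apply: ffB.1; rewrite !rmorphM -es -eb.
  have -> : fB y = (f a1 / f a2) * fB x by rewrite -e divfK.
  have fa2 : f a2 != 0 by rewrite (frac_eq0 ff).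
  have : f s * f a1 = f q * f a2 by rewrite -!rmorphM eq.
  move=> esq; transitivity (f s * f a1 * fB u2 * fB h * fB x / f a2); first by field.
  by rewrite esq; field.
set g := u1 * h in key; set b' := b * u2 in key.
have hg : homB g by apply: (homM hB).
have g0 : g != 0 by apply: mulf_neq0.
have b'0 : b' != 0.
  by apply: contraNneq (mulf_neq0 g0 y0) => b'0; rewrite key b'0 mul0r.
clearbody g b'.
suff [r er] : divides g b'.
  by exists r; apply: (mulfI g0); rewrite key er; ring.
have [S [_ [eS _]]] := cmp_supp hB b'; rewrite eS.
apply: divides_sum => m; have [->|bm] := eqVneq (cmp hB m b') 0; first exact: divides0.
apply: hom_divides => // [|P]; first exact: hom_cmp.
case: (pselect (trivial_on_hom P)) => tP.
  have cv0 w : homB w -> w != 0 -> cval P w = 0%N.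
    move=> hw w0; have [a [j [_ [a0 [ha ->]]]]] := homB_form F0 cd hw w0.
    by rewrite cvalE // tP // tP ?muln0 //; exists d.
  by rewrite !cv0 //; apply: hom_cmp.
(* The Gauss value of b' is v(g) + v(y) - v(x), at least v(g), and bounds the values of all
   components of b' from below. *)
have := congr1 (ascend P) key; rewrite !(valM (is_val_ascend P)) //.
have := le P; rewrite ascend_gauss // => le' e'.
have [l hl] := hg; apply: leq_trans ((gaussP hB (cval P) b'0).2 m bm).
have <- := gauss_hom hB (cval P) hl g0.
by rewrite -(leq_add2r (gauss hB (cval P) y)) e' leq_add2l.
Qed.

Lemma Krull_ascent : Krull B.
Proof. by exists (A -> Prop), ascend; exact: krull_ascend. Qed.

Definition imset (E : A -> Prop) : B -> Prop := fun b => exists a, E a /\ b = iota a.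

(** On homogeneous elements of A an extended valuation is 0 or c times the original one, so
    domination in A passes to B. *)
Lemma vle_imset (E : A -> Prop) a : nonzero_set E -> (forall e, E e -> hom Ad e) ->
  hom Ad a -> vle E a -> vle (imset E) (iota a).
Proof.
move=> nE hE ha Ea; apply: (vle_dom krull_ascend); rewrite iE => a0 P.
have [e [Ee [e0 le]]] := vle_hord kA P nE Ea a0.
exists (iota e); split; first by exists e.
rewrite iE; split=> //.
case: (ascend_hom P (hE e Ee) e0) => -[tP ->] //.
by case: (ascend_hom P ha a0) => -[tP' ->] //; rewrite leq_mul2l le orbT.
Qed.

End KrullAscent.

(** * Comparison of the class groups of A and B *)

Lemma grp_iso_of_bij (G H : zmodType) (h : G -> H) : (forall x y, h (x + y) = h x + h y) ->
  injective h -> (forall y, exists x, h x = y) -> grp_iso G H.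
Proof.
move=> hD hinj /choice [g hg]; exists h; split=> //.
by exists g => // x; apply: hinj; rewrite hg.
Qed.

Lemma veq_sym (R : idomainType) (E E' : R -> Prop) : veq E E' -> veq E' E.
Proof. by case. Qed.

Lemma veq_mulsetK (R : idomainType) (t r s : R) (E E' : R -> Prop) : t != 0 ->
  veq (mulset (t * r) E) (mulset (t * s) E') -> veq (mulset r E) (mulset s E').
Proof.
have mm r' (X : R -> Prop) : mulset (t * r') X = mulset t (mulset r' X).
  apply/funext => x; apply/propext; split.
    by move=> [e [Xe ->]]; exists (r' * e); rewrite mulrA; split=> //; exists e.
  by move=> [_ [[e [Xe ->]] ->]]; exists e; rewrite mulrA.
rewrite !mm => t0 [h1 h2]; split=> x hx; apply: (vle_mulsetK t0).
  by apply: h1; exists x.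
by apply: h2; exists x.
Qed.

Section ClassGroups.
Variables (A B : idomainType) (F : A) (c : nat) (iota : {rmorphism A -> B}) (z : B).
Hypotheses (c0 : (0 < c)%N) (F0 : F != 0) (hp : presents iota z c F).
Variables (Ad : int -> A -> Prop) (hA : Zgrading Ad) (d : int).
Hypotheses (AF : Ad d F) (cd : coprime c `|d|%N).
Hypotheses (kA : Krull A) (kB : Krull B) (pF : prime_elt F).
Local Notation hB := (Bd_grading c0 F0 hp hA AF cd).
Local Notation homB := (hom (Bd c0 hp hA d)).
Local Notation im := (imset iota).
Local Notation hom_set E := (forall e, E e -> hom Ad e).
Hypothesis vle_im : forall (E : A -> Prop) a, nonzero_set E -> hom_set E ->
  hom Ad a -> vle E a -> vle (im E) (iota a).
Implicit Types (E : A -> Prop) (G : B -> Prop) (a b r s : A).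
Let iE := iota_eq0 c0 hp.
Let izE := iotaMz_eq0 c0 F0 hp.

Lemma imset_nonzero E : nonzero_set E -> nonzero_set (im E).
Proof. by move=> [e [Ee e0]]; exists (iota e); rewrite iE; split=> //; exists e. Qed.

Lemma imset_mulset r E : im (mulset r E) = mulset (iota r) (im E).
Proof.
apply/funext => b; apply/propext; split.
  by move=> [_ [[e [Ee ->]] ->]]; exists (iota e); rewrite rmorphM; split=> //; exists e.
by move=> [_ [[e [Ee ->]] ->]]; exists (r * e); rewrite rmorphM; split=> //; exists e.
Qed.

Lemma imset_setprod E E' : im (setprod E E') = setprod (im E) (im E').
Proof.
apply/funext => b; apply/propext; split.
  move=> [_ [[e [e' [Ee [Ee' ->]]]] ->]]; exists (iota e), (iota e').
  by rewrite rmorphM; split; [exists e | split=> //; exists e'].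
move=> [_ [_ [[e [Ee ->]] [[e' [Ee' ->]] ->]]]]; exists (e * e').
by rewrite rmorphM; split=> //; exists e, e'.
Qed.

Lemma veq_imset E E' : nonzero_set E -> nonzero_set E' -> hom_set E -> hom_set E' ->
  veq E E' -> veq (im E) (im E').
Proof.
move=> nE nE' hE hE' [h1 h2].
split=> _ [a [Ea ->]]; apply: vle_im => //; [exact: hE' | exact: h1 | exact: hE | exact: h2].
Qed.

Lemma hom_mulset r E : hom Ad r -> hom_set E -> hom_set (mulset r E).
Proof. by move=> hr hE _ [e [Ee ->]]; apply: (homM hA) => //; apply: hE. Qed.

(** Extension respects closures of homogeneous sets, so the multipliers r and s are first made
    homogeneous by [veq_top]. *)
Lemma vsim_imset E E' : nonzero_set E -> nonzero_set E' -> hom_set E -> hom_set E' ->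
  vsim E E' -> vsim (im E) (im E').
Proof.
move=> nE nE' hE hE' [r0 [s0 [r00 [s00 h0]]]].
have [r [s [hr [hs [rn [sn h]]]]]] := veq_top hA kA nE nE' hE hE' r00 s00 h0.
exists (iota r), (iota s); rewrite !iE; do 2!split=> //.
by rewrite -!imset_mulset; apply: veq_imset => //; first [exact: mulset_nonzero | exact: hom_mulset].
Qed.

(** A test pair x, y from A is tested in B; freeness over A brings the resulting divisibility back
    and discards the factor z^j with j < c. *)
Let veq_descent E E' a b j : (j < c)%N -> b != 0 -> a != 0 ->
  veq (mulset (iota a * z ^+ j) (im E)) (mulset (iota b) (im E')) ->
  veq (mulset a E) (mulset b E').
Proof.
move=> jc b0 a0 [h1 h2]; split=> _ [e [Ee ->]] x y y0 hy.
  apply/(divides_iota c0 hp); rewrite 2!rmorphM; apply: h1.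
  - by exists (iota e); split=> //; exists e.
  - by rewrite iE.
  move=> _ [_ [[e' [Ee' ->]] ->]].
  have /(divides_iota c0 hp) h : divides y (x * (a * e')) by apply: hy; exists e'.
  have -> : iota x * (iota a * z ^+ j * iota e') = iota (x * (a * e')) * z ^+ j.
    by rewrite !rmorphM; ring.
  exact: divides_mulr.
apply: (divides_iotaMz c0 hp jc); have -> : iota (x * (a * e)) * z ^+ j = iota x * (iota a * z ^+ j * iota e).
  by rewrite !rmorphM; ring.
apply: h2.
- by exists (iota e); split=> //; exists e.
- by rewrite iE.
move=> _ [_ [[e' [Ee' ->]] ->]]; rewrite -!rmorphM; apply/(divides_iota c0 hp).
by apply: hy; exists e'.
Qed.

(** Homogeneous multipliers in B have the form a z^j and b z^k with j, k < c. Cancelling the lower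
    power of z leaves an exponent below c, which [veq_descent] absorbs. *)
Lemma vsim_imset_inj E E' : nonzero_set E -> nonzero_set E' -> hom_set E -> hom_set E' ->
  vsim (im E) (im E') -> vsim E E'.
Proof.
move=> nE nE' hE hE' [r0 [s0 [r00 [s00 h0]]]].
have him X : hom_set X -> forall g, im X g -> homB g.
  move=> hX _ [a [Xa ->]]; have := homB_iotaMz c0 F0 hp hA AF cd 0%N (hX a Xa).
  by rewrite expr0 mulr1.
have [r [s [hr [hs [rn [sn h]]]]]] := veq_top hB kB (imset_nonzero nE) (imset_nonzero nE')
  (him _ hE) (him _ hE') r00 s00 h0.
have [a [j [jc [a0 [_ er]]]]] := homB_form F0 cd hr rn.
have [b [k [kc [b0 [_ es]]]]] := homB_form F0 cd hs sn.
rewrite {}er {}es in h; exists a, b; do 2!split=> //.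
have zn i : z ^+ i != 0 by rewrite expf_neq0 // (z_neq0 c0 F0 hp).
case: (leqP k j) => kj.
  apply: (@veq_descent _ _ _ _ (j - k)) => //; first by lia.
  apply: (veq_mulsetK (zn k)); rewrite mulrCA -exprD subnKC // [z ^+ k * _]mulrC.
  exact: h.
apply: veq_sym; apply: (@veq_descent _ _ _ _ (k - j)) => //; first by lia.
apply: (veq_mulsetK (zn j)); rewrite mulrCA -exprD subnKC 1?ltnW // [z ^+ j * _]mulrC.
exact: veq_sym.
Qed.

(* Replacing a z^j by a only changes the value at the prime (z). *)
Lemma vsim_imset_surj G : nonzero_set G -> (forall g, G g -> homB g) ->
  exists E, nonzero_set E /\ hom_set E /\ vsim (im E) G.
Proof.
move=> nG hG; have hv := is_val_hord kB; have pz := prime_z c0 F0 hp cd pF.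
have z0 := z_neq0 c0 F0 hp.
pose E a := hom Ad a /\ exists j, G (iota a * z ^+ j).
have GE g : G g -> g != 0 -> exists a j, E a /\ a != 0 /\ g = iota a * z ^+ j.
  move=> Gg g0; have [a [j [_ [a0 [ha eg]]]]] := homB_form F0 cd (hG g Gg) g0.
  by exists a, j; split=> //; split=> //; exists j; rewrite -eg.
have nE : nonzero_set E.
  by have [g [Gg g0]] := nG; have [a [j [Ea [a0 _]]]] := GE g Gg g0; exists a.
exists E; split=> //; split; first by move=> a [].
have nI := imset_nonzero nE.
pose Z := divides z; pose m := dmin G Z; pose l := dmin (im E) Z.
have zn i : z ^+ i != 0 by apply: expf_neq0.
(* The multipliers are crossed so that both sides have value m + l at the prime (z); at all other
   primes z has value 0. *)
exists (z ^+ m), (z ^+ l); do 2!split=> //.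
apply/(veq_dmin kB); try exact: mulset_nonzero.
move=> P; rewrite !(dmin_mulset kB) // !valX //.
case: (posnP (hord P z)) => [hz|zP].
  rewrite hz !muln0 !add0n; have [[g [Gg [g0 <-]]] hg] := dminP P nG.
  have eqz a j : a != 0 -> hord P (iota a * z ^+ j) = hord P (iota a).
    by move=> a0; rewrite valM ?iE // valX // hz muln0 addn0.
  have [a [j [Ea [a0 eg]]]] := GE g Gg g0; rewrite eg eqz //.
  apply: dmin_eq; first by exists (iota a); rewrite iE; split=> //; exists a.
  move=> _ [a' [[_ [j' Ga']] ->]]; rewrite iE => a'0.
  rewrite -(eqz a j) // -(eqz a' j') // -eg; have := (hg _ Ga'); rewrite izE => /(_ a'0).
  by have := (dminP P nG).2 g Gg g0.
have hP : height_one P by apply: contrapT => /hord_out e; rewrite e in zP.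
have Pz : P z by apply/(hord_gt0 kB).
rewrite (hord_prime_elt kB pz hP Pz) !muln1 (height_one_prime_elt pz hP Pz).
by rewrite addnC.
Qed.

(** A class goes to the class of the image of a chosen homogeneous representative. [vsim_imset]
    makes this independent of the choice, whence additivity, as images commute with products of
    sets. *)
Lemma class_groups_iso (GA GB : zmodType) :
  class_group_iso A GA -> class_group_iso B GB -> grp_iso GA GB.
Proof.
move=> /(class_group_sets kA) [pA [pAM [pA_surj pA_eq]]].
move=> /(class_group_sets kB) [pB [pBM [pB_surj pB_eq]]].
have rep g : exists E, nonzero_set E /\ hom_set E /\ pA E = g.
  have [E [nE <-]] := pA_surj g; have [E' [nE' [hE' h]]] := homogenize hA kA nE.
  by exists E'; do 2!split=> //; apply/esym/pA_eq.
have [E hE] := choice rep.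
have nE g : nonzero_set (E g) by case: (hE g).
have nI g := imset_nonzero (nE g).
apply: (@grp_iso_of_bij _ _ (fun g => pB (im (E g)))) => [g g'|g g' /pB_eq h|y].
- rewrite -pBM // -imset_setprod; apply/pB_eq => //.
    by apply/imset_nonzero/setprod_nonzero.
  apply: vsim_imset => //; [exact: setprod_nonzero | by case: (hE (g + g')) => _ [] | |].
    move=> _ [e [e' [Ee [Ee' ->]]]].
    by apply: (homM hA); [case: (hE g) => _ [h _] | case: (hE g') => _ [h _]]; apply: h.
  apply/pA_eq => //; first exact: setprod_nonzero.
  by rewrite pAM //; have [_ [_ ->]] := hE (g + g'); have [_ [_ ->]] := hE g;
     have [_ [_ ->]] := hE g'.
- have [_ [hg eg]] := hE g; have [_ [hg' eg']] := hE g'.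
  by rewrite -eg -eg'; apply/pA_eq => //; apply: vsim_imset_inj => //; apply: h.
have [G [nG <-]] := pB_surj y; have [G' [nG' [hG' h]]] := homogenize hB kB nG.
have [E' [nE' [hE' h']]] := vsim_imset_surj nG' hG'.
have [_ [hg eg]] := hE (pA E'); exists (pA E').
transitivity (pB G'); last by apply/esym/pB_eq.
transitivity (pB (im E')); last by apply/pB_eq => //; exact: imset_nonzero.
apply/pB_eq => //; first exact: imset_nonzero.
by apply: vsim_imset => //; apply/pA_eq.
Qed.

End ClassGroups.

Lemma Forall_mem (T : eqType) (Q : T -> Prop) (s : seq T) :
  List.Forall Q s <-> forall x, x \in s -> Q x.
Proof.
split; first by elim=> // x l Qx _ IH y; rewrite inE => /orP[/eqP ->|/IH].
elim: s => [|x s IH] h; first by constructor.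
constructor; first by apply: h; rewrite inE eqxx.
by apply: IH => y ys; apply: h; rewrite inE ys orbT.
Qed.

(** * Unique factorization *)

Section Factorial.
Variable R : idomainType.
Implicit Types (x y p q u w : R) (s t : seq R) (P : R -> Prop).
Local Notation primes_seq := (List.Forall (@prime_elt R)).
Local Notation irreds_seq := (List.Forall (@irreducible_elt R)).

(** The explicit unit covers units and nonunits at once and makes the property convenient for
    induction. *)
Definition factorial : Prop := forall x, x != 0 ->
  exists u s, is_unit u /\ primes_seq s /\ x = u * \prod_(y <- s) y.

Lemma is_unitM u w : is_unit u -> is_unit w -> is_unit (u * w).
Proof. by move=> [a ea] [b eb]; exists (a * b); rewrite mulrACA ea eb mulr1. Qed.

Lemma is_unit1 : is_unit (1 : R).
Proof. by exists 1; rewrite mulr1. Qed.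

Lemma is_unit_mull u w : is_unit (u * w) -> is_unit u.
Proof. by move=> [a e]; exists (w * a); rewrite mulrA. Qed.

Lemma is_unit_neq0 u : is_unit u -> u != 0.
Proof. by move=> [a e]; apply/eqP => u0; move/eqP: e; rewrite u0 mul0r eq_sym oner_eq0. Qed.

Lemma divides_unit x u : is_unit u -> divides x u -> is_unit x.
Proof. by move=> hu [q e]; apply: (@is_unit_mull _ q); rewrite mulrC -e. Qed.

Lemma unit_divides u x : is_unit u -> divides u x.
Proof. by move=> [a e]; exists (x * a); rewrite -mulrA [a * u]mulrC e mulr1. Qed.

Lemma prime_irreducible p : prime_elt p -> irreducible_elt p.
Proof.
move=> [p0 [nu pM]]; split=> //; split=> // a b e.
have unit_of x y : p = x * y -> divides p x -> is_unit y.
  move=> exy [q eq]; exists q; apply: (mulfI p0).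
  by rewrite mulr1 [in RHS]exy eq; ring.
have [|h|h] := pM a b; first by exists 1; rewrite mul1r.
  by right; apply: unit_of h.
by left; apply: (unit_of b a) => //; rewrite mulrC.
Qed.

Lemma irreducible_assoc p q : irreducible_elt p -> ~ is_unit q -> divides q p ->
  exists u, is_unit u /\ p = u * q.
Proof. by move=> [_ [_ irr]] nq [r e]; exists r; split=> //; have [] := irr r q e. Qed.

Lemma prime_divides_prod p s : prime_elt p -> divides p (\prod_(y <- s) y) ->
  exists2 q, q \in s & divides p q.
Proof.
move=> pp; elim: s => [|q s IH]; rewrite ?big_nil ?big_cons.
  by case: pp => _ [nu _] [r e]; case: nu; exists r; rewrite mulrC -e.
case: (pp) => _ [_ pM] /pM [h|/IH [r rs h]]; first by exists q; rewrite ?inE ?eqxx.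
by exists r => //; rewrite inE rs orbT.
Qed.

Lemma UFD_factor : is_UFD R -> forall x, x != 0 ->
  exists u s, is_unit u /\ irreds_seq s /\ x = u * \prod_(y <- s) y.
Proof.
move=> [_ [fac _]] x x0; case: (pselect (is_unit x)) => hx.
  by exists x, [::]; rewrite big_nil mulr1; split=> //; split=> //; constructor.
by have [s [hs ->]] := fac x x0 hx; exists 1, s; rewrite mul1r; split=> //; exact: is_unit1.
Qed.

Lemma irreducibleM_unit p u : irreducible_elt p -> is_unit u -> irreducible_elt (p * u).
Proof.
move=> [p0 [nu irr]] [w e]; have u0 : u != 0 by apply: is_unit_neq0; exists w.
split; first exact: mulf_neq0.
split=> [/is_unit_mull //|a b eab].
have [|h|h] := irr a (b * w); first by rewrite mulrA -eab -mulrA e mulr1.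
  by left.
by right; apply: is_unit_mull h.
Qed.

(** Factor x, y and q in x y = q p. The units are absorbed into p, because uniqueness compares bare
    products; then p is associate to a factor of x or of y. *)
Lemma UFD_irreducible_prime p : is_UFD R -> irreducible_elt p -> prime_elt p.
Proof.
move=> hU hirr; have [p0 [nu irr]] := hirr; split=> //; split=> // x y [q e].
have [->|x0] := eqVneq x 0; first by left; apply: divides0.
have [->|y0] := eqVneq y 0; first by right; apply: divides0.
have q0 : q != 0 by apply: contraNneq (mulf_neq0 x0 y0) => q0; rewrite e q0 mul0r.
have [u [s [[u' eu] [hs ex]]]] := UFD_factor hU x0.
have [w [t [[w' ew] [ht ey]]]] := UFD_factor hU y0.
have [v [r [hv [hr eq]]]] := UFD_factor hU q0.
have hv' : is_unit (v * (u' * w')).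
  by apply: is_unitM => //; apply: is_unitM; [exists u; rewrite mulrC | exists w; rewrite mulrC].
have [_ [_ uniq]] := hU.
have [|||_ [us [hus [ss pe]]]] := uniq (s ++ t) ((p * (v * (u' * w'))) :: r).
- by apply/List.Forall_app.
- by constructor=> //; apply: irreducibleM_unit.
- rewrite big_cat big_cons /=.
  transitivity ((u * u') * (w * w') * (\prod_(i <- s) i * \prod_(i <- t) i)).
    by rewrite eu ew !mul1r.
  transitivity (x * y * (u' * w')); first by rewrite ex ey; ring.
  by rewrite e eq; ring.
have : p * (v * (u' * w')) \in [seq a.1 * a.2 | a <- zip us (s ++ t)].
  by rewrite (perm_mem pe) inE eqxx.
move/mapP => [[a b] hab /= epab].
have [k ek] : divides p b.
  have au : a \in us by have := map_f fst hab; rewrite -/(unzip1 _) unzip1_zip ?ss.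
  have [a' ea] := (Forall_mem _ _).1 hus a au.
  exists (v * (u' * w') * a'); rewrite -[b]mul1r -ea; transitivity (a' * (a * b)); first by ring.
  by rewrite -epab; ring.
have : b \in s ++ t by have := map_f snd hab; rewrite -/(unzip2 _) unzip2_zip ?ss.
have pb : divides p b by exists k.
rewrite mem_cat => /orP[bs|bt]; [left; rewrite ex (big_rem b bs) | right; rewrite ey (big_rem b bt)];
  by apply: divides_mull; apply: divides_mulr.
Qed.

Lemma UFD_factorial : is_UFD R -> factorial.
Proof.
move=> hU x x0; have [u [s [hu [hs e]]]] := UFD_factor hU x0; exists u, s; split=> //.
split=> //; apply: List.Forall_impl hs => p; exact: UFD_irreducible_prime.
Qed.

Lemma factorial_irreducible_prime p : factorial -> irreducible_elt p -> prime_elt p.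
Proof.
move=> hF hirr; have [p0 [nu irr]] := hirr.
have [u [[|q s] [hu [hs e]]]] := hF p p0.
  by case: nu; rewrite e big_nil mulr1.
have hq : prime_elt q by apply: ((Forall_mem _ _).1 hs); rewrite inE eqxx.
have [q0 [nuq qM]] := hq.
have [|w [[w' ew] ep]] := irreducible_assoc hirr nuq.
  by rewrite e big_cons; apply/divides_mull/divides_mulr/divides_refl.
split=> //; split=> // x y [r exy].
have [|h|h] := qM x y; first by exists (r * w); rewrite exy ep mulrA.
  by left; have [k ->] := h; exists (k * w'); rewrite ep -mulrA [w' * _]mulrA [w' * w]mulrC ew mul1r.
by right; have [k ->] := h; exists (k * w'); rewrite ep -mulrA [w' * _]mulrA [w' * w]mulrC ew mul1r.
Qed.

(** The unit w is carried along because removing the factor matched with p leaves a unit behind. *)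
Lemma prime_factor_uniq s t w : is_unit w -> primes_seq s -> primes_seq t ->
  \prod_(y <- s) y = w * \prod_(y <- t) y ->
  size s = size t /\ exists u : seq R, List.Forall (@is_unit R) u /\ size u = size s /\
    perm_eq [seq a.1 * a.2 | a <- zip u s] t.
Proof.
elim: s t w => [|p s IH] t w hw hs ht; rewrite ?big_nil ?big_cons => e.
  case: t ht e => [|q t] ht e.
    by split=> //; exists [::]; split; [constructor | split].
  have [_ [nu _]] := (Forall_mem _ _).1 ht q (mem_head _ _).
  case: nu; exists (w * \prod_(y <- t) y); rewrite [RHS]e big_cons; ring.
have hp := (Forall_mem _ _).1 hs p (mem_head _ _).
have {}hs : primes_seq s by apply/Forall_mem => x xs; apply: ((Forall_mem _ _).1 hs); rewrite inE xs orbT.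
have [q qt pq] : exists2 q, q \in t & divides p q.
  apply: prime_divides_prod => //; have [w' ew] := hw.
  exists (w' * \prod_(y <- s) y); transitivity (w' * (w * \prod_(y <- t) y)); last by rewrite -e; ring.
  by rewrite mulrA [w' * w]mulrC ew mul1r.
have hq := (Forall_mem _ _).1 ht q qt.
have [v [hv eq]] := irreducible_assoc (prime_irreducible hq) hp.2.1 pq.
have pt := perm_to_rem qt.
have ht' : primes_seq (rem q t).
  by apply/Forall_mem => x xs; apply: ((Forall_mem _ _).1 ht); apply: mem_rem xs.
have [||ss [u [hu [su pe]]]] := IH (rem q t) (w * v) _ hs ht'.
- exact: is_unitM.
- apply: (mulfI hp.1); rewrite e (perm_big _ pt) /= big_cons eq; ring.
split; first by rewrite (perm_size pt) /= ss.
exists (v :: u); split; first by constructor.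
split; first by rewrite /= su.
by rewrite /= -eq perm_sym (perm_trans pt) // perm_cons perm_sym.
Qed.

Lemma idomain_is_domain : is_domain R.
Proof.
split; first exact: oner_neq0.
by move=> x y /eqP; rewrite mulf_eq0 => /orP[] /eqP ->; [left | right].
Qed.

Lemma factorial_UFD : factorial -> is_UFD R.
Proof.
move=> hF; split; first exact: idomain_is_domain.
have prime_irr s : primes_seq s -> irreds_seq s.
  by apply: List.Forall_impl => p; apply: prime_irreducible.
split=> [x x0 nu|s t hs ht e].
  have [u [[|p s] [hu [hs e]]]] := hF x x0.
    by case: nu; rewrite e big_nil mulr1.
  have := prime_irr _ hs; move/Forall_mem => h.
  exists (p * u :: s); split; last by rewrite e !big_cons; ring.
  apply/Forall_mem => y; rewrite inE => /orP[/eqP ->|ys].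
    by apply: irreducibleM_unit => //; apply: h; rewrite inE eqxx.
  by apply: h; rewrite inE ys orbT.
apply: (@prime_factor_uniq s t 1); rewrite ?mul1r //; first exact: is_unit1.
  by apply: List.Forall_impl hs => p; apply: factorial_irreducible_prime.
by apply: List.Forall_impl ht => p; apply: factorial_irreducible_prime.
Qed.

Lemma factorial_unif p : factorial -> prime_elt p -> unif (divides p) p.
Proof.
move=> hF hp; split; first exact: prime_elt_ideal.
have [p0 [nu pM]] := hp; split; first exact: divides_refl.
split=> // x x0; have [u [s [hu [hs ->]]]] := hF x x0.
have n1 : ~ divides p 1 by move/(divides_unit is_unit1).
suff [n [r [pt e]]] : exists n r, ~ divides p r /\ \prod_(y <- s) y = r * p ^+ n.
  exists n, 1, (u * r); split=> //; split; last by rewrite e; ring.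
  by move/pM => [/(divides_unit hu)|].
elim: s hs => [_|q s IH hs]; first by exists 0%N, 1; rewrite big_nil expr0 mulr1.
have hq := (Forall_mem _ _).1 hs q (mem_head _ _).
have [|n [r [pt e]]] := IH.
  by apply/Forall_mem => x' xs; apply: ((Forall_mem _ _).1 hs); rewrite inE xs orbT.
rewrite big_cons e; case: (pselect (divides p q)) => pq; last first.
  by exists n, (q * r); split; [move/pM => [] | rewrite mulrA].
have [v [hv eq]] := irreducible_assoc (prime_irreducible hq) nu pq.
exists n.+1, (v * r); split; first by move/pM => [/(divides_unit hv)|].
by rewrite eq exprS; ring.
Qed.

Lemma prime_divides_assoc p q : prime_elt p -> prime_elt q -> divides p q ->
  divides q = divides p.
Proof.
move=> hp hq pq; have [v [[v' ev] eq]] := irreducible_assoc (prime_irreducible hq) hp.2.1 pq.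
apply/funext => x; apply/propext; split; first exact: divides_trans.
apply: divides_trans; exists v'; rewrite eq mulrA [v' * v]mulrC ev mul1r; exact: erefl.
Qed.

(** The family consists of the orders at principal primes. Divisibility is by induction on the prime
    factors of y: each has positive order in x, so it divides x and can be cancelled. *)
Lemma factorial_Krull : factorial -> Krull R.
Proof.
move=> hF.
pose v P := if pselect (exists p, prime_elt p /\ P = divides p) then ord P else fun=> 0%N.
have vE p : prime_elt p -> v (divides p) = ord (divides p).
  by move=> hp; rewrite /v; case: pselect => // -[]; exists p.
have v0 P : ~ (exists p, prime_elt p /\ P = divides p) -> v P = fun=> 0%N.
  by rewrite /v; case: pselect.
have v_val P : is_val (v P).
  case: (pselect (exists p, prime_elt p /\ P = divides p)) => [[p [hp ->]]|/v0 ->].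
    by rewrite vE //; apply: is_val_ord (factorial_unif hF hp).
  exact: is_val0.
exists (R -> Prop), v; split=> //; split=> [x x0|y x y0 x0].
  have [u [s [hu [hs e]]]] := hF x x0.
  exists (map (@divides R) s) => P.
  case: (pselect (exists p, prime_elt p /\ P = divides p)) => [[p [hp ->]]|/v0 -> //].
  rewrite vE // -lt0n => /(ord_gt0 (factorial_unif hF hp) x0); rewrite e.
  have [_ [nu pM]] := hp.
  move/pM => [/(divides_unit hu)//|/(prime_divides_prod hp) [q qs pq]].
  have hq := (Forall_mem _ _).1 hs q qs.
  rewrite -(prime_divides_assoc hp hq pq).
  elim: s qs {e hs} => //= r s IH; rewrite inE => /orP[/eqP ->|/IH h]; [by left | by right].
have [u [s [hu [hs e]]]] := hF y y0.
elim: s y x y0 x0 hs e => [|q s IH] y x y0 x0 hs e le.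
  by rewrite e big_nil mulr1; apply: unit_divides.
have hq := (Forall_mem _ _).1 hs q (mem_head _ _); have huq := factorial_unif hF hq.
have ey : y = q * (u * \prod_(i <- s) i) by rewrite e big_cons; ring.
have [x' ex] : divides q x.
  apply/(ord_gt0 huq x0); apply: leq_trans (_ : (0 < ord (divides q) y)%N) _.
    by apply/(ord_gt0 huq y0); rewrite ey; apply/divides_mulr/divides_refl.
  by have := le (divides q); rewrite vE.
have q0 : q != 0 by case: hq.
have x'0 : x' != 0 by apply: contraNneq x0 => h; rewrite ex h mul0r.
have y'0 : u * \prod_(i <- s) i != 0.
  by apply: contraNneq y0 => h; rewrite ey h mulr0.
rewrite ey ex [x' * q]mulrC; apply: divides_mul2l; apply: IH => //.
  by apply/Forall_mem => x'' xs; apply: ((Forall_mem _ _).1 hs); rewrite inE xs orbT.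
by move=> P; have := le P; rewrite ey ex (valM (v_val P) q0 y'0) (valM (v_val P) x'0 q0) addnC leq_add2r.
Qed.

Definition all_principal : Prop :=
  forall D : (R -> Prop) -> int, is_divisor D -> is_principal D.

(** A height-one prime contains a prime factor of any of its nonzero elements and is generated by
    it; an effective divisor is then that of a product of such generators. *)
Lemma factorial_all_principal : factorial -> all_principal.
Proof.
move=> hF; have kR := factorial_Krull hF; have hv := is_val_hord kR.
have gen P : height_one P -> exists p, p != 0 /\
    forall Q, height_one Q -> hord Q p = (`[< Q = P >] : nat).
  move=> hP; have [primeP [[x [x0 Px]] _]] := hP.
  have [u [s [hu [hs ex]]]] := hF x x0; rewrite ex in Px.
  have [q qs Pq] : exists2 q, q \in s & P q.
    have [_ [n1 PM']] := primeP; case: (PM' _ _ Px) => [Pu|].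
      by case: hu => u' eu; case: n1; rewrite -eu; apply: ideal_mull.
    elim: s {hs ex Px} => [|q s IH]; first by rewrite big_nil => /n1.
    rewrite big_cons => /PM' [Pq|/IH [q' qs Pq]]; first by exists q; rewrite ?inE ?eqxx.
    by exists q' => //; rewrite inE qs orbT.
  have hq := (Forall_mem _ _).1 hs q qs; exists q; split; first by case: hq.
  move=> Q hQ; case: asboolP => [->|QP]; first exact: hord_prime_elt.
  have [q0 _] := hq; case: (posnP (hord Q q)) => // /(hord_gt0 kR hQ q0) Qq.
  by case: QP; rewrite (height_one_prime_elt hq hQ Qq) (height_one_prime_elt hq hP Pq).
move=> D hD; have [b [b0 hb]] := divisor_bounded kR hD.
suff [a [a0 ha]] : exists a, a != 0 /\
    forall P, height_one P -> D P + (hord P b)%:Z = (hord P a)%:Z.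
  apply/(principalP kR); exists a, b; do 2!split=> //; move=> P hP.
  by rewrite -ha // addrK.
have [l hl] : exists l, forall P, height_one P -> D P + (hord P b)%:Z != 0 -> List.In P l.
  have [_ [l1 hl1]] := hD; have [l2 hl2] := (krull_hord kR).2.1 b b0.
  exists (l1 ++ l2) => P hP ne; apply: In_cat.
  have [e|h] := eqVneq (D P) 0; last by left; apply: hl1.
  by right; apply: hl2; apply: contraNneq ne => h; rewrite e h.
suff main (l' : seq (R -> Prop)) (E : (R -> Prop) -> int) : (forall P, 0 <= E P) ->
    (forall P, height_one P -> E P != 0 -> List.In P l') ->
    exists a, a != 0 /\ forall P, height_one P -> E P = (hord P a)%:Z.
  exact: main hb hl.
elim: l' E => [|P l' IH] D' D0 hl'.
  exists 1; rewrite oner_neq0; split=> // P hP; rewrite val1 //.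
  by apply: contrapT => /eqP /(hl' _ hP).
case: (pselect (height_one P)) => hP; last first.
  by apply: IH => // Q hQ /(hl' _ hQ) [e|//]; case: hP; rewrite e.
have [p [p0 hp]] := gen P hP.
(* The coefficient at P is set to 0 before recursing, so repeated entries of the list do no harm. *)
have [||a [a0 ha]] := IH (fun Q => if pselect (Q = P) then 0 else D' Q).
- by move=> Q; case: pselect => ? /=; [exact: lexx | exact: D0].
- move=> Q hQ; case: pselect => [//|QP] /=.
  by move=> /(hl' _ hQ) [/esym|].
exists (a * p ^+ absz (D' P)); rewrite mulf_neq0 ?expf_neq0 //; split=> // Q hQ.
rewrite valM ?expf_neq0 // valX // hp //; have := ha Q hQ.
case: pselect => /= [eQ|QP] e; case: asboolP => // _; last by rewrite muln0 addn0.
by rewrite eQ in e *; rewrite muln1; have := D0 P; lia.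
Qed.

(** Principality of the divisor of a single P yields a prime generator of P. A nonunit lies in some
    P, and dividing by its generator lowers the total order, on which the induction runs. *)
Lemma all_principal_factorial : Krull R -> all_principal -> factorial.
Proof.
move=> kR hD; have hv := is_val_hord kR; have kv := krull_hord kR.
have gen P : height_one P -> exists p, prime_elt p /\ P = divides p.
  move=> hP; have [|a [b [a0 [b0 h]]]] := (principalP kR _).1 (hD (fun Q => (`[< Q = P >] : nat)%:Z) _).
    split=> [Q hQ|]; first by case: asboolP => // e; case: hQ; rewrite e.
    by exists [:: P] => Q; case: asboolP => // ->; left.
  have [p ea] : divides b a.
    apply: kv.2.2 => // Q; case: (pselect (height_one Q)) => hQ; last by rewrite !(hord_out _ hQ).
    by have := h Q hQ; lia.
  have p0 : p != 0 by apply: contraNneq a0 => p0; rewrite ea p0 mul0r.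
  have hp Q : height_one Q -> hord Q p = (`[< Q = P >] : nat).
    move=> hQ; have := h Q hQ; rewrite ea (valM (hv Q)) //.
    by case: asboolP => _ /=; lia.
  have eP : P = divides p.
    apply/funext => x; apply/propext; split=> [Px|]; last first.
      have [primeP _] := hP => px; apply: (ideal_divides primeP px).
      by apply/(hord_gt0 kR hP p0); rewrite hp //; case: asboolP.
    have [->|x0] := eqVneq x 0; first exact: divides0.
    apply: kv.2.2 => // Q; case: (pselect (height_one Q)) => hQ; last by rewrite !(hord_out _ hQ).
    by rewrite hp //; case: asboolP => // ->; apply/(hord_gt0 kR).
  exists p; split=> //; have [[_ [n1 PM]] _] := hP; rewrite eP in n1 PM.
  by split=> //; split=> // -[q e]; apply: n1; exists q; rewrite mulrC.
move=> x x0; have [l hl] := kv.2.1 x x0.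
move: {2}(\sum_(P <- l) hord P x)%N.+1 (ltnSn (\sum_(P <- l) hord P x)%N) => n.
elim: n x x0 hl => // n IH x x0 hl lt.
case: (pselect (is_unit x)) => hx.
  by exists x, [::]; rewrite big_nil mulr1; split=> //; split=> //; constructor.
(* A nonunit x does not divide 1, so it has positive order at some P. *)
have [|P [q [hq ltP]]] := exists_unif_ord_lt kv (oner_neq0 R) x0.
  by case=> q e; apply: hx; exists q; rewrite mulrC -e.
have hP := unif_height_one hq; have [p [hp eP]] := gen P hP.
have xP : (0 < hord P x)%N by rewrite hordE //; apply: leq_trans ltP.
have [y ey] : divides p x by rewrite -eP; apply/(hord_gt0 kR).
have y0 : y != 0 by apply: contraNneq x0 => y0; rewrite ey y0 mul0r.
have [p0 _] := hp; have vx Q : hord Q x = (hord Q y + hord Q p)%N by rewrite ey valM.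
have pP : hord P p = 1%N by apply: hord_prime_elt => //; rewrite eP; apply: divides_refl.
have [||u [s [hu [hs e]]]] := IH y y0.
- by move=> Q yQ; apply: hl; rewrite vx addn_eq0 negb_and yQ.
- rewrite -ltnS; apply: leq_trans lt; rewrite ltnS; apply: (@In_sum_lt _ _ _ _ P).
  + by move=> Q; rewrite vx leq_addr.
  + by apply: hl; rewrite -lt0n.
  + by rewrite vx pP addn1.
exists u, (p :: s); split=> //; split; first by constructor.
by rewrite ey e big_cons; ring.
Qed.

End Factorial.

(** * Factoriality through class groups, and the conclusion *)

Lemma class_group_trivial (R : idomainType) (G : zmodType) : class_group_iso R G ->
  all_principal R <-> forall g : G, g = 0.
Proof.
move=> [phi [_ [surj ker]]]; split=> [h g|h D hD]; last exact/ker.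
by have [D [hD <-]] := surj g; apply/ker => //; apply: h.
Qed.

Lemma UFD_iff (R : idomainType) : is_UFD R <-> Krull R /\ all_principal R.
Proof.
split=> [/UFD_factorial h|[kR h]].
  by split; [exact: factorial_Krull | exact: factorial_all_principal].
exact/factorial_UFD/all_principal_factorial.
Qed.

Lemma grp_iso_sym (G H : zmodType) : grp_iso G H -> grp_iso H G.
Proof.
move=> [h [hD [g hK gK]]]; exists g; split; last by exists h.
by move=> x y; apply: (can_inj hK); rewrite hD !gK.
Qed.

Lemma grp_iso_trivial (G H : zmodType) : grp_iso G H ->
  (forall g : G, g = 0) -> forall k : H, k = 0.
Proof.
move=> [h [hD [g _ gK]]] triv k; rewrite -(gK k) (triv (g k)).
by apply: (@addrI _ (h 0)); rewrite -hD !addr0.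
Qed.

Lemma grp_iso_prodl (G H G' : zmodType) : grp_iso G H -> grp_iso (G * G')%type (H * G')%type.
Proof.
move=> [h [hD [g hK gK]]]; exists (fun p : G * G' => (h p.1, p.2)); split.
  by move=> x y; rewrite /= hD.
by exists (fun p : H * G' => (g p.1, p.2)) => -[x y] /=; rewrite ?hK ?gK.
Qed.

Theorem theorem3p8 (A : idomainType) (F : A) (c : nat)
  (B : comPzRingType) (iota : {rmorphism A -> B}) (z : B) :
  F != 0 -> (0 < c)%N ->
  presents iota z c F ->
  (exists Ad : int -> A -> Prop, Zgrading Ad /\
     exists d : int, Ad d F /\ coprime c `|d|%N) ->
  is_domain B /\
  (exists (K : fieldType) (fA : {rmorphism A -> K}) (fB : {rmorphism B -> K}),
     is_frac_field fA /\ is_frac_field fB) /\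
  (prime_elt F ->
     (is_Krull A <-> is_Krull B) /\
     (is_Krull A -> is_Krull B ->
        (exists (GA GB HA HB : zmodType),
           class_group_iso A GA /\ class_group_iso B GB /\
           grp_iso (GA * GA)%type (GB * HB)%type /\
           grp_iso (GB * GB)%type (GA * HA)%type) /\
        (forall GA GB : zmodType, class_group_iso A GA -> class_group_iso B GB ->
           fin_gen GA \/ fin_gen GB -> grp_iso GA GB)) /\
     (is_UFD A <-> is_UFD B)).
Proof.
move=> F0 c0 hp grad.
have [Ad [d [fB [hA [AF [cd [ffB [fB_hom fB_surj]]]]]]]] := presentation_embedding F0 c0 hp grad.
have ff := tofrac_is_frac A.
have domB : is_domain B.
  split=> [|x y e]; first by apply/eqP => /(congr1 fB)/eqP; rewrite rmorph1 rmorph0 oner_eq0.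
  have /eqP := congr1 fB e; rewrite rmorphM rmorph0 mulf_eq0.
  by move=> /orP[] /eqP h; [left | right]; apply: ffB.1; rewrite h rmorph0.
split=> //; split; first by exists {fraction A}, (@FracField.tofrac A), fB.
(* B is known to be a domain only through its embedding, so it receives the structure of an integral
   domain here. *)
have [B' eB] := domain_idomain domB; subst B => pF.
have KA : is_Krull A <-> Krull A by split; [exact: is_Krull_Krull | exact: Krull_is_Krull ff].
have KB : is_Krull B' <-> Krull B' by split; [exact: is_Krull_Krull | exact: Krull_is_Krull ffB].
have up kA := Krull_ascent c0 F0 hp hA AF cd kA pF ff ffB fB_hom fB_surj.
have down := Krull_descent c0 hp.
have iso GA GB : Krull A -> class_group_iso A GA -> class_group_iso B' GB -> grp_iso GA GB.
  move=> kA; apply: (class_groups_iso c0 F0 hp hA AF cd kA (up kA) pF) => E a nE hE ha.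
  exact: (vle_imset c0 F0 hp hA AF cd kA pF ff ffB fB_hom fB_surj nE hE ha).
split; first by split=> [/KA/up/KB|/KB/down/KA].
split.
  move=> /KA kA /KB kB; split=> [|GA GB hGA hGB _]; last exact: iso hGB.
  have [GA hGA] := class_group_exists kA; have [GB hGB] := class_group_exists kB.
  (* As GA and GB are isomorphic, GA serves as complement of GB in GA * GA, and GB as complement of
     GA in GB * GB. *)
  have i := iso GA GB kA hGA hGB; exists GA, GB, GB, GA; do 2!split=> //.
  by split; apply: grp_iso_prodl => //; apply: grp_iso_sym.
have transfer : Krull A -> all_principal A <-> all_principal B'.
  move=> kA; have [GA hGA] := class_group_exists kA.
  have [GB hGB] := class_group_exists (up kA); have i := iso GA GB kA hGA hGB.
  rewrite (class_group_trivial hGA) (class_group_trivial hGB).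
  by split; apply: grp_iso_trivial => //; apply: grp_iso_sym.
by split=> /UFD_iff [k /transfer h]; apply/UFD_iff; split; [exact: up | exact: h | exact: down | apply: h; exact: down].
Qed.
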